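(* Let $d=2n$ be an even positive integer and let $F$ be a compactly supported distribution on $\mathbb{R}^d$. Let $\mathbf{H}_F$ be the matrix with entries $\langle F,f_\alpha\overline{f_\beta}\rangle$, where $(f_\alpha)$ runs over a system of harmonic polynomials on $\mathbb{R}^d$ spanning the space of all harmonic polynomials. Suppose $\mathbf{H}_F$ has rank $m<\infty$. Then $F=\sum_{q=1}^{m_0}L_q\delta(x-x_q)$ with $m_0\le m$, points $x_q\in\mathbb{R}^d$, and $L_q$ linear differential operators with constant coefficients on $\mathbb{R}^d$.
   Context: $\langle F,\phi\rangle$ denotes the action of $F$ on a smooth function $\phi$. The rank of $\mathbf{H}_F$ does not depend on the choice of the spanning system of harmonic polynomials. *)

(* Defs.v *)
From HB Require Import structures.
From mathcomp Require Import all_boot all_order all_algebra.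
From mathcomp Require Import all_classical all_reals all_analysis.
From mathcomp Require Export complex.
Set Implicit Arguments. Unset Strict Implicit. Unset Printing Implicit Defensive.
Import Order.TTheory GRing.Theory Num.Theory.
Import numFieldNormedType.Exports.
Local Open Scope ring_scope.
Local Open Scope complex_scope.

Section Distributions.
Variables (R : realType) (d : nat).

Definition e (i : 'I_d) : 'rV[R]_d := delta_mx 0 i.

Definition partial (i : 'I_d) (f : 'rV[R]_d -> R) : 'rV[R]_d -> R :=
  fun x => 'D_(e i) f x.

Definition dseq (s : seq 'I_d) (f : 'rV[R]_d -> R) : 'rV[R]_d -> R :=
  foldr partial f s.

Definition smooth (f : 'rV[R]_d -> R) : Prop :=
  forall s : seq 'I_d, continuous (dseq s f) /\
    forall (i : 'I_d) (x : 'rV[R]_d), derivable (dseq s f) x (e i).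

Definition dmulti (a : 'I_d -> nat) (f : 'rV[R]_d -> R) : 'rV[R]_d -> R :=
  dseq (flatten [seq nseq (a i) i | i <- enum 'I_d]) f.

(* A compactly supported (complex) distribution, given by its action on real
   smooth test functions (the action on complex test functions u + i v is
   <F,u> + i <F,v>): it is linear, and continuous for the topology of
   C^infinity(R^d), i.e. there are C, a ball of radius r and an order N with
   |<F,phi>| <= C * max_{|s| <= N} sup_{|x| <= r} |D^s phi (x)|. *)
Definition compact_distribution (F : ('rV[R]_d -> R) -> R[i]) : Prop :=
  (forall (a : R) (f g : 'rV[R]_d -> R), smooth f -> smooth g ->
      F (fun x => a * f x + g x) = a%:C * F f + F g) /\
  exists (C r : R) (N : nat), 0 <= C /\
    forall phi, smooth phi ->
    forall M : R,
      (forall s : seq 'I_d, (size s <= N)%N ->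
         forall x : 'rV[R]_d, `|x| <= r -> `|dseq s phi x| <= M) ->
      `|F phi| <= (C * M)%:C.

Definition pairing (F : ('rV[R]_d -> R) -> R[i]) (h : 'rV[R]_d -> R[i]) : R[i] :=
  F (fun x => complex.Re (h x)) + Complex 0 1 * F (fun x => complex.Im (h x)).

Definition cpoly (p : 'rV[R]_d -> R[i]) : Prop :=
  exists (N : nat) (c : {ffun 'I_d -> 'I_N} -> R[i]),
    forall x : 'rV[R]_d,
      p x = \sum_(a : {ffun 'I_d -> 'I_N}) c a * \prod_(i < d) ((x 0 i)%:C ^+ a i).

Definition laplacian (f : 'rV[R]_d -> R) : 'rV[R]_d -> R :=
  fun x => \sum_(i < d) partial i (partial i f) x.

Definition harmonic_poly (p : 'rV[R]_d -> R[i]) : Prop :=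
  cpoly p /\ forall x : 'rV[R]_d,
    laplacian (fun y => complex.Re (p y)) x = 0 /\ laplacian (fun y => complex.Im (p y)) x = 0.

Definition Hsub (F : ('rV[R]_d -> R) -> R[i]) (k l : nat)
    (f : 'I_k -> 'rV[R]_d -> R[i]) (g : 'I_l -> 'rV[R]_d -> R[i]) : 'M[R[i]]_(k, l) :=
  \matrix_(a < k, b < l) pairing F (fun x => f a x * (g b x)^*%C).

(* H_F (over the spanning system of all harmonic polynomials) has rank m:
   the rank of an infinite matrix is the supremum of ranks of its finite
   submatrices, and here this supremum is attained and equals m. *)
Definition HF_rank (F : ('rV[R]_d -> R) -> R[i]) (m : nat) : Prop :=
  (forall (k l : nat) (f : 'I_k -> 'rV[R]_d -> R[i]) (g : 'I_l -> 'rV[R]_d -> R[i]),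
      (forall a, harmonic_poly (f a)) -> (forall b, harmonic_poly (g b)) ->
      (\rank (Hsub F f g) <= m)%N) /\
  exists (k l : nat) (f : 'I_k -> 'rV[R]_d -> R[i]) (g : 'I_l -> 'rV[R]_d -> R[i]),
    (forall a, harmonic_poly (f a)) /\ (forall b, harmonic_poly (g b)) /\
    \rank (Hsub F f g) = m.

(* action of L delta(. - x0) on phi, where L = sum_a c_a D^a is a constant
   coefficient differential operator (multi-indices a with entries < N):
   <D^a delta_{x0}, phi> = (-1)^{|a|} D^a phi (x0). *)
Definition Ldelta (N : nat) (c : {ffun 'I_d -> 'I_N} -> R[i]) (x0 : 'rV[R]_d)
    (phi : 'rV[R]_d -> R) : R[i] :=
  \sum_(a : {ffun 'I_d -> 'I_N})
     c a * ((-1) ^+ (\sum_(i < d) (a i : nat)) * dmulti (fun i => a i : nat) phi x0)%:C.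

End Distributions.

(* Main.v *)
Require Import Defs.
From HB Require Import structures.
From mathcomp Require Import all_boot all_order all_algebra.
From mathcomp Require Import all_classical all_reals all_analysis.
From mathcomp Require Import complex.
Import Order.TTheory GRing.Theory Num.Theory.
Import numFieldNormedType.Exports.
Local Open Scope ring_scope.
From mathcomp Require Import perm ring lra zify.
Set Implicit Arguments. Unset Strict Implicit. Unset Printing Implicit Defensive.

(* Identify R^(2n) with C^n. Holomorphic polynomials are harmonic, so the forms
   <F, f conj(g)> on holomorphic polynomials f, g have finite rank r. Inserting
   exp(t z_j) conj(exp(- t z_j)), which has modulus 1, multiplies these numbers by a
   polynomially bounded factor, while a rank factorization splits every r x r
   determinant of the twisted form into (entire function of t) times (conjugate of
   an entire function of t); the product of the two entire functions grows
   polynomially, so by Liouville it is a polynomial in t of bounded degree.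
   Cramer's rule then expresses <F, z_j^k f conj(g)>, for all k, through finitely
   many functionals of f. Iterating over the coordinates and conjugating, the
   functionals P F, for P a polynomial, span a finite-dimensional space, so F is
   killed by a nonzero polynomial in every real coordinate. Polynomials are dense
   in the smooth functions, so the factors without real roots can be divided out,
   and Hermite interpolation at the real roots writes F as a finite sum of
   derivatives of Dirac masses. Finally, multiplying by holomorphic polynomials
   that vanish to high order at all points but one produces a diagonal submatrix
   with one nonzero entry per point, which bounds the number of points by m.

   Only truncated exponentials are used: the product of the truncations at w and
   - w is 1 up to a tail of the exponential series. *)

(** * Finite rank and the shift lemma *)

(** Finite rank alone says nothing about multiplication by z_j: the f with <F, f conj(g)> = 0 for
    all g form a subspace of finite codimension, but a priori not an ideal, so the quotient carries
    no multiplication operator. The missing information has to come from the compact support.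
    Inserting exp(t z_j) alone would only give growth like exp(c |t|), with c the size of the
    support. In the unimodular combination just the derivatives in the order of F produce powers of
    |t|, so the degree left by Liouville's theorem depends on that order and on the rank only. The
    second factor is antiholomorphic in t, but only the modulus of the determinant is estimated, so
    its conjugate can be put in its place. The functionals are computed on polynomials, whereas
    dividing out a factor without real roots leads to smooth functions that are not polynomials.
    Density is therefore needed in the topology in which F is continuous: all derivatives up to a
    given order, uniformly on balls. *)

Section Cauchy.
Variable C : numClosedFieldType.

(** Repeated square roots of -1: the order of such a root divides the power of two but not its half.
    Orders that are powers of two are enough, since the discrete Cauchy formula below works for
    every sufficiently large order. *)
Lemma prim_root_exp2 (k : nat) : exists w : C, (2 ^ k.+1).-primitive_root w.
Proof.
have [w hw] : exists w : C, w ^+ (2 ^ k) = -1.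
  elim: k => [|k [w hw]]; first by exists (-1); rewrite expn0 expr1.
  by exists (sqrtC w); rewrite expnS exprM sqrtCK.
exists w.
have w1 : w ^+ (2 ^ k.+1) = 1 by rewrite expnSr exprM hw sqrrN expr1n.
have [m mp md] := prim_order_exists (expn_gt0 2 k.+1) w1.
suff -> : (2 ^ k.+1 = m)%N by [].
have /(dvdn_pfactor _ _ (isT : prime 2)) [l lk em] := md.
move: lk; rewrite leq_eqVlt => /orP[/eqP <- //|]; rewrite ltnS => lk.
have : w ^+ (2 ^ k) = 1.
  by apply/eqP; rewrite -(prim_order_dvd mp) em dvdn_exp2l.
rewrite hw => /eqP; rewrite eq_sym -subr_eq0 opprK.
by rewrite -mulr2n pnatr_eq0.
Qed.

(** The integral over the circle is replaced by an average over M-th roots of unity, which extracts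
    the coefficient exactly once M is at least [size P] and greater than [k]. *)
Lemma cauchy_estimate (P : {poly C}) (rho K : C) (k : nat) : 0 <= rho ->
  (forall t : C, `|t| = rho -> `|P.[t]| <= K) -> `|P`_k| * rho ^+ k <= K.
Proof.
move=> rho0 hP.
have [N hN] : exists N, (maxn k.+1 (size P) <= 2 ^ N.+1)%N.
  by exists (maxn k.+1 (size P)); apply/ltnW/ltnW/ltn_expl.
have [w hw] := prim_root_exp2 N.
move: (2 ^ N.+1)%N hN hw => M hN hw.
have M0 : (0 < M)%N by exact: prim_order_gt0 hw.
have w_n0 : w != 0.
  apply/eqP => w0; have := prim_expr_order hw.
  by rewrite w0 expr0n gtn_eqF// => /eqP; rewrite eq_sym oner_eq0.
have nw : `|w| = 1.
  apply/eqP; rewrite -(@pexpr_eq1 _ `|w| M) //.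
  by rewrite -normrX (prim_expr_order hw) normr1.
(* Orthogonality: for l different from k the terms are the powers of [v], an M-th root of unity
   other than 1, so the geometric sum vanishes. *)
have geo l : (l < M)%N -> \sum_(j < M) (w ^+ j) ^+ l * (w ^- j) ^+ k
             = if l == k then M%:R else 0.
  move=> lM; have kM : (k < M)%N by move: hN; rewrite geq_max => /andP[].
  case: eqP => [->|lk].
    rewrite (eq_bigr (fun=> 1)); last first.
      by move=> j _; rewrite -exprMn divff ?expf_neq0// expr1n.
    by rewrite sumr_const card_ord.
  pose v := w ^+ l / w ^+ k.
  rewrite (eq_bigr (fun j : 'I_M => v ^+ j)); last first.
    by move=> j _; rewrite /v exprMn -!exprM -!exprVn -!exprM mulnC [(j * k)%N]mulnC.
  have v1 : v != 1.
    rewrite /v; apply/eqP => /(congr1 ( *%R^~ (w ^+ k))).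
    rewrite divfK ?expf_neq0// mul1r => /eqP.
    by rewrite (eq_prim_root_expr hw) !modn_small// => /eqP.
  apply: (mulfI (_ : v - 1 != 0)); first by rewrite subr_eq0.
  rewrite mulr0 -subrX1 /v exprMn -!exprVn -!exprM mulnC [(k * M)%N]mulnC !exprM.
  by rewrite exprVn (prim_expr_order hw) invr1 !expr1n mulr1 subrr.
have sumP : \sum_(j < M) P.[rho * w ^+ j] * (w ^- j) ^+ k = M%:R * (P`_k * rho ^+ k).
  have e j : P.[rho * w ^+ j] = \sum_(l < M) P`_l * (rho * w ^+ j) ^+ l.
    by apply: horner_coef_wide; move: hN; rewrite geq_max => /andP[].
  under eq_bigr do rewrite e mulr_suml.
  rewrite exchange_big /=.
  transitivity (\sum_(l < M) P`_l * rho ^+ l * (if l == k :> nat then M%:R else 0)).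
    apply: eq_bigr => l _; rewrite -geo ?ltn_ord// mulr_sumr; apply: eq_bigr => j _.
    by rewrite exprMn !mulrA.
  have kM : (k < M)%N by move: hN; rewrite geq_max => /andP[].
  rewrite (bigD1 (Ordinal kM)) //= eqxx big1 ?addr0 => [|l lk]; first by rewrite mulrC.
  by rewrite ifN ?mulr0.
have : M%:R * (`|P`_k| * rho ^+ k) <= M%:R * K.
  have -> : M%:R * (`|P`_k| * rho ^+ k) = `|M%:R * (P`_k * rho ^+ k)|.
    by rewrite !normrM normrX (ger0_norm rho0) normr_nat.
  rewrite -sumP (le_trans (ler_norm_sum _ _ _))//.
  rewrite [leRHS]mulr_natl -[X in _ *+ X](card_ord M) -sumr_const; apply: ler_sum => j _.
  rewrite normrM !(normrX, normfV) nw !expr1n invr1 expr1n mulr1; apply: hP.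
  by rewrite normrM normrX nw expr1n mulr1 ger0_norm.
by rewrite ler_pM2l // ltr0n.
Qed.

(** The [P n] play the role of truncations of an entire series: only the coefficients below [n] are
    settled, and on each disc the growth bound holds from some [n] on. *)
Lemma liouville_truncated (P : nat -> {poly C}) (M : nat) (K : C) :
  (forall k n n', (k < n)%N -> (k < n')%N -> (P n)`_k = (P n')`_k) ->
  0 <= K ->
  (forall rho : C, 0 <= rho -> exists n0, forall n, (n0 <= n)%N ->
     forall t : C, `|t| <= rho -> `|(P n).[t]| <= K * (1 + rho) ^+ M) ->
  forall k n, (M < k)%N -> (k < n)%N -> (P n)`_k = 0.
Proof.
move=> hst K0 hgr k n Mk kn; apply/eqP; apply: contraT => cn0.
set c := `|(P n)`_k|; have c0 : 0 < c by rewrite normr_gt0.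
(* Then [c * rho] is [K * 2 ^+ M + c], too large by [c]. The summand 1 also gives [1 <= rho], hence
   1 + rho <= 2 rho. *)
pose rho := K * 2 ^+ M / c + 1.
have rho1 : 1 <= rho by rewrite lerDr divr_ge0 ?mulr_ge0 ?exprn_ge0 ?ler0n// ltW.
have rho0 : 0 <= rho by exact: le_trans rho1.
have [n0 hn0] := hgr _ rho0.
have {hn0} : c * rho ^+ k <= K * (1 + rho) ^+ M.
  rewrite /c (hst k n (maxn n0 k.+1)) ?leq_max ?leqnn ?orbT//.
  by apply: cauchy_estimate => // t ht; apply: hn0; rewrite ?leq_max ?leqnn ?ht.
have h2 : K * (1 + rho) ^+ M <= K * 2 ^+ M * rho ^+ M.
  have r12 : 1 + rho <= 2%:R * rho by rewrite mulr_natl mulr2n lerD2r.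
  rewrite -mulrA -exprMn ler_wpM2l//; apply: lerXn2r r12.
    by rewrite nnegrE addr_ge0.
  by rewrite nnegrE mulr_ge0.
move=> /le_trans /(_ h2).
rewrite -(subnK (ltnW Mk)) exprD mulrA ler_pM2r ?exprn_gt0 ?(lt_le_trans _ rho1)//.
have : c * rho <= c * rho ^+ (k - M).
  by rewrite ler_pM2l// -{1}[rho]expr1 ler_weXn2l// subn_gt0.
move=> /le_trans h /h{h}.
rewrite /rho mulrDr mulr1 mulrC divfK ?gt_eqF// gerDl.
by rewrite lt_geF.
Qed.

End Cauchy.

Lemma ord0_false (o : 'I_0) : False.
Proof. by case: o. Qed.

(** * Matrices of finite rank with arbitrary index types *)

Section FiniteRank.
Variable K : fieldType.

Definition rank_le (I J : Type) (B : I -> J -> K) (m : nat) : Prop :=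
  forall k l (i : 'I_k -> I) (j : 'I_l -> J),
    (\rank (\matrix_(a, b) B (i a) (j b)) <= m)%N.

Lemma rank_le_factor (I J : Type) (B : I -> J -> K) (A : finType)
    (lam : I -> A -> K) (mu : J -> A -> K) :
  (forall i j, B i j = \sum_a lam i a * mu j a) -> rank_le B #|A|.
Proof.
move=> hB k l i j.
have -> : \matrix_(a, b) B (i a) (j b) =
  (\matrix_(a < k, b < #|A|) lam (i a) (enum_val b)) *m
  (\matrix_(a < #|A|, b < l) mu (j b) (enum_val a)).
  apply/matrixP => a b; rewrite !mxE hB (reindex (enum_val (A := A))).
    by apply: eq_bigr => c _; rewrite !mxE.
  by apply: onW_bij; exact: enum_val_bij.
by rewrite (leq_trans (mxrankM_maxl _ _))// rank_leq_col.
Qed.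

(** A maximal invertible square submatrix, bordered by one more row and column, becomes singular;
    its Schur complement is zero, which expresses every row through the rows [i0]. The normalization
    of [lam] will make a determinant equal to 1. *)
Lemma rank_factor (I J : Type) (B : I -> J -> K) (m : nat) : rank_le B m ->
  exists (r : nat) (i0 : 'I_r -> I) (j0 : 'I_r -> J) (lam : I -> 'I_r -> K),
    [/\ (r <= m)%N, (\matrix_(a, b) B (i0 a) (j0 b)) \in unitmx,
        forall a b, lam (i0 a) b = (a == b)%:R &
        forall i j, B i j = \sum_a lam i a * B (i0 a) j].
Proof.
move=> hB.
pose P r := `[< exists (i0 : 'I_r -> I) (j0 : 'I_r -> J),
  (\matrix_(a, b) B (i0 a) (j0 b)) \in unitmx >].
have exP : exists r, P r.
  exists 0%N; apply/asboolP.
  exists (fun o => False_rect _ (ord0_false o)), (fun o => False_rect _ (ord0_false o)).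
  by rewrite unitmxE det_mx00 unitr1.
have ubP r : P r -> (r <= m)%N.
  by move=> /asboolP[i0 [j0 u]]; rewrite -(mxrank_unit u); exact: hB.
have [r /asboolP[i0 [j0 u]] rmax] := ex_maxnP exP ubP.
set B0 := \matrix_(a, b) _ in u.
exists r, i0, j0, (fun i a => ((\row_b B i (j0 b)) *m invmx B0) 0 a).
split.
- by apply: ubP; apply/asboolP; exists i0, j0.
- exact: u.
- move=> a b; have -> : \row_b' B (i0 a) (j0 b') = row a B0 by apply/rowP => ?; rewrite !mxE.
  by rewrite -row_mul mulmxV// !mxE.
move=> i j.
pose c := \row_b B i (j0 b); pose e := \col_a B (i0 a) j.
pose i1 (k : 'I_(r + 1)) := match fintype.split k with inl a => i0 a | inr _ => i end.
pose j1 (k : 'I_(r + 1)) := match fintype.split k with inl a => j0 a | inr _ => j end.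
have eB : \matrix_(a, b) B (i1 a) (j1 b) = block_mx B0 e c (B i j)%:M.
  apply/matrixP => a b; rewrite mxE /i1 /j1 /block_mx /col_mx /row_mx !mxE.
  by case: (fintype.split a) => a'; rewrite mxE; case: (fintype.split b) => b';
    rewrite !mxE// !ord1.
pose s := (B i j)%:M - c *m invmx B0 *m e : 'M[K]_1.
have eB2 : block_mx B0 e c (B i j)%:M =
    block_mx B0 0 c 1%:M *m block_mx 1%:M (invmx B0 *m e) 0 s.
  rewrite mulmx_block !mulmx1 !mulmx0 !mul0mx !mul1mx !addr0 mulmxA mulmxV// mul1mx.
  by rewrite /s mulmxA addrC subrK.
have : ~~ (block_mx B0 e c (B i j)%:M \in unitmx).
  apply/negP => u1; have /rmax : P (r + 1)%N.
    by apply/asboolP; exists i1, j1; rewrite eB.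
  by rewrite addn1 ltnn.
rewrite eB2 unitmxE det_mulmx det_lblock det_ublock !det1 mulr1 mul1r unitrM.
rewrite -unitmxE u /= unitfE negbK /s det_mx11 !mxE /= mulr1n subr_eq0 => /eqP ->.
by apply: eq_bigr => a _; congr (_ * _); rewrite !mxE.
Qed.
End FiniteRank.

(** * Determinants of truncated power series *)

Section TruncatedDeterminants.
Variable K : comNzRingType.

(** Congruence modulo the power [k.+1] of the variable, so that truncations of different lengths can
    stand for one power series. *)
Definition eq_upto (k : nat) (p q : {poly K}) := forall l, (l <= k)%N -> p`_l = q`_l.

Lemma eq_uptoM k p p' q q' : eq_upto k p p' -> eq_upto k q q' -> eq_upto k (p * q) (p' * q').
Proof.
move=> hp hq l lk; rewrite !coefM; apply: eq_bigr => i _.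
by rewrite hp ?hq// (leq_trans _ lk)// ?leq_subr// -ltnS ltn_ord.
Qed.

Lemma eq_upto_det k r (A A' : 'M[{poly K}]_r) :
  (forall a b, eq_upto k (A a b) (A' a b)) -> eq_upto k (\det A) (\det A').
Proof.
move=> h; rewrite /determinant.
apply: (big_ind2 (eq_upto k)) => //.
  by move=> p p' q q' hp hq l lk; rewrite !coefD hp ?hq.
move=> s _; apply: eq_uptoM => //.
by apply: (big_ind2 (eq_upto k)) => // p p' q q'; exact: eq_uptoM.
Qed.

(** Cramer's rule with the determinant kept on the left: it is applied to matrices of polynomials,
    where the determinant need not be invertible. *)
Lemma cramer_row r (A : 'M[K]_r) (v : 'rV[K]_r) :
  \det A *: v = \sum_b \det (\matrix_(a, c) (if a == b then v 0 c else A a c)) *: row b A.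
Proof.
have -> : \det A *: v = (v *m \adj A) *m A by rewrite -mulmxA mul_adj_mx mul_mx_scalar.
rewrite mulmx_sum_row; apply: eq_bigr => b _; congr (_ *: _).
rewrite mxE (expand_det_row _ b); apply: eq_bigr => a _.
rewrite !mxE eqxx; congr (_ * _); rewrite /cofactor; congr (_ * \det _).
by apply/matrixP => x y; rewrite !mxE eq_sym (negbTE (neq_lift _ _)).
Qed.

End TruncatedDeterminants.

Lemma det_norm_le (C : numDomainType) r (A : 'M[C]_r) (G : C) :
  (forall a b, `|A a b| <= G) -> `|\det A| <= r`!%:R * G ^+ r.
Proof.
move=> h; rewrite /determinant (le_trans (ler_norm_sum _ _ _))//.
apply: (@le_trans _ _ (\sum_(s : 'S_r) G ^+ r)); last first.
  by rewrite sumr_const card_Sn mulr_natl.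
apply: ler_sum => s _; rewrite normrM normr_sign mul1r normr_prod.
rewrite -[X in G ^+ X]card_ord -prodr_const; apply: ler_prod => i _.
by rewrite normr_ge0 h.
Qed.

(** * The shift lemma *)

Section Shift.
Variables (C : numClosedFieldType) (I J : Type) (B : I -> J -> C).
Variables (S : I -> I) (T : J -> J) (m M : nat).

(* The truncation of [B (exp (t S) i) (exp (- conj t T) j)]. *)
Definition twist (n : nat) (t : C) (i : I) (j : J) : C :=
  \sum_(a < n) \sum_(b < n)
    t ^+ a * (- t^* ) ^+ b / (a`! * b`!)%:R * B (iter a S i) (iter b T j).

(** For fixed [j], the series with coefficients B (iter k S i) j / k! satisfies a Cramer identity
    whose determinants are polynomials of degree at most [M * r], by Liouville. Hence [i] enters
    only through r (M r + 1) numbers, whatever [k] is. *)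
Lemma shift_finite_rank :
  rank_le B m ->
  (forall i j, exists2 K, 0 <= K & forall rho : C, 0 <= rho ->
     exists n0, forall n, (n0 <= n)%N -> forall t : C, `|t| <= rho ->
       `|twist n t i j| <= K * (1 + rho) ^+ M) ->
  exists m', rank_le (fun i (jk : J * nat) => B (iter jk.2 S i) jk.1) m'.
Proof.
move=> /rank_factor[r [i0 [j0 [lam [_ uB0 lam0 hB]]]]] hgr.
pose mu j (a : 'I_r) := B (i0 a) j.
pose l n i a : {poly C} := \poly_(k < n) (lam (iter k S i) a / k`!%:R).
(* The coefficients are conjugated so that [u] is a polynomial in t: [twist] contains its conjugate,
   a function of the conjugate of t. *)
pose u n j a : {poly C} := \poly_(k < n) ((mu (iter k T j) a)^* * (-1) ^+ k / k`!%:R).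
pose Lm n (i : 'I_r -> I) := \matrix_(a, b) l n (i a) b.
pose Um n := \matrix_(a, b) u n (j0 a) b.
pose P n i := \det (Lm n i) * \det (Um n).
have Pst i k n n' : (k < n)%N -> (k < n')%N -> (P n i)`_k = (P n' i)`_k.
  move=> kn kn'; apply: (eq_uptoM (k := k)) => //; apply: eq_upto_det => a b x xk;
  by rewrite !mxE !coef_poly !(leq_ltn_trans xk).
have PM i k n : (M * r < k)%N -> (k < n)%N -> (P n i)`_k = 0.
  have /choice[Kf hK] : forall ab : 'I_r * 'I_r, exists K, 0 <= K /\ forall rho : C, 0 <= rho ->
     exists n0, forall n, (n0 <= n)%N -> forall t : C, `|t| <= rho ->
       `|twist n t (i ab.1) (j0 ab.2)| <= K * (1 + rho) ^+ M.
    by move=> ab; have [K K0 hK] := hgr (i ab.1) (j0 ab.2); exists K.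
  pose K := \sum_ab Kf ab.
  have K0 : 0 <= K by apply: sumr_ge0 => ab _; have [] := hK ab.
  have leK ab : Kf ab <= K.
    by rewrite /K (bigD1 ab) //= lerDl; apply: sumr_ge0 => x _; have [] := hK x.
  move=> Mk kn; apply: (@liouville_truncated _ (P^~ i) (M * r) (r`!%:R * K ^+ r)) Mk kn.
  - exact: Pst.
  - by rewrite mulr_ge0 ?ler0n ?exprn_ge0.
  move=> rho rho0.
  have /choice[nf hnf] : forall ab : 'I_r * 'I_r, exists n0, forall n, (n0 <= n)%N ->
     forall t : C, `|t| <= rho ->
       `|twist n t (i ab.1) (j0 ab.2)| <= K * (1 + rho) ^+ M.
    move=> ab; have [_ /(_ _ rho0)[n0 h]] := hK ab; exists n0 => n' hn t ht.
    by rewrite (le_trans (h _ hn _ ht))// ler_wpM2r ?exprn_ge0 ?addr_ge0.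
  exists (\max_ab nf ab)%N => n' hn t ht.
  rewrite exprM -mulrA -exprMn.
  (* The twisted matrix is [Lm] at t times the conjugate transpose of [Um] at t, so its determinant
     has the modulus of [P]. *)
  have -> : `|(P n' i).[t]| = `|\det (\matrix_(a, b) twist n' t (i a) (j0 b))|.
    have -> : \matrix_(a, b) twist n' t (i a) (j0 b) =
       map_mx (horner_eval t) (Lm n' i) *m (map_mx Num.conj (map_mx (horner_eval t) (Um n')))^T.
      apply/matrixP => a b; rewrite !mxE.
      under [RHS]eq_bigr => c _.
        rewrite !mxE /horner_eval !horner_poly rmorph_sum mulr_suml /=; under eq_bigr do rewrite mulr_sumr.
        over.
      rewrite exchange_big /=; apply: eq_bigr => x _.
      rewrite exchange_big /=; apply: eq_bigr => y _.
      rewrite hB mulr_sumr; apply: eq_bigr => c _.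
      rewrite !rmorphM /= conjCK fmorphV !rmorphXn rmorphN1 rmorph_nat /mu /=.
      rewrite -[- t^* ]mulN1r exprMn invfM.
      move: (_^-1) (_^-1) ((-1) ^+ y) (t^* ^+ y) => u1 u2 u3 u4; ring.
    rewrite det_mulmx det_tr /P hornerM !normrM; congr (_ * _).
      by rewrite det_map_mx.
    by rewrite !det_map_mx norm_conjC.
  apply: det_norm_le => a b; rewrite mxE.
  by apply: (hnf (a, b)) => //; apply: leq_trans hn; exact: (leq_bigmax (F := nf)).
pose v k i j := B (iter k S i) j / k`!%:R.
(* Cramer's rule puts [i] in place of the reference row [b]; the numbers [q i b x] with x at most
   [M * r] are the finitely many functionals of [i]. *)
pose rep (i : I) (b c : 'I_r) := if c == b then i else i0 c.
pose q i b k := (P k.+1 (rep i b))`_k.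
pose q0 k := (P k.+1 i0)`_k.
(* At t = 0 the first determinant is 1 by the normalization of [lam], and the second is the
   conjugate of an invertible minor. *)
have q00 : q0 0%N != 0.
  have e0 : (P 1%N i0)`_0 = (\det (Lm 1%N i0))`_0 * (\det (Um 1%N))`_0 by rewrite coef0M.
  rewrite /q0 e0 -!horner_coef0 mulf_neq0//.
    rewrite -[_.[0]]/(horner_eval 0 _) -det_map_mx.
    suff -> : map_mx (horner_eval 0) (Lm 1%N i0) = 1%:M by rewrite det1 oner_neq0.
    apply/matrixP => a b; rewrite !mxE /horner_eval horner_coef0 coef_poly /= lam0.
    by rewrite divr1.
  rewrite -[_.[0]]/(horner_eval 0 _) -det_map_mx.
  have -> : map_mx (horner_eval 0) (Um 1%N) = (map_mx Num.conj (\matrix_(a, b) B (i0 a) (j0 b)))^T.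
    apply/matrixP => a b; rewrite !mxE /horner_eval horner_coef0 coef_poly /=.
    by rewrite expr0 mulr1 divr1.
  by rewrite det_tr det_map_mx fmorph_eq0 -unitfE -unitmxE.
(* Coefficient [k] of the Cramer identity P(i0) w(i) = sum over b of P(rep i b) w(i0 b), where w is
   the generating series of [v]. On the right the coefficients of P beyond [M * r] are zero. *)
have key k i j : \sum_(x < k.+1) q0 x * v (k - x)%N i j =
    \sum_b \sum_(x < (M * r).+1 | (x <= k)%N) q i b x * v (k - x)%N (i0 b) j.
  pose w i : {poly C} := \sum_a l k.+1 i a * (mu j a)%:P.
  have wE i' x : (x < k.+1)%N -> (w i')`_x = v x i' j.
    move=> xk; rewrite /w coef_sum /v hB mulr_suml; apply: eq_bigr => a _.
    by rewrite coefMC coef_poly xk mulrAC.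
  have eqP : P k.+1 i0 * w i = \sum_b P k.+1 (rep i b) * w (i0 b).
    rewrite /w mulr_sumr.
    have cr := cramer_row (Lm k.+1 i0) (\row_a l k.+1 i a).
    transitivity (\sum_a ((\det (Lm k.+1 i0) *: \row_a l k.+1 i a) 0 a * (\det (Um k.+1) * (mu j a)%:P))).
      by apply: eq_bigr => a _; rewrite !mxE /P -!mulrA [l _ _ _ * (_ * _)]mulrCA.
    rewrite cr.
    under eq_bigr do rewrite summxE mulr_suml.
    rewrite exchange_big /=; apply: eq_bigr => b _; rewrite mulr_sumr.
    apply: eq_bigr => a _; rewrite !mxE /P -!mulrA; congr (\det _ * _).
      by apply/matrixP => x y; rewrite !mxE /rep; case: eqP.
    by rewrite mulrCA.
  have := congr1 (fun p : {poly C} => p`_k) eqP; rewrite /= coefM coef_sum.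
  move=> h; transitivity (\sum_(x < k.+1) (P k.+1 i0)`_x * (w i)`_(k - x)).
    apply: eq_bigr => x _; rewrite wE ?ltnS ?leq_subr//.
    by rewrite /q0 (Pst i0 x k.+1 x.+1).
  rewrite h; apply: eq_bigr => b _; rewrite coefM.
  rewrite (big_ord_widen_cond (maxn k (M * r)).+1 xpredT (fun x => (P k.+1 (rep i b))`_x * (w (i0 b))`_(k - x))) ?ltnS ?leq_maxl//.
  rewrite (big_ord_widen_cond (maxn k (M * r)).+1 (fun x => (x <= k)%N) (fun x => q i b x * v (k - x)%N (i0 b) j)) ?ltnS ?leq_maxr//.
  rewrite [LHS]big_mkcond [RHS]big_mkcond; apply: eq_bigr => x _ /=; rewrite !ltnS.
  case: (leqP x k) => xk //=.
  rewrite wE ?ltnS ?leq_subr// /q (Pst _ x k.+1 x.+1)//.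
  by case: ifP => // /negbT; rewrite -ltnNge => xM; rewrite PM ?mul0r.
(* As [q0 0] is nonzero, [key] is a recursion for [v k]. Solving it keeps the variables separated:
   [i] occurs in [q] only, [j] and [k] in the weights only. *)
have ex k : exists w : J -> 'I_r * 'I_(M * r).+1 -> C, forall i j,
    v k i j = \sum_(bx : 'I_r * 'I_(M * r).+1) q i bx.1 bx.2 * w j bx.
  elim/ltn_ind: k => k IH.
  have /choice[W hW] : forall y : nat, exists w : J -> 'I_r * 'I_(M * r).+1 -> C,
      (y < k)%N -> forall i j, v y i j = \sum_(bx : 'I_r * 'I_(M * r).+1) q i bx.1 bx.2 * w j bx.
    by move=> y; case: (ltnP y k) => [/IH[w hw]|yk]; [exists w|exists (fun _ _ => 0)].
  exists (fun j (bx : 'I_r * 'I_(M * r).+1) => (q0 0%N)^-1 * ((if (bx.2 <= k)%N then v (k - bx.2)%N (i0 bx.1) j else 0)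
             - \sum_(x < k) q0 x.+1 * W (k - x.+1)%N j bx)) => i j.
  apply: (mulfI q00); have := key k i j; rewrite big_ord_recl subn0 => /eqP.
  rewrite eq_sym -subr_eq => /eqP <-.
  rewrite mulr_sumr; under [RHS]eq_bigr do rewrite mulrCA mulVKf// mulrBr.
  rewrite sumrB; congr (_ - _).
    rewrite pair_big_dep /= big_mkcond /=; apply: eq_bigr => -[b x] _ /=.
    by case: ifP; rewrite ?mulr0.
  under [RHS]eq_bigr do rewrite mulr_sumr.
  rewrite exchange_big /=; apply: eq_bigr => x _.
  rewrite hW; last by rewrite ltn_subrL (leq_ltn_trans _ (ltn_ord x)).
  by rewrite mulr_sumr; apply: eq_bigr => bx _; rewrite mulrCA.
have /choice[W hW] := ex.
exists #|{: 'I_r * 'I_(M * r).+1}|.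
apply: (@rank_le_factor _ _ _ _ _ (fun i (bx : 'I_r * 'I_(M * r).+1) => q i bx.1 bx.2)
  (fun jk bx => jk.2`!%:R * W jk.2 jk.1 bx)) => i [j k] /=.
under eq_bigr do rewrite mulrCA.
by rewrite -mulr_sumr -hW /v mulrC divfK// pnatr_eq0 -lt0n fact_gt0.
Qed.
End Shift.

(** * Truncated exponentials *)

Section TruncatedExponential.

Definition trunc_exp (C : numFieldType) (n : nat) : {poly C} := \poly_(k < n) (k`!%:R)^-1.

Lemma deriv_trunc_exp (C : numFieldType) n : (trunc_exp C n)^`() = trunc_exp C n.-1.
Proof.
apply/polyP => k; rewrite coef_deriv !coef_poly.
case: n => [|n] /=; first by rewrite mul0rn.
rewrite ltnS; case: ltnP => _; last by rewrite mul0rn.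
by rewrite -[LHS]mulr_natl factS natrM invfM mulrA divff ?pnatr_eq0// mul1r.
Qed.

Lemma exp_tail (R : realType) (x : R) : 0 <= x ->
  exists2 n0, (0 < n0)%N & forall n, \sum_(n0 <= k < n) x ^+ k / k`!%:R <= 1.
Proof.
move=> x0; have cv := @is_cvg_series_exp_coeff R x.
have nd : nondecreasing_seq (series (exp_coeff x)).
  apply/nondecreasing_seqP => n; rewrite seriesSr lerDl.
  by rewrite /exp_coeff /= divr_ge0 ?exprn_ge0.
have /cvgrPdist_lt/(_ 1 ltr01)[n0 _ hn0] := cv.
exists n0.+1 => // n; case: (leqP n0.+1 n) => [nn|nn]; last by rewrite big_geq ?ler01// ltnW.
have := nondecreasing_cvgn_le nd cv n.
have := hn0 n0.+1 (leqnSn n0); rewrite /= => /ltW /(le_trans (ler_norm _)).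
have -> : series (exp_coeff x) n =
    series (exp_coeff x) n0.+1 + \sum_(n0.+1 <= k < n) x ^+ k / k`!%:R.
  by rewrite /series /= [LHS](@big_cat_nat _ _ _ n0.+1)//= ltnW.
lra.
Qed.

Variable R : realType.
Let C := R[i].

(** Coefficient k of the product is part of an alternating binomial sum divided by k!. For 0 < k <
    [n0] the sum is complete, hence zero; in general it is at most 2^k / k!, which explains the tail
    at [2 * W]. The bound 2 is the constant term 1 plus a tail of at most 1. The two truncation
    orders are independent because differentiation lowers them separately. *)
Lemma trunc_exp_mul_bound (W : R) : 0 <= W ->
  exists n0, forall n n', (n0 <= n)%N -> (n0 <= n')%N ->
  forall w : C, `|w| <= W%:C%C -> `|(trunc_exp C n).[w] * (trunc_exp C n').[- w]| <= 2%:R.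
Proof.
move=> W0; have [n0 n00 hn0] := @exp_tail R (2 * W) (mulr_ge0 (ler0n _ 2) W0).
exists n0 => n n' hn hn' w hw.
pose tm : {poly C} := \poly_(k < n') ((-1) ^+ k / k`!%:R).
have -> : (trunc_exp C n').[- w] = tm.[w].
  rewrite /trunc_exp !horner_poly; apply: eq_bigr => k _.
  by rewrite [(- w) ^+ k]exprNn mulrA [(-1) ^+ _ / _]mulrC.
pose p := trunc_exp C n * tm; rewrite -hornerM -/p.
have coefp k : p`_k = \sum_(a < k.+1) (if (a < n)%N && (k - a < n')%N then
    (-1) ^+ (k - a) * 'C(k, a)%:R / k`!%:R else 0).
  rewrite /p coefM; apply: eq_bigr => a _; rewrite !coef_poly.
  case: (ltnP a n) => an /=; last by rewrite mul0r.
  case: (ltnP (k - a) n') => _ /=; last by rewrite mulr0.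
  have ak : (a <= k)%N by rewrite -ltnS.
  rewrite -(bin_fact ak) !natrM !invfM mulrA [in RHS]mulrACA.
  have := lt0r_neq0 (_ : 0 < 'C(k, a)%:R :> C); rewrite ltr0n bin_gt0 => /(_ ak).
  have := lt0r_neq0 (_ : 0 < a`!%:R :> C); rewrite ltr0n fact_gt0 => /(_ isT).
  have := lt0r_neq0 (_ : 0 < (k - a)`!%:R :> C); rewrite ltr0n fact_gt0 => /(_ isT).
  by move=> ? ? ?; field; do !(apply/andP; split).
have small k : (k < n0)%N -> p`_k = (k == 0%N)%:R.
  move=> kn; rewrite coefp.
  have -> : \sum_(a < k.+1) (if (a < n)%N && (k - a < n')%N then
     (-1) ^+ (k - a) * 'C(k, a)%:R / k`!%:R else 0) =
     \sum_(a < k.+1) ((-1) ^+ (k - a) * 1 ^+ a) *+ 'C(k, a) / (k`!%:R : C).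
    apply: eq_bigr => a _; have ak : (a <= k)%N by rewrite -ltnS.
    rewrite (leq_ltn_trans ak (leq_trans kn hn)).
    rewrite (leq_ltn_trans (leq_subr _ _) (leq_trans kn hn')) /=.
    by rewrite expr1n mulr1 mulr_natr.
  rewrite -mulr_suml -exprDn addNr expr0n.
  by case: k kn => [|k] _ /=; rewrite ?mul0r// fact0 divr1.
have big k : `|p`_k| <= (2 ^ k)%:R / k`!%:R.
  rewrite coefp (le_trans (ler_norm_sum _ _ _))//.
  have -> : (2 ^ k)%:R = \sum_(a < k.+1) 'C(k, a)%:R :> C.
    rewrite -natr_sum; congr _%:R; rewrite -[2%N]/(1 + 1)%N expnDn.
    by apply: eq_bigr => a _; rewrite !exp1n !muln1.
  rewrite mulr_suml; apply: ler_sum => a _; case: ifP => _.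
    by rewrite !normrM normrX normrN1 expr1n mul1r normfV !normr_nat.
  by rewrite normr0 divr_ge0.
have sz : (size p <= n + n')%N.
  by rewrite (leq_trans (size_polyMleq _ _))// (leq_trans (leq_pred _))// leq_add ?size_poly.
rewrite (horner_coef_wide _ sz) (le_trans (ler_norm_sum _ _ _))//.
rewrite -(big_mkord xpredT (fun k => `|p`_k * w ^+ k|)).
have nn : (n0 <= n + n')%N by rewrite (leq_trans hn) ?leq_addr.
rewrite (big_cat_nat (leq0n n0) nn)/= (big_ltn n00)/= small// mul1r expr0 normr1.
rewrite big_nat_cond big1 ?addr0 => [|k]; last first.
  by rewrite andbT => /andP[k0 kn]; rewrite small// gtn_eqF// mul0r normr0.
rewrite -[2%:R]/(1 + 1) lerD2l.
apply: (@le_trans _ _ ((\sum_(n0 <= k < n + n') (2 * W) ^+ k / k`!%:R)%:C)%C); last first.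
  by rewrite -(rmorph1 (real_complex R)) lecR.
rewrite rmorph_sum /=; apply: ler_sum => k _.
rewrite normrM normrX (le_trans (ler_pM _ _ (big k) (lexx _)))// ?exprn_ge0//.
rewrite rmorphM rmorphXn rmorphM fmorphV !rmorph_nat exprMn natrX mulrAC.
rewrite ler_wpM2r ?invr_ge0// ler_wpM2l ?exprn_ge0// lerXn2r// nnegrE//.
exact: le_trans hw.
Qed.

End TruncatedExponential.

(** * Smooth functions *)

Lemma is_derive_line (R : realType) (V : normedModType R) (f : V -> R) (v x : V) (df : R) :
  is_derive (0 : R) 1 (fun h : R => f (h *: v + x)) df <-> is_derive x v f df.
Proof.
have E : (fun h : R => h^-1 *: (((fun h : R => f (h *: v + x)) \o shift 0) (h *: (1 : R)) - f (0 *: v + x))) =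
    (fun h : R => h^-1 *: ((f \o shift x) (h *: v) - f x)).
  by apply/funext => h /=; rewrite addr0 scale0r add0r [_%:A]mulr1.
by split=> -[h1 h2]; split; rewrite /derivable /derive ?E// -E.
Qed.

Section Smooth.
Variables (R : realType) (d : nat).
Local Notation V := 'rV[R]_d.
Implicit Types (f g : V -> R) (v : V) (i j : 'I_d) (s : seq 'I_d) (x y : V).

(* Smoothness, locked so that unification never unfolds it. *)
Definition lsmooth : (V -> R) -> Prop := locked (@smooth R d).

Lemma lsmoothE f : lsmooth f = smooth f.
Proof. by rewrite /lsmooth -lock. Qed.

(** Coinduction: it is enough to exhibit a class of functions that contains the given one and is
    stable under partial derivatives, so no formula for higher derivatives is needed. *)
Lemma smooth_coind (P : (V -> R) -> Prop) :
  (forall f, P f -> [/\ continuous f, forall i x, derivable f x (e R i) &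
     forall i, P (partial i f)]) ->
  forall f, P f -> lsmooth f.
Proof.
move=> hP f Pf; rewrite lsmoothE => s.
suff : P (dseq s f) by move=> /hP[].
by elim: s => [|i s IH] //=; have [_ _] := hP _ IH; apply.
Qed.

Lemma smooth_cont f : lsmooth f -> continuous f.
Proof. by rewrite lsmoothE => /(_ [::])[]. Qed.

Lemma smooth_derivable f i x : lsmooth f -> derivable f x (e R i).
Proof. by rewrite lsmoothE => /(_ [::])[_]; apply. Qed.

Lemma dseq_cat s s' f : dseq (s ++ s') f = dseq s (dseq s' f).
Proof. by rewrite /dseq foldr_cat. Qed.

Lemma dseq_rcons s i f : dseq (rcons s i) f = dseq s (partial i f).
Proof. by rewrite -cats1 dseq_cat. Qed.

Lemma smooth_dseq s f : lsmooth f -> lsmooth (dseq s f).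
Proof. by rewrite !lsmoothE => sf s'; rewrite -dseq_cat; exact: sf. Qed.

Lemma smooth_partial i f : lsmooth f -> lsmooth (partial i f).
Proof. exact: (@smooth_dseq [:: i]). Qed.

Lemma partial_cst (c : R) i : partial i (fun _ : V => c) = fun=> 0.
Proof. by apply/funext => x; rewrite /partial derive_cst. Qed.

Lemma smooth_cst (c : R) : lsmooth (fun _ : V => c).
Proof.
apply: (@smooth_coind (fun f => exists c, f = fun=> c)); last by exists c.
move=> _ [k ->]; split; [exact: cst_continuous|by move=> *; exact: derivable_cst|].
by move=> i; exists 0; rewrite partial_cst.
Qed.

Lemma partialD i f g : lsmooth f -> lsmooth g ->
  partial i (fun x => f x + g x) = fun x => partial i f x + partial i g x.
Proof.
by move=> sf sg; apply/funext => x; rewrite /partial deriveD//; exact: smooth_derivable.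
Qed.

Lemma partialM i f g : lsmooth f -> lsmooth g ->
  partial i (fun x => f x * g x) = fun x => partial i f x * g x + f x * partial i g x.
Proof.
move=> sf sg; apply/funext => x; rewrite /partial deriveM; try exact: smooth_derivable.
by rewrite addrC [g x *: _]mulrC.
Qed.

(** The stable class for products: by the Leibniz rule a derivative of a product leaves the products
    but stays among their sums. *)
Inductive sum_of_products : (V -> R) -> Prop :=
| SPmul f g : lsmooth f -> lsmooth g -> sum_of_products (fun x => f x * g x)
| SPadd f g : sum_of_products f -> sum_of_products g ->
    sum_of_products (fun x => f x + g x).

Lemma sum_of_products_smooth f : sum_of_products f -> lsmooth f.
Proof.
apply: smooth_coind => {}f.
elim=> [{}f g sf sg|{}f g _ [cf df pf] _ [cg dg pg]]; split.
- by move=> x; apply: continuousM; exact: smooth_cont.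
- by move=> i x; apply: derivableM; exact: smooth_derivable.
- move=> i; rewrite partialM//.
  by apply: SPadd; apply: SPmul => //; exact: smooth_partial.
- by move=> x; apply: continuousD; [exact: cf|exact: cg].
- by move=> i x; apply: derivableD; [exact: df|exact: dg].
move=> i; suff -> : partial i (fun x => f x + g x) = fun x => partial i f x + partial i g x.
  exact: SPadd.
by apply/funext => x; rewrite /partial deriveD.
Qed.

Lemma smoothM f g : lsmooth f -> lsmooth g -> lsmooth (fun x => f x * g x).
Proof. by move=> sf sg; apply: sum_of_products_smooth; exact: SPmul. Qed.

Lemma smoothD f g : lsmooth f -> lsmooth g -> lsmooth (fun x => f x + g x).
Proof.
move=> sf sg; apply: sum_of_products_smooth.
have -> : (fun x => f x + g x) = fun x => (f x * 1) + (g x * 1).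
  by apply/funext => x; rewrite !mulr1.
by apply: SPadd; apply: SPmul => //; exact: smooth_cst.
Qed.

Lemma smoothN f : lsmooth f -> lsmooth (fun x => - f x).
Proof.
move=> sf; have -> : (fun x => - f x) = fun x => -1 * f x.
  by apply/funext => x; rewrite mulN1r.
by apply: smoothM => //; exact: smooth_cst.
Qed.

Lemma smoothB f g : lsmooth f -> lsmooth g -> lsmooth (fun x => f x - g x).
Proof. by move=> sf sg; apply: smoothD => //; exact: smoothN. Qed.

Lemma smooth_sum (T : Type) (r : seq T) (P : pred T) (F : T -> V -> R) :
  (forall t, P t -> lsmooth (F t)) -> lsmooth (fun x => \sum_(t <- r | P t) F t x).
Proof.
move=> sF; elim: r => [|t r IH].
  by rewrite (_ : (fun _ => _) = fun=> 0); [exact: smooth_cst|apply/funext => x; rewrite big_nil].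
rewrite (_ : (fun _ => _) = fun x => if P t then F t x + \sum_(u <- r | P u) F u x
    else \sum_(u <- r | P u) F u x); last by apply/funext => x; rewrite big_cons.
by case Pt: (P t) => //; apply: smoothD => //; exact: sF.
Qed.

Lemma smooth_prod (T : Type) (r : seq T) (P : pred T) (F : T -> V -> R) :
  (forall t, P t -> lsmooth (F t)) -> lsmooth (fun x => \prod_(t <- r | P t) F t x).
Proof.
move=> sF; elim: r => [|t r IH].
  by rewrite (_ : (fun _ => _) = fun=> 1); [exact: smooth_cst|apply/funext => x; rewrite big_nil].
rewrite (_ : (fun _ => _) = fun x => if P t then F t x * \prod_(u <- r | P u) F u x
    else \prod_(u <- r | P u) F u x); last by apply/funext => x; rewrite big_cons.
by case Pt: (P t) => //; apply: smoothM => //; exact: sF.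
Qed.

Lemma smoothX f n : lsmooth f -> lsmooth (fun x => f x ^+ n).
Proof.
move=> sf; elim: n => [|n IH]; first exact: smooth_cst.
rewrite (_ : (fun _ => _) = fun x => f x * f x ^+ n); first exact: smoothM.
by apply/funext => x; rewrite exprS.
Qed.

Lemma is_derive_coord i j x : is_derive x (e R j) (fun y : V => y 0 i) (i == j)%:R.
Proof.
apply/is_derive_line.
have -> : (fun h : R => (h *: e R j + x) 0 i) = (fun h : R => h * (i == j)%:R + x 0 i).
  by apply/funext => h; rewrite !mxE eqxx.
by apply: is_derive_eq; rewrite scaler0 addr0 add0r [_%:A]mulr1.
Qed.

Lemma partial_coord i j : partial j (fun x : V => x 0 i) = fun=> (i == j)%:R.
Proof. by apply/funext => x; have [_] := is_derive_coord i j x. Qed.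

Lemma smooth_coord i : lsmooth (fun x : V => x 0 i).
Proof.
apply: (@smooth_coind (fun f => (exists c, f = fun=> c) \/ f = fun x => x 0 i)); last by right.
move=> _ [[k ->]|->]; split.
- exact: cst_continuous.
- by move=> *; exact: derivable_cst.
- by move=> j; left; exists 0; rewrite partial_cst.
- exact: coord_continuous.
- by move=> j x; have [] := is_derive_coord i j x.
- by move=> j; left; exists (i == j)%:R; rewrite partial_coord.
Qed.

Lemma smoothV f : lsmooth f -> (forall x, f x != 0) -> lsmooth (fun x => (f x)^-1).
Proof.
move=> sf f0.
(* The quotients g / f^k with g smooth form a stable class, by the quotient rule. *)
apply: (@smooth_coind (fun h => exists2 gk : (V -> R) * nat, lsmooth gk.1 &
   h = fun x => gk.1 x * (f x ^+ gk.2)^-1)); last first.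
  exists ((fun=> 1), 1%N); first exact: smooth_cst.
  by apply/funext => x; rewrite /= mul1r expr1.
have fk0 k x : f x ^+ k != 0 by rewrite expf_neq0.
move=> _ [[g k] /= sg ->]; have sfk := smoothX k sf.
have dV i x : derivable (fun y => (f y ^+ k)^-1) x (e R i).
  by apply: derivableV => //; exact: smooth_derivable.
split.
- move=> x /=; apply: (@continuousM _ _ g (fun y => (f y ^+ k)^-1)); first exact: smooth_cont.
  by apply: continuousV => //; exact: (smooth_cont sfk).
- by move=> i x; apply: derivableM => //; exact: smooth_derivable.
move=> i; exists ((fun x => partial i g x * f x ^+ k - g x * partial i (fun y => f y ^+ k) x), (k + k)%N) => /=.
  by apply: smoothB; apply: smoothM => //; exact: smooth_partial.
apply/funext => x; rewrite {1}/partial deriveM//; last exact: smooth_derivable.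
rewrite deriveV//; last exact: smooth_derivable.
have scE (a b : R) : a *: b = a * b by [].
rewrite !scE /= -/(partial i _ x) -/(partial i g x) exprD.
have := fk0 k x; set q := f x ^+ k => q0.
set a := partial _ _ _; set b := partial _ _ _.
by field.
Qed.

End Smooth.

(** * Slices in one coordinate and symmetry of mixed derivatives *)

Section Slices.
Variables (R : realType) (d : nat).
Local Notation V := 'rV[R]_d.
Implicit Types (f g : V -> R) (i j : 'I_d) (s : seq 'I_d) (x y : V).

Definition upd x i (t : R) : V := \row_j (if j == i then t else x 0 j).

Lemma updE x i t j : upd x i t 0 j = if j == i then t else x 0 j.
Proof. by rewrite mxE. Qed.

Lemma upd_id x i : upd x i (x 0 i) = x.
Proof. by apply/rowP => j; rewrite mxE; case: eqP => [->|]. Qed.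

Lemma updC x i j a b : i != j -> upd (upd x i a) j b = upd (upd x j b) i a.
Proof.
move=> ij; apply/rowP => k; rewrite !mxE.
by case: (eqVneq k j) => [->|//]; rewrite eq_sym (negbTE ij).
Qed.

Lemma coord_le_norm x i : `|x 0 i| <= `|x|.
Proof.
rewrite [leRHS]mx_normrE; exact: (le_bigmax _ (fun ij : 'I_1 * 'I_d => `|x ij.1 ij.2|) (0, i)).
Qed.

Lemma norm_le_coord x (r : R) : 0 <= r -> (forall i, `|x 0 i| <= r) -> `|x| <= r.
Proof.
move=> r0 hx; rewrite [leLHS]mx_normrE; apply: bigmax_le => // -[a b] _ /=.
by rewrite (ord1 a).
Qed.

Lemma norm_upd x i t (r : R) : `|x| <= r -> `|t| <= r -> `|upd x i t| <= r.
Proof.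
move=> xr tr; apply: norm_le_coord => [|j]; first exact: le_trans xr.
by rewrite mxE; case: ifP => // _; exact: le_trans (coord_le_norm x j) xr.
Qed.

Lemma is_derive_slice f i x t : lsmooth f ->
  is_derive (t : R) 1 (fun u : R => f (upd x i u)) (partial i f (upd x i t)).
Proof.
move=> sf; have /derivableP/is_derive_line := @smooth_derivable _ _ f i (upd x i t) sf.
rewrite -/(partial i f (upd x i t)) => h.
apply/is_derive_line; move: h.
congr is_derive; apply/funext => h; congr f.
apply/rowP => j; rewrite !mxE eqxx /=.
by case: ifP => _; rewrite ?mulr0 ?add0r//.
Qed.

(** The first condition says that [c] lies between [a] and [b], in a form that covers both orders of
    the endpoints and transfers directly to balls. *)
Lemma slice_mvt f i x (a b : R) : lsmooth f -> exists2 c,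
  (forall z r : R, `|a - z| <= r -> `|b - z| <= r -> `|c - z| <= r) &
  f (upd x i b) - f (upd x i a) = partial i f (upd x i c) * (b - a).
Proof.
move=> sf.
have main u v : u <= v -> exists2 c, u <= c <= v &
    f (upd x i v) - f (upd x i u) = partial i f (upd x i c) * (v - u).
  move=> uv; have [|c cuv ->] := @MVT_segment R (fun t => f (upd x i t))
    (fun t => partial i f (upd x i t)) u v uv (fun t _ => is_derive_slice i x t sf).
    apply: continuous_subspaceT => t.
    apply: differentiable_continuous; apply/derivable1_diffP.
    by have [] := is_derive_slice i x t sf.
  by exists c => //; move: cuv; rewrite in_itv.
case: (leP a b) => [/main[c cab ->]|/ltW/main[c cab h]]; exists c => //.
- by move: cab => /andP[? ?] z r; rewrite !ler_norml => /andP[? ?] /andP[? ?]; apply/andP; split; lra.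
- by move: cab => /andP[? ?] z r; rewrite !ler_norml => /andP[? ?] /andP[? ?]; apply/andP; split; lra.
- by rewrite -[LHS]opprB h; ring.
Qed.

Lemma slice_line f i j x (t h : R) : i != j ->
  f (upd (h *: e R j + x) i t) = f (h *: e R j + upd x i t).
Proof.
move=> ij; congr f; apply/rowP => k; rewrite !mxE; case: eqP => [->|//].
by rewrite (negbTE ij) andbF mulr0 add0r.
Qed.

Lemma slice_line_eq f i x (t h : R) : f (upd (h *: e R i + x) i t) = f (upd x i t).
Proof.
congr f; apply/rowP => k; rewrite !mxE; case: eqP => //= _.
by rewrite ?andbF mulr0 add0r.
Qed.

Lemma is_derive_upd f i j x t : lsmooth f ->
  is_derive x (e R j) (fun y => f (upd y i t))
    (if i == j then 0 else partial j f (upd x i t)).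
Proof.
move=> sf; apply/is_derive_line; case: eqP => [<-|/eqP ij].
  rewrite (_ : (fun _ => _) = fun=> f (upd x i t)); first exact: is_derive_cst.
  by apply/funext => h; rewrite slice_line_eq.
rewrite (_ : (fun _ => _) = fun h => f (h *: e R j + upd x i t)); last first.
  by apply/funext => h; rewrite slice_line.
by apply/is_derive_line/derivableP; exact: smooth_derivable.
Qed.

Lemma partial_upd f i j t : lsmooth f ->
  partial j (fun y => f (upd y i t)) = if i == j then fun=> 0 else fun y => partial j f (upd y i t).
Proof.
move=> sf; apply/funext => x; have [_] := is_derive_upd i j x t sf.
by rewrite /partial => ->; case: ifP.
Qed.

Lemma continuous_upd i t : continuous (fun x : V => upd x i t).
Proof.
rewrite (_ : (fun _ => _) = fun x => x + (t - x 0 i) *: e R i); last first.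
  apply/funext => x; apply/rowP => j; rewrite !mxE eqxx /=.
  by case: eqP => [->|_]; rewrite ?mulr1 ?subrKC// mulr0 addr0.
move=> x; apply: (@continuousD _ _ _ id (fun x : V => (t - x 0 i) *: e R i) x).
  exact: cvg_id.
have h : continuous (fun y : V => t - y 0 i).
  by apply: smooth_cont; apply: smoothB; [exact: smooth_cst|exact: smooth_coord].
exact: cvgZr_tmp (h x).
Qed.

Lemma smooth_upd f i t : lsmooth f -> lsmooth (fun x => f (upd x i t)).
Proof.
move=> sf; apply: (@smooth_coind _ _ (fun h => exists2 g, lsmooth g & h = fun x => g (upd x i t))); last by exists f.
move=> _ [g sg ->]; split.
- move=> x; apply: (@continuous_comp _ _ _ (fun x => upd x i t) g).
    exact: continuous_upd.
  exact: smooth_cont.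
- by move=> j x; have [] := is_derive_upd i j x t sg.
move=> j; rewrite partial_upd//; case: eqP => _.
  by exists (fun=> 0); first exact: smooth_cst.
by exists (partial j g); first exact: smooth_partial.
Qed.

Lemma partialB i f g : lsmooth f -> lsmooth g ->
  partial i (fun x => f x - g x) = fun x => partial i f x - partial i g x.
Proof.
by move=> sf sg; apply/funext => x; rewrite /partial deriveB//; exact: smooth_derivable.
Qed.

Lemma near_cube f x (eps : R) : continuous f -> 0 < eps ->
  exists2 h : R, 0 < h & forall y, (forall i, `|y 0 i - x 0 i| <= h) -> `|f y - f x| <= eps.
Proof.
move=> cf e0; have /cvgrPdist_le/(_ _ e0)/nbhs_ballP[h /= h0 hh] := cf x.
exists (h / 2); first by rewrite divr_gt0.
move=> y hy; rewrite distrC; apply: hh; split=> [|a b]; first exact: h0.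
rewrite (ord1 a) /ball /=.
rewrite distrC (le_lt_trans (hy b))//.
by rewrite ltr_pdivrMr// ltr_pMr// ltr1n.
Qed.

(* Both mixed partials at nearby points equal the second difference quotient of [f]. *)
Lemma partialC f i j : lsmooth f -> partial i (partial j f) = partial j (partial i f).
Proof.
move=> sf; have [->//|ij] := eqVneq i j; apply/funext => x.
(* The mean value theorem is applied to the difference [u] in direction [k], then to the derivative
   of [f] in direction [l]. *)
have key (k l : 'I_d) (h : R) : k != l -> 0 < h -> exists2 y : V, (forall i, `|y 0 i - x 0 i| <= h) &
    f (upd (upd x k (x 0 k + h)) l (x 0 l + h)) - f (upd (upd x k (x 0 k + h)) l (x 0 l))
    - (f (upd (upd x k (x 0 k)) l (x 0 l + h)) - f (upd (upd x k (x 0 k)) l (x 0 l)))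
    = partial l (partial k f) y * (h * h).
  move=> kl h0; pose u y := f (upd y l (x 0 l + h)) - f (upd y l (x 0 l)).
  have su : lsmooth u by apply: smoothB; exact: smooth_upd.
  have [c hc ec] := slice_mvt k x (x 0 k) (x 0 k + h) su.
  have spf := smooth_partial k sf.
  have [c' hc' ec'] := slice_mvt l (upd x k c) (x 0 l) (x 0 l + h) spf.
  exists (upd (upd x k c) l c').
    move=> a; rewrite !mxE; case: eqP => [->|_].
      by apply: hc'; rewrite ?subrr ?normr0 ?(ltW h0)// addrC addKr gtr0_norm.
    case: eqP => [->|_]; last by rewrite subrr normr0 ltW.
    by apply: hc; rewrite ?subrr ?normr0 ?(ltW h0)// addrC addKr gtr0_norm.
  rewrite -[LHS]/(u (upd x k (x 0 k + h)) - u (upd x k (x 0 k))) ec.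
  rewrite /u partialB; try exact: smooth_upd.
  by rewrite !partial_upd// eq_sym (negbTE kl) ec'; ring.
apply/eqP; apply: contraT; rewrite -subr_eq0 => D0.
(* Two errors of a third of the gap cannot close it. *)
pose eps := `|partial i (partial j f) x - partial j (partial i f) x| / 3.
have eps0 : 0 < eps by rewrite divr_gt0 ?normr_gt0.
have [h1 h10 H1] := near_cube x (smooth_cont (smooth_partial i (smooth_partial j sf))) eps0.
have [h2 h20 H2] := near_cube x (smooth_cont (smooth_partial j (smooth_partial i sf))) eps0.
pose h := Num.min h1 h2; have h0 : 0 < h by rewrite lt_min h10.
have ji : j != i by rewrite eq_sym.
have [y hy ey] := key j i h ji h0; have [z hz ez] := key i j h ij h0.
have yz : partial i (partial j f) y = partial j (partial i f) z.
  apply: (mulIf (_ : h * h != 0)); first by rewrite mulf_neq0// gt_eqF.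
  apply: etrans (esym ey) (etrans _ ez).
  rewrite (updC _ _ _ ji) (updC _ _ _ ji) (updC _ _ _ ji) (updC _ _ _ ji).
  by move: (f _) (f _) (f _) (f _) => a b c a'; ring.
have := H1 y (fun a => le_trans (hy a) _); rewrite ge_min lexx => /(_ isT) {}H1.
have := H2 z (fun a => le_trans (hz a) _); rewrite ge_min lexx orbT => /(_ isT) {}H2.
move: D0; rewrite -normr_gt0; move: eps0 H1 H2; rewrite yz /eps.
move: (partial i _ x) (partial j _ x) (partial j _ z) => A B D.
have := ler_distD D A B; rewrite (distrC A D).
by clear ey ez yz hy hz; lra.
Qed.
End Slices.

(** * Density of polynomials *)

Section Weights.
Variable R : realType.

(* Expanded Bernstein weights: the law of the sum of [n] independent Bernoulli
   variables of parameter [U], listed by outcomes. *)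
Fixpoint bernoulli_law (U : {poly R}) (n : nat) : seq (nat * {poly R}) :=
  if n is n'.+1 then
    [seq (kp.1.+1, U * kp.2) | kp <- bernoulli_law U n'] ++
    [seq (kp.1, (1 - U) * kp.2) | kp <- bernoulli_law U n']
  else [:: (0%N, 1)].

Lemma bernoulli_law_le U n kp : kp \in bernoulli_law U n -> (kp.1 <= n)%N.
Proof.
elim: n kp => [|n IH] kp; first by rewrite inE => /eqP ->.
by rewrite /= mem_cat => /orP[]/mapP[kp' /IH h ->] //=; exact: ltnW.
Qed.

Lemma bernoulli_law_ge0 U n kp x : 0 <= U.[x] <= 1 -> kp \in bernoulli_law U n -> 0 <= kp.2.[x].
Proof.
move=> /andP[u0 u1]; elim: n kp => [|n IH] kp; first by rewrite inE => /eqP ->; rewrite hornerC.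
by rewrite /= mem_cat => /orP[]/mapP[kp' /IH h ->] /=; rewrite !hornerE mulr_ge0// subr_ge0.
Qed.

Lemma bernoulli_law_sum U n x : \sum_(kp <- bernoulli_law U n) kp.2.[x] = 1.
Proof.
elim: n => [|n IH] /=; first by rewrite big_seq1 hornerC.
rewrite big_cat !big_map /=.
under eq_bigr do rewrite hornerM; under [X in _ + X]eq_bigr do rewrite hornerM.
by rewrite -!mulr_sumr IH !hornerE /=; ring.
Qed.

Lemma bernoulli_law_variance U n x c :
  \sum_(kp <- bernoulli_law U n) kp.2.[x] * (kp.1%:R - c) ^+ 2 =
  (n%:R * U.[x] - c) ^+ 2 + n%:R * (U.[x] * (1 - U.[x])).
Proof.
elim: n c => [|n IH] c /=; first by rewrite big_seq1 hornerC /=; ring.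
rewrite big_cat !big_map /=.
have e (k : nat) : k.+1%:R - c = k%:R - (c - 1) by rewrite -natr1; ring.
under eq_bigr do rewrite hornerM -mulrA e.
under [X in _ + X]eq_bigr do rewrite hornerM -mulrA.
rewrite -!mulr_sumr !IH !hornerE -natr1 /=; ring.
Qed.

(** Bernstein's proof of the Weierstrass theorem: the variance controls the mean distance to the
    node. The result is stated for weights rather than for a function, so that the same weights
    serve a function and all its derivatives in the other variables. *)
Lemma weierstrass_weights (r eps : R) : 0 < r -> 0 < eps ->
  exists L : seq (R * {poly R}),
  [/\ forall tp, tp \in L -> `|tp.1| <= r,
      forall tp x, tp \in L -> `|x| <= r -> 0 <= tp.2.[x],
      forall x, \sum_(tp <- L) tp.2.[x] = 1 &
      forall x, `|x| <= r -> \sum_(tp <- L) tp.2.[x] * `|x - tp.1| <= eps].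
Proof.
move=> r0 e0; pose eta := eps / (4 * r).
have eta0 : 0 < eta by rewrite divr_gt0// mulr_gt0.
pose n := (Num.truncn (4 * r / (eta * eps))).+1.
have n0 : 0 < n%:R :> R by rewrite ltr0n.
have hn : 4 * r / (eta * eps) < n%:R.
  by rewrite /n truncnS_gt.
clearbody n.
pose U : {poly R} := (2 * r)^-1 *: ('X + r%:P).
have UE x : U.[x] = (x + r) / (2 * r) by rewrite !hornerE mulrC.
have U01 x : `|x| <= r -> 0 <= U.[x] <= 1.
  rewrite ler_norml UE => /andP[? ?].
  rewrite divr_ge0 ?ler_pdivrMr ?mul1r ?mulr_gt0//=; lra.
pose node k : R := - r + 2 * r * (k%:R / n%:R).
exists [seq (node kp.1, kp.2) | kp <- bernoulli_law U n]; split.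
- move=> _ /mapP[kp /bernoulli_law_le kn ->] /=.
  have k1 : 0 <= (kp.1%:R / n%:R : R) <= 1.
    by rewrite divr_ge0//= ler_pdivrMr// mul1r ler_nat.
  case/andP: k1 => k0 k1; rewrite /node ler_norml.
  move: (kp.1%:R / n%:R) k0 k1 => t t0 t1; clear -r0 t0 t1; nra.
- by move=> _ x /mapP[kp kL ->] /U01 xr /=; exact: bernoulli_law_ge0 kL.
- by move=> x; rewrite big_map /= bernoulli_law_sum.
move=> x xr; rewrite big_map /=.
pose delta := n%:R * eta; have d0 : 0 < delta by rewrite mulr_gt0.
(* Trades the absolute deviation for the variance: |y| is at most delta, or else at most y^2 /
   delta. *)
have absle (y : R) : `|y| <= delta + y ^+ 2 / delta.
  rewrite -[y ^+ 2]real_normK ?num_real// -(ler_pM2r d0) mulrDl divfK ?gt_eqF//.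
  by move: `|y| (normr_ge0 y) => t t0; clear -t0 d0; nra.
have pt kp : kp \in bernoulli_law U n -> kp.2.[x] * `|x - node kp.1| <=
    2 * r / n%:R * (kp.2.[x] * delta + kp.2.[x] * (kp.1%:R - n%:R * U.[x]) ^+ 2 / delta).
  move=> kL; have p0 := bernoulli_law_ge0 (U01 _ xr) kL.
  have -> : x - node kp.1 = - (2 * r / n%:R * (kp.1%:R - n%:R * U.[x])).
    by rewrite /node UE; field; rewrite !gt_eqF.
  rewrite normrN normrM gtr0_norm ?divr_gt0 ?mulr_gt0// mulrCA.
  rewrite ler_pM2l ?divr_gt0 ?mulr_gt0// -mulrA -mulrDr ler_wpM2l//.
rewrite big_seq (le_trans (ler_sum _ pt))// -big_seq -mulr_sumr big_split /= -!mulr_suml.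
rewrite bernoulli_law_sum bernoulli_law_variance subrr expr0n add0r mul1r.
have /andP[u0 u1] := U01 _ xr.
have uu : n%:R * (U.[x] * (1 - U.[x])) / delta <= eta^-1.
  rewrite /delta invfM mulrACA divff ?gt_eqF// mul1r ler_piMl ?invr_ge0 ?ltW//.
  by move: (U.[x]) u0 u1 => u u0 u1; clear -u0 u1; nra.
apply: (@le_trans _ _ (2 * r / n%:R * (delta + eta^-1))).
  by rewrite ler_pM2l ?divr_gt0 ?mulr_gt0// lerD2l.
have -> : 2 * r / n%:R * (delta + eta^-1) = eps / 2 + 2 * r / eta / n%:R.
  by rewrite /delta /eta; field; rewrite !gt_eqF.
have : 2 * r / eta / n%:R <= eps / 2.
  rewrite ler_pdivrMr//; move: hn; rewrite invfM mulrA ltr_pdivrMr// => hn.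
  have -> : 2 * r / eta = 4 * r / eta / 2 by field; rewrite gt_eqF.
  rewrite [leRHS]mulrAC ler_pM2r ?invr_gt0// [leRHS]mulrC; exact: ltW.
lra.
Qed.

End Weights.

(** * Leibniz bounds on cubes *)

Section Bounds.
Variables (R : realType) (d : nat).
Local Notation V := 'rV[R]_d.
Implicit Types (f g : V -> R) (i j : 'I_d) (s : seq 'I_d) (x y : V).

Lemma dseqD s f g : lsmooth f -> lsmooth g ->
  dseq s (fun x => f x + g x) = fun x => dseq s f x + dseq s g x.
Proof.
move=> sf sg; elim: s => //= i s ->.
by rewrite partialD//; exact: smooth_dseq.
Qed.

Lemma dseqB s f g : lsmooth f -> lsmooth g ->
  dseq s (fun x => f x - g x) = fun x => dseq s f x - dseq s g x.
Proof.
move=> sf sg; elim: s => //= i s ->.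
by rewrite partialB//; exact: smooth_dseq.
Qed.

Lemma dseq_cst0 s : dseq s (fun _ : V => 0) = fun=> 0.
Proof. by elim: s => //= i s ->; rewrite partial_cst. Qed.

Lemma partial_dseqC i s f : lsmooth f -> partial i (dseq s f) = dseq s (partial i f).
Proof.
move=> sf; elim: s => //= j s <-; apply: partialC; exact: smooth_dseq.
Qed.

(** Each derivative doubles the number of terms in the Leibniz expansion. *)
Lemma dseq_mul_bound s f g x (A B : R) : lsmooth f -> lsmooth g ->
  (forall s', (size s' <= size s)%N -> `|dseq s' f x| <= A) ->
  (forall s', (size s' <= size s)%N -> `|dseq s' g x| <= B) ->
  `|dseq s (fun x => f x * g x) x| <= 2 ^+ size s * (A * B).
Proof.
elim/last_ind: s f g => [|s i IH] f g sf sg hf hg /=.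
  by rewrite expr0 mul1r normrM ler_pM//; [exact: (hf [::])|exact: (hg [::])].
have si := smooth_partial i.
rewrite dseq_rcons partialM// dseqD; try by apply: smoothM => //; exact: si.
rewrite size_rcons exprS -mulrA mulr_natl mulr2n (le_trans (ler_normD _ _))// lerD//.
  apply: IH => //; first exact: si.
    by move=> s' hs'; rewrite -dseq_rcons; apply: hf; rewrite !size_rcons.
  by move=> s' hs'; apply: hg; rewrite size_rcons leqW.
apply: IH => //; first exact: si.
  by move=> s' hs'; apply: hf; rewrite size_rcons leqW.
by move=> s' hs'; rewrite -dseq_rcons; apply: hg; rewrite !size_rcons.
Qed.

Lemma cube_bound f (r : R) : continuous f ->
  exists2 A : R, 0 <= A & forall x, `|x| <= r -> `|f x| <= A.
Proof.
move=> cf.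
have cK : compact [set x : V | forall i, (`[(- r)%R, r]%classic : set R) (x ord0 i)]%classic.
  exact: (@rV_compact R d (fun=> `[(- r)%R, r]%classic) (fun=> @segment_compact R (- r) r)).
have /compact_bounded[M [_ HM]] :=
  continuous_compact (continuous_subspaceT cf) cK.
exists (`|M| + 1); first by rewrite addr_ge0.
move=> x xr; apply: (HM (`|M| + 1)); first by rewrite (le_lt_trans (ler_norm _))// ltrDl.
exists x => // i /=; rewrite in_itv /= -ler_norml.
exact: le_trans (coord_le_norm x i) xr.
Qed.

Lemma smooth_bound f N (r : R) : lsmooth f ->
  exists2 A : R, 0 <= A & forall s, (size s <= N)%N -> forall x, `|x| <= r -> `|dseq s f x| <= A.
Proof.
elim: N f => [|N IH] f sf.
  have [A A0 hA] := cube_bound r (smooth_cont sf); exists A => // s.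
  by rewrite leqn0 size_eq0 => /eqP -> x /hA.
have [A A0 hA] := cube_bound r (smooth_cont sf).
have /choice[B hB] : forall i, exists B : R, 0 <= B /\ forall s, (size s <= N)%N ->
    forall x, `|x| <= r -> `|dseq s (partial i f) x| <= B.
  by move=> i; have [B B0 hB] := IH _ (smooth_partial i sf); exists B.
have B0 i : 0 <= B i by have [] := hB i.
exists (A + \sum_i B i); first by rewrite addr_ge0// sumr_ge0.
elim/last_ind => [_ x /hA h|s i _]; first by rewrite (le_trans h)// lerDl sumr_ge0.
rewrite size_rcons ltnS dseq_rcons => ss x xr.
have [_ /(_ _ ss _ xr) h] := hB i; rewrite (le_trans h)//.
by rewrite (bigD1 i)//= addrCA lerDl addr_ge0// sumr_ge0.
Qed.

Lemma smooth_horner_coord (p : {poly R}) i : lsmooth (fun x : V => p.[x 0 i]).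
Proof.
elim/poly_ind: p => [|p c IH].
  by rewrite (_ : (fun _ => _) = fun=> 0); [exact: smooth_cst|apply/funext => x; rewrite horner0].
rewrite (_ : (fun _ => _) = fun x => p.[x 0 i] * x 0 i + c).
  apply: smoothD; last exact: smooth_cst.
  by apply: smoothM => //; exact: smooth_coord.
by apply/funext => x; rewrite !hornerE.
Qed.

Lemma partial_horner_coord (p : {poly R}) i j :
  partial j (fun x : V => p.[x 0 i]) = fun x => (if i == j then p^`() else 0).[x 0 i].
Proof.
elim/poly_ind: p => [|p c IH].
  rewrite (_ : (fun _ => _) = fun=> 0); last by apply/funext => x; rewrite horner0.
  by rewrite partial_cst deriv0; apply/funext => x; rewrite if_same horner0.
rewrite (_ : (fun _ => _) = fun x => p.[x 0 i] * x 0 i + c); last first.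
  by apply/funext => x; rewrite !hornerE.
have sp := smooth_horner_coord p i; have sx := @smooth_coord R d i.
rewrite partialD; [|exact: smoothM|exact: smooth_cst].
rewrite partialM// IH partial_cst partial_coord; apply/funext => x.
by case: eqP => _; rewrite ?derivD ?derivM ?derivX ?derivC !hornerE /=; ring.
Qed.

End Bounds.

(** * Functions approximable by polynomials *)

Section Density.
Variables (R : realType) (d : nat).
Local Notation V := 'rV[R]_d.
Implicit Types (f g : V -> R) (i j : 'I_d) (s : seq 'I_d) (x y : V).

Inductive rpoly : (V -> R) -> Prop :=
| rpoly_cst (c : R) : rpoly (fun=> c)
| rpoly_coord i : rpoly (fun x => x 0 i)
| rpolyD f g : rpoly f -> rpoly g -> rpoly (fun x => f x + g x)
| rpolyM f g : rpoly f -> rpoly g -> rpoly (fun x => f x * g x).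

Lemma rpoly_smooth f : rpoly f -> lsmooth f.
Proof.
elim=> [c|i|{}f g _ sf _ sg|{}f g _ sf _ sg]; first exact: smooth_cst.
- exact: smooth_coord.
- exact: smoothD.
- exact: smoothM.
Qed.

Lemma rpoly_horner_coord (p : {poly R}) i : rpoly (fun x => p.[x 0 i]).
Proof.
elim/poly_ind: p => [|p c IH].
  by rewrite (_ : (fun _ => _) = fun=> 0); [exact: rpoly_cst|apply/funext => x; rewrite horner0].
rewrite (_ : (fun _ => _) = fun x => p.[x 0 i] * x 0 i + c); last first.
  by apply/funext => x; rewrite !hornerE.
by apply: rpolyD; [apply: rpolyM => //; exact: rpoly_coord|exact: rpoly_cst].
Qed.

Definition approximable f := forall N (r eps : R), 0 < eps ->
  exists2 p, rpoly p & forall s, (size s <= N)%N -> forall x, `|x| <= r ->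
    `|dseq s (fun x => f x - p x) x| <= eps.

Lemma rpoly_approximable f : rpoly f -> approximable f.
Proof.
move=> pf N r eps e0; exists f => // s _ x _.
rewrite (_ : (fun x => f x - f x) = fun=> 0); last by apply/funext => y; rewrite subrr.
by rewrite dseq_cst0 normr0 ltW.
Qed.

Lemma approximableD f g : lsmooth f -> lsmooth g ->
  approximable f -> approximable g -> approximable (fun x => f x + g x).
Proof.
move=> sf sg af ag N r eps e0; have e2 : 0 < eps / 2 by rewrite divr_gt0.
have [p pp hp] := af N r _ e2; have [q pq hq] := ag N r _ e2.
exists (fun x => p x + q x); first exact: rpolyD.
move=> s ss x xr.
rewrite (_ : (fun x => _) = fun x => (f x - p x) + (g x - q x)); last first.
  by apply/funext => y; ring.
have sp := rpoly_smooth pp; have sq := rpoly_smooth pq.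
rewrite dseqD; try exact: smoothB.
by rewrite (le_trans (ler_normD _ _))// [eps]splitr lerD ?hp ?hq.
Qed.

Lemma approximableM f g : lsmooth f -> lsmooth g ->
  approximable f -> approximable g -> approximable (fun x => f x * g x).
Proof.
move=> sf sg af ag N r eps e0.
have [A A0 hA] := smooth_bound N r sf; have [B B0 hB] := smooth_bound N r sg.
(* The error splits into three products, of sizes A del, del B and del^2; keeping [del] at most 1
   bounds the last by [del]. *)
pose M := 2 ^+ N * (A + B + 1).
have M0 : 0 < M by rewrite mulr_gt0 ?exprn_gt0// ltr_wpDl// addr_ge0.
pose del := Num.min 1 (eps / M).
have d0 : 0 < del by rewrite lt_min ltr01 divr_gt0.
have [p pp hp] := af N r _ d0; have [q pq hq] := ag N r _ d0.
have sp := rpoly_smooth pp; have sq := rpoly_smooth pq.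
exists (fun x => p x * q x); first exact: rpolyM.
move=> s ss x xr.
rewrite (_ : (fun x => _) = fun x => (f x * (g x - q x) + (f x - p x) * g x) -
     (f x - p x) * (g x - q x)); last by apply/funext => y; ring.
have sfp := smoothB sf sp; have sgq := smoothB sg sq.
rewrite dseqB ?dseqD; try by [exact: smoothM|apply: smoothD; exact: smoothM].
have P1 := @dseq_mul_bound _ _ s f _ x A del sf sgq.
have P2 := @dseq_mul_bound _ _ s _ g x del B sfp sg.
have P3 := @dseq_mul_bound _ _ s _ _ x del del sfp sgq.
have le s' : (size s' <= size s)%N -> (size s' <= N)%N by move=> /leq_trans; apply.
have {}P1 := P1 (fun s' h => hA s' (le _ h) x xr) (fun s' h => hq s' (le _ h) x xr).
have {}P2 := P2 (fun s' h => hp s' (le _ h) x xr) (fun s' h => hB s' (le _ h) x xr).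
have {}P3 := P3 (fun s' h => hp s' (le _ h) x xr) (fun s' h => hq s' (le _ h) x xr).
rewrite (le_trans (ler_normB _ _))// (le_trans (lerD (ler_normD _ _) (lexx _)))//.
apply: (le_trans (lerD (lerD P1 P2) P3)).
rewrite -!mulrDr; apply: (@le_trans _ _ (2 ^+ N * (A * del + del * B + del * del))).
  by rewrite ler_wpM2r ?ler_weXn2l ?ler1n// !addr_ge0 ?mulr_ge0// ltW.
have d1 : del <= 1 by rewrite ge_min lexx.
have : M * del <= eps by rewrite mulrC -ler_pdivlMr// ge_min lexx orbT.
apply: le_trans; rewrite /M -mulrA ler_wpM2l ?exprn_ge0//.
have : del * del <= del by rewrite ler_piMr// ltW.
by move=> dd; clear -A0 B0 d0 d1 dd; clearbody del; lra.
Qed.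

Lemma approximable_closed f : lsmooth f ->
  (forall N (r eps : R), 0 < eps -> exists2 g, lsmooth g /\ approximable g &
    forall s, (size s <= N)%N -> forall x, `|x| <= r ->
    `|dseq s (fun x => f x - g x) x| <= eps) -> approximable f.
Proof.
move=> sf h N r eps e0; have e2 : 0 < eps / 2 by rewrite divr_gt0.
have [g [sg ag] hg] := h N r _ e2; have [p pp hp] := ag N r _ e2.
exists p => // s ss x xr; have sp := rpoly_smooth pp.
rewrite (_ : (fun x => _) = fun x => (f x - g x) + (g x - p x)); last first.
  by apply/funext => y; ring.
rewrite dseqD; try exact: smoothB.
by rewrite (le_trans (ler_normD _ _))// [eps]splitr lerD ?hp ?hg.
Qed.

End Density.

(** * Making one variable polynomial at a time *)

Section SliceApproximation.
Variables (R : realType) (d : nat).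
Local Notation V := 'rV[R]_d.
Implicit Types (f g : V -> R) (i j : 'I_d) (s : seq 'I_d) (x y : V).

Definition indep j f := forall x t, f (upd x j t) = f x.

(** Polynomials in the coordinate [i] with smooth coefficients. [J] records the coordinates already
    absent, so that eliminating one variable does not bring back another. *)
Inductive poly_in i (J : 'I_d -> Prop) : (V -> R) -> Prop :=
| poly_in0 : poly_in i J (fun=> 0)
| poly_in_add g (p : {poly R}) f : lsmooth g -> indep i g ->
    (forall j, J j -> indep j g) -> poly_in i J f ->
    poly_in i J (fun x => g x * p.[x 0 i] + f x).

Lemma poly_in_smooth i J f : poly_in i J f -> lsmooth f.
Proof.
elim=> [|g p {}f sg _ _ _ sf]; first exact: smooth_cst.
by apply: smoothD => //; apply: smoothM => //; exact: smooth_horner_coord.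
Qed.

Lemma indep_partial0 i f : lsmooth f -> indep i f -> partial i f = fun=> 0.
Proof.
move=> sf hf; rewrite (_ : f = fun x => f (upd x i 0)); last first.
  by apply/funext => x; rewrite hf.
by rewrite partial_upd// eqxx.
Qed.

Lemma indep_partial i j f : lsmooth f -> indep j f -> indep j (partial i f).
Proof.
move=> sf hf x t.
have e : partial i f = if j == i then fun=> 0 else fun y => partial i f (upd y j t).
  by rewrite -partial_upd//; congr partial; apply/funext => y; rewrite hf.
have upd2 y : upd (upd y j t) j t = upd y j t.
  by apply/rowP => k; rewrite !mxE; case: eqP.
by rewrite e; case: eqP => // _; rewrite upd2.
Qed.

Lemma indep_upd i j f c : indep j f -> indep j (fun x => f (upd x i c)).
Proof.
move=> hf x t; have [->|ij] := eqVneq i j; last by rewrite -updC// hf.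
by congr f; apply/rowP => k; rewrite !mxE; case: eqP.
Qed.

Lemma indep_upd_eq i f c : indep i (fun x => f (upd x i c)).
Proof. by move=> x t; congr f; apply/rowP => k; rewrite !mxE; case: eqP. Qed.

Lemma poly_deriv_primitive (p : {poly R}) : exists2 q : {poly R}, q^`() = p & q.[0] = 0.
Proof.
exists ('X * \poly_(k < size p) (p`_k / k.+1%:R)); last by rewrite !hornerE.
apply/polyP => k; rewrite coef_deriv coefXM /= coef_poly.
case: ltnP => [_|hk]; last by rewrite mul0rn nth_default.
by rewrite -[LHS]mulr_natr divfK// pnatr_eq0.
Qed.

Lemma poly_in_primitive i J f : poly_in i J f -> exists F, [/\ poly_in i J F,
  partial i F = f & forall x, F (upd x i 0) = 0].
Proof.
elim=> [|g p {}f sg ig iJ _ [F [hF pF F0]]].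
  by exists (fun=> 0); split => //; [exact: poly_in0|rewrite partial_cst].
have [q dq q0] := poly_deriv_primitive p.
exists (fun x => g x * q.[x 0 i] + F x); split.
- exact: poly_in_add.
- have sq := smooth_horner_coord q i; have sF := poly_in_smooth hF.
  rewrite partialD//; last exact: smoothM.
  rewrite partialM// (indep_partial0 sg ig) partial_horner_coord eqxx dq pF.
  by apply/funext => x; rewrite mul0r add0r.
- by move=> x; rewrite F0 updE eqxx q0 mulr0 addr0.
Qed.

Lemma dseq_slice_mul s i f (p : {poly R}) c : lsmooth f -> i \notin s ->
  dseq s (fun x => f (upd x i c) * p.[x 0 i]) = fun x => dseq s f (upd x i c) * p.[x 0 i].
Proof.
move=> sf; elim: s => //= j s IH; rewrite inE negb_or => /andP[ij is_].
have ssf := smooth_dseq s sf; have sp := smooth_horner_coord p i.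
rewrite IH// partialM//; last exact: smooth_upd.
rewrite partial_upd// partial_horner_coord (negbTE ij).
by apply/funext => x; rewrite horner0 mulr0 addr0.
Qed.

Lemma dseq_slice s i f c : lsmooth f -> i \notin s ->
  dseq s (fun x => f (upd x i c)) = fun x => dseq s f (upd x i c).
Proof.
move=> sf; elim: s => //= j s IH; rewrite inE negb_or => /andP[ij is_].
by rewrite IH// partial_upd ?(negbTE ij)//; exact: smooth_dseq.
Qed.

Lemma poly_in_slices i (J : 'I_d -> Prop) f (L : seq (R * {poly R})) :
  lsmooth f -> (forall j, J j -> indep j f) ->
  poly_in i J (fun x => \sum_(tp <- L) f (upd x i tp.1) * tp.2.[x 0 i]).
Proof.
move=> sf hf; elim: L => [|tp L IH].
  by rewrite (_ : (fun _ => _) = fun=> 0); [exact: poly_in0|apply/funext => x; rewrite big_nil].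
rewrite (_ : (fun _ => _) = fun x => f (upd x i tp.1) * tp.2.[x 0 i] +
    \sum_(tp <- L) f (upd x i tp.1) * tp.2.[x 0 i]).
  apply: (@poly_in_add i J (fun x => f (upd x i tp.1)) tp.2) => //.
  - exact: smooth_upd.
  - exact: indep_upd_eq.
  - by move=> j /hf; exact: indep_upd.
by apply/funext => x; rewrite big_cons.
Qed.

Lemma dseq_slices s i f (L : seq (R * {poly R})) : lsmooth f -> i \notin s ->
  dseq s (fun x => \sum_(tp <- L) f (upd x i tp.1) * tp.2.[x 0 i]) =
  fun x => \sum_(tp <- L) dseq s f (upd x i tp.1) * tp.2.[x 0 i].
Proof.
move=> sf is_; elim: L => [|tp L IH].
  rewrite (_ : (fun _ => _) = fun=> 0); last by apply/funext => x; rewrite big_nil.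
  by rewrite dseq_cst0; apply/funext => x; rewrite big_nil.
rewrite (_ : (fun _ => _) = fun x => f (upd x i tp.1) * tp.2.[x 0 i] +
    \sum_(tp <- L) f (upd x i tp.1) * tp.2.[x 0 i]); last first.
  by apply/funext => x; rewrite big_cons.
rewrite dseqD.
- by rewrite dseq_slice_mul// IH; apply/funext => x; rewrite big_cons.
- by apply: smoothM; [exact: smooth_upd|exact: smooth_horner_coord].
apply: smooth_sum => tp' _.
by apply: smoothM; [exact: smooth_upd|exact: smooth_horner_coord].
Qed.

(** Induction on the number [a] of derivatives in direction [i]. With none, the weights commute with
    the remaining derivatives and the mean value theorem bounds the error. Otherwise the approximant
    of [partial i f] is integrated from the slice where the coordinate is 0, on which [f] is kept
    exactly. *)
Lemma slice_approximation i (J : 'I_d -> Prop) (r : R) a b : 0 < r ->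
  forall f (eps : R), lsmooth f -> (forall j, J j -> indep j f) -> 0 < eps ->
  exists2 Q, poly_in i J Q & forall s, (count_mem i s <= a)%N ->
    (count (predC1 i) s <= b)%N -> forall x, `|x| <= r ->
    `|dseq s (fun x => f x - Q x) x| <= eps.
Proof.
move=> r0; elim: a => [|a IH] f eps sf hf e0.
  (* One order more than [b]: the mean value theorem spends a derivative in direction [i]. *)
  have [A A0 hA] := smooth_bound b.+1 r sf.
  have A1 : 0 < A + 1 by rewrite ltr_wpDl.
  have [L [Lr Lp L1 Le]] := weierstrass_weights r0 (divr_gt0 e0 A1).
  have hQ := @poly_in_slices i J f L sf hf.
  exists (fun x => \sum_(tp <- L) f (upd x i tp.1) * tp.2.[x 0 i]) => // s.
  rewrite leqn0 => /eqP ci cs x xr.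
  have is_ : i \notin s by apply/count_memPn.
  have ss : (size s <= b)%N by rewrite -(count_predC (pred1 i) s) ci.
  rewrite dseqB//; last exact: poly_in_smooth hQ.
  rewrite dseq_slices// -[dseq s f x]mulr1 -(L1 (x 0 i)) mulr_sumr -sumrB.
  rewrite (le_trans (ler_norm_sum _ _ _))//.
  have xir : `|x 0 i| <= r by exact: le_trans (coord_le_norm x i) xr.
  apply: (@le_trans _ _ (\sum_(tp <- L) A * (tp.2.[x 0 i] * `|x 0 i - tp.1|))).
    rewrite big_seq [leRHS]big_seq; apply: ler_sum => tp tL.
    rewrite -mulrBl normrM (ger0_norm (Lp _ _ tL xir)) [leRHS]mulrCA mulrC.
    rewrite ler_wpM2l ?(Lp _ _ tL xir)//.
    have [c hc] := slice_mvt i x tp.1 (x 0 i) (smooth_dseq s sf).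
    rewrite upd_id => ->; rewrite normrM ler_wpM2r//.
    apply: (hA (i :: s)); first by rewrite ltnS.
    by rewrite norm_upd// -[c]subr0 hc// subr0// Lr.
  rewrite -mulr_sumr (le_trans (ler_wpM2l A0 (Le _ xir)))//.
  rewrite mulrCA ler_piMr ?ltW// ltr_pdivrMr// mul1r.
  by rewrite ltrDl.
have r1 : 0 < 1 + r by rewrite addr_gt0.
have spf := smooth_partial i sf.
have hpf j : J j -> indep j (partial i f) by move=> /hf; exact: indep_partial.
(* The divisor 1 + r serves both cases below: [eps / (1 + r)] is at most [eps], and so is its
   product with [r], the bound on the length of the path from the zero slice. *)
have e1 := divr_gt0 e0 r1.
have [Q' pQ' hQ'] := IH _ _ spf hpf e1.
have [P [pP dP P0]] := poly_in_primitive pQ'.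
pose f0 x := f (upd x i 0).
have sf0 : lsmooth f0 by exact: smooth_upd.
pose Q x := f0 x * (1 : {poly R}).[x 0 i] + P x.
have pQ : poly_in i J Q.
  apply: poly_in_add => //; first exact: indep_upd_eq.
  by move=> j /hf; exact: indep_upd.
have sQ := poly_in_smooth pQ; have sP := poly_in_smooth pP.
have QE : Q = fun x => f0 x + P x by apply/funext => x; rewrite /Q hornerC mulr1.
have sfQ := smoothB sf sQ.
have dfQ : partial i (fun x => f x - Q x) = fun x => partial i f x - Q' x.
  rewrite partialB// QE partialD// dP (indep_partial0 sf0 (@indep_upd_eq i f 0)).
  by apply/funext => x; rewrite add0r.
have eps1 : eps / (1 + r) <= eps.
  by rewrite ler_pdivrMr// mulrDr mulr1 lerDl mulr_ge0 ?ltW.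
exists Q => // s ca cb x xr.
have [is_|is_] := boolP (i \in s).
  have [s1 [s2 es]] : exists s1 s2, s = s1 ++ i :: s2.
    by case/splitPr: is_ => s1 s2; exists s1, s2.
  rewrite es dseq_cat /= partial_dseqC// -dseq_cat dfQ (le_trans _ eps1)// hQ'//.
    by move: ca; rewrite es !count_cat /= eqxx addnCA add1n ltnS.
  by move: cb; rewrite es !count_cat /= eqxx add0n.
have [c hc] := slice_mvt i x 0 (x 0 i) (smooth_dseq s sfQ).
have xir : `|x 0 i| <= r by exact: le_trans (coord_le_norm x i) xr.
have cr : `|c| <= r by rewrite -[c]subr0 hc// subr0// normr0 ltW.
have -> : dseq s (fun x => f x - Q x) (upd x i 0) = 0.
  have := dseq_slice 0 sfQ is_ => /(congr1 (fun h => h x)) /= <-.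
  rewrite (_ : (fun y => _) = fun=> 0) ?dseq_cst0//.
  apply/funext => y; rewrite QE /f0 P0 addr0.
  have -> : upd (upd y i 0) i 0 = upd y i 0 by apply/rowP => k; rewrite !mxE; case: eqP.
  by rewrite subrr.
rewrite upd_id subr0 => ->; rewrite partial_dseqC// dfQ subr0 normrM.
apply: (@le_trans _ _ (eps / (1 + r) * r)).
  rewrite ler_pM// hQ'//; last by rewrite norm_upd.
  by move/count_memPn: is_ => ->.
by rewrite mulrAC ler_pdivrMr// ler_wpM2l ?ltW// ltrDr.
Qed.

Lemma poly_in_approximable i J f : poly_in i J f ->
  (forall g, lsmooth g -> indep i g -> (forall j, J j -> indep j g) -> approximable g) ->
  approximable f.
Proof.
move=> hf h; elim: hf => [|g p {}f sg ig Jg hf af].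
  by apply: rpoly_approximable; exact: rpoly_cst.
have sp := smooth_horner_coord p i; have ap := rpoly_approximable (rpoly_horner_coord p i).
apply: approximableD => //; [exact: smoothM|exact: poly_in_smooth hf|].
by apply: approximableM => //; exact: h.
Qed.

Lemma indep_cst f : (forall i, indep i f) -> f = fun=> f 0.
Proof.
move=> hf; apply/funext => x.
suff h (s : seq 'I_d) : f (\row_j (if j \in s then 0 else x 0 j)) = f x.
  rewrite -(h (enum 'I_d)); congr f; apply/rowP => j.
  by rewrite !mxE mem_enum.
elim: s => [|i s IH]; first by congr f; apply/rowP => j; rewrite mxE.
rewrite -{}IH -[RHS](hf i _ 0); congr f; apply/rowP => j.
by rewrite !mxE inE; case: eqP.
Qed.

(** Induction on the list of coordinates on which the function may depend: a slice approximation
    makes one of them polynomial, and its coefficients depend only on the others. *)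
Lemma smooth_approximable f : lsmooth f -> approximable f.
Proof.
suff h (s : seq 'I_d) g : lsmooth g -> (forall j, j \notin s -> indep j g) -> approximable g.
  by move=> sf; apply: (h (enum 'I_d)) => // j; rewrite mem_enum.
elim: s g => [|i s IH] g sg hg.
  by rewrite (indep_cst (fun j => hg j isT)); apply: rpoly_approximable; exact: rpoly_cst.
apply: approximable_closed => // N r eps e0.
have r0 : 0 < `|r| + 1 by rewrite ltr_wpDl.
have [Q pQ hQ] := @slice_approximation i (fun j => j \notin i :: s) _ N N r0 g eps sg hg e0.
exists Q.
  split; first exact: poly_in_smooth pQ.
  apply: poly_in_approximable pQ _ => u su iu Ju.
  apply: IH => // j js; have [->//|ji] := eqVneq j i.
  by apply: Ju; rewrite inE negb_or ji.
move=> t tN x xr; apply: hQ.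
- exact: leq_trans (count_size _ _) tN.
- exact: leq_trans (count_size _ _) tN.
- by rewrite (le_trans xr)// (le_trans (ler_norm _))// lerDl.
Qed.

End SliceApproximation.

(** * Complex-valued smooth functions *)

Section ComplexCalculus.
Variables (R : realType) (d : nat).
Local Notation V := 'rV[R]_d.
Local Notation C := R[i].
Local Notation Re := complex.Re.
Local Notation Im := complex.Im.
Implicit Types (f g : V -> R) (h k : V -> C) (i j : 'I_d) (s : seq 'I_d) (x y : V).

Definition csmooth h := lsmooth (fun x => Re (h x)) /\ lsmooth (fun x => Im (h x)).

Definition cpartial i h : V -> C :=
  fun x => Complex (partial i (fun x => Re (h x)) x) (partial i (fun x => Im (h x)) x).

Definition cdseq s h : V -> C := foldr cpartial h s.

Lemma complex_eqP (a b : C) : Re a = Re b -> Im a = Im b -> a = b.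
Proof. by case: a b => [a1 a2] [b1 b2] /= -> ->. Qed.

Lemma ReD (a b : C) : Re (a + b) = Re a + Re b. Proof. by case: a b => [? ?] [? ?]. Qed.
Lemma ImD (a b : C) : Im (a + b) = Im a + Im b. Proof. by case: a b => [? ?] [? ?]. Qed.
Lemma ReM (a b : C) : Re (a * b) = Re a * Re b - Im a * Im b.
Proof. by case: a b => [? ?] [? ?]. Qed.
Lemma ImM (a b : C) : Im (a * b) = Re a * Im b + Im a * Re b.
Proof. by case: a b => [? ?] [? ?]. Qed.
Lemma Re_conj (a : C) : Re (a^*)%C = Re a. Proof. by case: a. Qed.
Lemma Im_conj (a : C) : Im (a^*)%C = - Im a. Proof. by case: a. Qed.

Lemma csmooth_cst (c : C) : csmooth (fun=> c).
Proof. by split; exact: smooth_cst. Qed.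

Lemma csmooth_real f : lsmooth f -> csmooth (fun x => (f x)%:C%C).
Proof. by move=> sf; split => //; exact: smooth_cst. Qed.

Lemma csmoothD h k : csmooth h -> csmooth k -> csmooth (fun x => h x + k x).
Proof.
move=> [h1 h2] [k1 k2]; split.
  by rewrite (_ : (fun _ => _) = fun x => Re (h x) + Re (k x)); [exact: smoothD|apply/funext => x; rewrite ReD].
by rewrite (_ : (fun _ => _) = fun x => Im (h x) + Im (k x)); [exact: smoothD|apply/funext => x; rewrite ImD].
Qed.

Lemma csmoothM h k : csmooth h -> csmooth k -> csmooth (fun x => h x * k x).
Proof.
move=> [h1 h2] [k1 k2]; split.
  rewrite (_ : (fun _ => _) = fun x => Re (h x) * Re (k x) - Im (h x) * Im (k x)).
    by apply: smoothB; exact: smoothM.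
  by apply/funext => x; rewrite ReM.
rewrite (_ : (fun _ => _) = fun x => Re (h x) * Im (k x) + Im (h x) * Re (k x)).
  by apply: smoothD; exact: smoothM.
by apply/funext => x; rewrite ImM.
Qed.

Lemma csmooth_conj h : csmooth h -> csmooth (fun x => (h x)^*%C).
Proof.
move=> [h1 h2]; split.
  by rewrite (_ : (fun _ => _) = fun x => Re (h x)) //; apply/funext => x; rewrite Re_conj.
rewrite (_ : (fun _ => _) = fun x => - Im (h x)); first exact: smoothN.
by apply/funext => x; rewrite Im_conj.
Qed.

Lemma csmoothX h n : csmooth h -> csmooth (fun x => h x ^+ n).
Proof.
move=> sh; elim: n => [|n IH]; first exact: csmooth_cst.
rewrite (_ : (fun _ => _) = fun x => h x * h x ^+ n); first exact: csmoothM.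
by apply/funext => x; rewrite exprS.
Qed.

Lemma csmooth_sum (T : Type) (r : seq T) (P : pred T) (F : T -> V -> C) :
  (forall t, csmooth (F t)) -> csmooth (fun x => \sum_(t <- r | P t) F t x).
Proof.
move=> sF; elim: r => [|t r IH].
  by rewrite (_ : (fun _ => _) = fun=> 0); [exact: csmooth_cst|apply/funext => x; rewrite big_nil].
rewrite (_ : (fun _ => _) = fun x => if P t then F t x + \sum_(u <- r | P u) F u x
    else \sum_(u <- r | P u) F u x); last by apply/funext => x; rewrite big_cons.
by case Pt: (P t) => //; apply: csmoothD.
Qed.

Lemma csmooth_prod (T : Type) (r : seq T) (P : pred T) (F : T -> V -> C) :
  (forall t, csmooth (F t)) -> csmooth (fun x => \prod_(t <- r | P t) F t x).
Proof.
move=> sF; elim: r => [|t r IH].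
  by rewrite (_ : (fun _ => _) = fun=> 1); [exact: csmooth_cst|apply/funext => x; rewrite big_nil].
rewrite (_ : (fun _ => _) = fun x => if P t then F t x * \prod_(u <- r | P u) F u x
    else \prod_(u <- r | P u) F u x); last by apply/funext => x; rewrite big_cons.
by case Pt: (P t) => //; apply: csmoothM.
Qed.

Lemma csmooth_horner (p : {poly C}) h : csmooth h -> csmooth (fun x => p.[h x]).
Proof.
move=> sh; rewrite (_ : (fun _ => _) = fun x => \sum_(a < size p) p`_a * h x ^+ a).
  apply: csmooth_sum => a; apply: csmoothM; first exact: csmooth_cst.
  exact: csmoothX.
by apply/funext => x; rewrite horner_coef.
Qed.

Lemma csmooth_cpartial i h : csmooth h -> csmooth (cpartial i h).
Proof. by move=> [h1 h2]; split; exact: smooth_partial. Qed.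

Lemma csmooth_cdseq s h : csmooth h -> csmooth (cdseq s h).
Proof. by move=> sh; elim: s => //= i s; exact: csmooth_cpartial. Qed.

Lemma Re_cdseq s h : (fun x => Re (cdseq s h x)) = dseq s (fun x => Re (h x)).
Proof. by elim: s => //= i s <-. Qed.

Lemma Im_cdseq s h : (fun x => Im (cdseq s h x)) = dseq s (fun x => Im (h x)).
Proof. by elim: s => //= i s <-. Qed.

Lemma cdseq_rcons s i h : cdseq (rcons s i) h = cdseq s (cpartial i h).
Proof. by rewrite /cdseq -cats1 foldr_cat. Qed.

Lemma cpartial_cst i (c : C) : cpartial i (fun=> c) = fun=> 0.
Proof. by apply/funext => x; rewrite /cpartial !partial_cst. Qed.

Lemma cpartialD i h k : csmooth h -> csmooth k ->
  cpartial i (fun x => h x + k x) = fun x => cpartial i h x + cpartial i k x.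
Proof.
move=> [h1 h2] [k1 k2]; apply/funext => x; rewrite /cpartial.
rewrite (_ : (fun x => Re _) = fun x => Re (h x) + Re (k x)); last by apply/funext => y; rewrite ReD.
rewrite (_ : (fun x => Im _) = fun x => Im (h x) + Im (k x)); last by apply/funext => y; rewrite ImD.
by rewrite !partialD.
Qed.

Lemma cpartialM i h k : csmooth h -> csmooth k ->
  cpartial i (fun x => h x * k x) = fun x => cpartial i h x * k x + h x * cpartial i k x.
Proof.
move=> [h1 h2] [k1 k2]; apply/funext => x; rewrite /cpartial.
rewrite (_ : (fun x => Re _) = fun x => Re (h x) * Re (k x) - Im (h x) * Im (k x)); last first.
  by apply/funext => y; rewrite ReM.
rewrite (_ : (fun x => Im _) = fun x => Re (h x) * Im (k x) + Im (h x) * Re (k x)); last first.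
  by apply/funext => y; rewrite ImM.
rewrite partialB ?partialD ?partialM//; try exact: smoothM.
by apply: complex_eqP; rewrite ?(ReD, ImD, ReM, ImM) /=; ring.
Qed.

Lemma cpartial_conj i h : csmooth h ->
  cpartial i (fun x => (h x)^*%C) = fun x => (cpartial i h x)^*%C.
Proof.
move=> [h1 h2]; apply/funext => x; rewrite /cpartial /=.
rewrite (_ : (fun x => Re _) = fun x => Re (h x)); last by apply/funext => y; rewrite Re_conj.
rewrite (_ : (fun x => Im (h x)^*%C) = fun x => 0 - Im (h x)); last first.
  by apply/funext => y; rewrite Im_conj sub0r.
by rewrite partialB ?partial_cst ?sub0r//; exact: smooth_cst.
Qed.

Lemma cdseqD s h k : csmooth h -> csmooth k ->
  cdseq s (fun x => h x + k x) = fun x => cdseq s h x + cdseq s k x.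
Proof.
move=> sh sk; elim: s => //= i s ->.
by rewrite cpartialD//; exact: csmooth_cdseq.
Qed.

Lemma cdseqZ s (c : C) h : csmooth h ->
  cdseq s (fun x => c * h x) = fun x => c * cdseq s h x.
Proof.
move=> sh; elim: s => //= i s ->.
rewrite cpartialM ?cpartial_cst; first by apply/funext => x; rewrite mul0r add0r.
  exact: csmooth_cst.
exact: csmooth_cdseq.
Qed.

Lemma cdseq_mul_bound s h k x (A B : C) : csmooth h -> csmooth k ->
  (forall s', (size s' <= size s)%N -> `|cdseq s' h x| <= A) ->
  (forall s', (size s' <= size s)%N -> `|cdseq s' k x| <= B) ->
  `|cdseq s (fun x => h x * k x) x| <= 2 ^+ size s * (A * B).
Proof.
elim/last_ind: s h k => [|s i IH] h k sh sk hh hk /=.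
  by rewrite expr0 mul1r normrM ler_pM//; [exact: (hh [::])|exact: (hk [::])].
have si := csmooth_cpartial i.
rewrite cdseq_rcons cpartialM// cdseqD; try by apply: csmoothM => //; exact: si.
rewrite size_rcons exprS -mulrA mulr_natl mulr2n (le_trans (ler_normD _ _))// lerD//.
  apply: IH => //; first exact: si.
    by move=> s' hs'; rewrite -cdseq_rcons; apply: hh; rewrite !size_rcons.
  by move=> s' hs'; apply: hk; rewrite size_rcons leqW.
apply: IH => //; first exact: si.
  by move=> s' hs'; apply: hh; rewrite size_rcons leqW.
by move=> s' hs'; rewrite -cdseq_rcons; apply: hk; rewrite !size_rcons.
Qed.

Lemma norm_complex_le (a : C) : `|a| <= (`|Re a| + `|Im a|)%:C%C.
Proof.
rewrite {1}[a]complexE (le_trans (ler_normD _ _))// rmorphD lerD//.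
  by rewrite normc_def /= expr0n /= addr0 sqrtr_sqr.
by rewrite normrM !normc_def /= !expr0n /= expr1n add0r addr0 sqrtr1 mul1r sqrtr_sqr.
Qed.

Lemma norm_Re_Im_le (a : C) (M : R) : `|a| <= M%:C%C -> `|Re a| <= M /\ `|Im a| <= M.
Proof.
rewrite normc_def lecR => h; split; apply: le_trans h.
  by rewrite -sqrtr_sqr ler_wsqrtr// lerDl sqr_ge0.
by rewrite -sqrtr_sqr ler_wsqrtr// lerDr sqr_ge0.
Qed.

Lemma csmooth_bound h N (r : R) : csmooth h ->
  exists2 A : R, 0 <= A & forall s, (size s <= N)%N -> forall x, `|x| <= r -> `|cdseq s h x| <= A%:C%C.
Proof.
move=> [h1 h2]; have [A A0 hA] := smooth_bound N r h1; have [B B0 hB] := smooth_bound N r h2.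
exists (A + B); first exact: addr_ge0.
move=> s ss x xr; rewrite (le_trans (norm_complex_le _))// lecR.
by rewrite lerD// -?(Re_cdseq s h) -?(Im_cdseq s h)//;
  [rewrite (congr1 (fun u => u x) (Re_cdseq s h)) hA|rewrite (congr1 (fun u => u x) (Im_cdseq s h)) hB].
Qed.

End ComplexCalculus.

(** * Distributions with compact support *)

Section Functionals.
Variables (R : realType) (d : nat).
Local Notation V := 'rV[R]_d.
Local Notation C := R[i].
Local Notation Re := complex.Re.
Local Notation Im := complex.Im.
Implicit Types (f g u : V -> R) (h k : V -> C) (i j : 'I_d) (s : seq 'I_d) (x y : V).
Implicit Types (L : (V -> R) -> C).

Definition smooth_linear L := forall (a : R) f g, lsmooth f -> lsmooth g ->
  L (fun x => a * f x + g x) = a%:C%C * L f + L g.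

(** A positive radius puts the origin in the ball, which forces every admissible [M] to be
    nonnegative. *)
Definition smooth_bounded L := exists (K r : R) (N : nat), [/\ 0 <= K, 0 < r &
  forall phi, lsmooth phi -> forall M : R,
    (forall s, (size s <= N)%N -> forall x, `|x| <= r -> `|dseq s phi x| <= M) ->
    `|L phi| <= (K * M)%:C%C].

Definition distrib L := smooth_linear L /\ smooth_bounded L.

Lemma compact_distribution_distrib L : compact_distribution L -> distrib L.
Proof.
rewrite /compact_distribution; have <- : @lsmooth R d = @smooth R d.
  by apply/funext => f; rewrite lsmoothE.
move=> [lL [K [r [N [K0 h]]]]]; split => //.
exists K, (`|r| + 1), N; split => //.
move=> phi sp M hM; apply: h => // s sN x xr; apply: hM => //.
by rewrite (le_trans xr)// (le_trans (ler_norm _))// lerDl.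
Qed.

Lemma distribD L1 L2 : distrib L1 -> distrib L2 -> distrib (fun f => L1 f + L2 f).
Proof.
move=> [l1 [K1 [r1 [N1 [K10 r10 h1]]]]] [l2 [K2 [r2 [N2 [K20 r20 h2]]]]]; split.
  by move=> a f g sf sg; rewrite l1// l2//; ring.
exists (K1 + K2), (Num.max r1 r2), (maxn N1 N2); split.
- exact: addr_ge0.
- by rewrite lt_max r10.
move=> phi sp M hM; rewrite (le_trans (ler_normD _ _))// mulrDl rmorphD lerD//.
  by apply: h1 => // s ss x xr; apply: hM; rewrite ?leq_max ?ss// le_max xr.
by apply: h2 => // s ss x xr; apply: hM; rewrite ?leq_max ?ss ?orbT// le_max xr orbT.
Qed.

Lemma distribZ (c : C) L : distrib L -> distrib (fun f => c * L f).
Proof.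
move=> [lL [K [r [N [K0 r0 h]]]]]; split.
  by move=> a f g sf sg; rewrite lL//; ring.
exists (complex.Re `|c| * K), r, N; split => //.
  by rewrite mulr_ge0// normc_def /= sqrtr_ge0.
move=> phi sp M hM; have -> : (Re `|c| * K * M)%:C%C = `|c| * (K * M)%:C%C.
  by rewrite -mulrA rmorphM; congr (_ * _); rewrite !normc_def.
by rewrite normrM ler_wpM2l//; exact: h.
Qed.

Lemma distrib0 : distrib (fun=> 0).
Proof.
split; first by move=> *; rewrite mulr0 addr0.
by exists 0, 1, 0%N; split => // phi _ M _; rewrite normr0 mul0r.
Qed.

Lemma distrib_sum (T : Type) (t : seq T) (P : pred T) (L : T -> (V -> R) -> C) :
  (forall a, distrib (L a)) -> distrib (fun f => \sum_(a <- t | P a) L a f).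
Proof.
move=> hL; elim: t => [|a t IH].
  by rewrite (_ : (fun _ => _) = fun=> 0); [exact: distrib0|apply/funext => x; rewrite big_nil].
rewrite (_ : (fun _ => _) = fun f => if P a then L a f + \sum_(a <- t | P a) L a f
    else \sum_(a <- t | P a) L a f); last by apply/funext => x; rewrite big_cons.
by case: (P a) => //; exact: distribD.
Qed.

Lemma distrib_conj L : distrib L -> distrib (fun f => (L f)^*%C).
Proof.
move=> [lL [K [r [N [K0 r0 h]]]]]; split.
  by move=> a f g sf sg; rewrite lL// rmorphD rmorphM /= oppr0.
exists K, r, N; split => // phi sp M hM.
by rewrite (_ : `|(L phi)^*%C| = `|L phi|); [exact: h|rewrite !normc_def Re_conj Im_conj sqrrN].
Qed.

Lemma distrib_mul u L : lsmooth u -> distrib L -> distrib (fun f => L (fun x => u x * f x)).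
Proof.
move=> su [lL [K [r [N [K0 r0 h]]]]]; split.
  move=> a f g sf sg; rewrite -lL; try exact: smoothM.
  by congr L; apply/funext => x; ring.
have [A A0 hA] := smooth_bound N r su.
exists (K * (2 ^+ N * A)), r, N; split => //; first by rewrite !mulr_ge0// exprn_ge0.
move=> phi sp M hM; rewrite -!mulrA; apply: h; first exact: smoothM.
have M0 : 0 <= M.
  by rewrite (le_trans _ (hM [::] isT 0 _))// normr0 ltW.
move=> s ss x xr; apply: (@le_trans _ _ (2 ^+ size s * (A * M))).
  apply: dseq_mul_bound => // s' hs'; [apply: hA|apply: hM] => //; exact: leq_trans hs' ss.
by rewrite ler_wpM2r ?mulr_ge0// ler_weXn2l// ler1n.
Qed.

Lemma distrib_eval s (w : V) : distrib (fun f => (dseq s f w)%:C%C).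
Proof.
split.
  move=> a f g sf sg; rewrite -rmorphM -rmorphD; congr (_%:C)%C.
  have -> : (fun x => a * f x + g x) = fun x => (cst a x) * f x + g x by [].
  rewrite dseqD//; last by apply: smoothM => //; exact: smooth_cst.
  congr (_ + _); suff -> : dseq s (fun x => cst a x * f x) = fun x => a * dseq s f x by [].
  elim: s => //= i s ->; rewrite partialM ?partial_cst.
  - by apply/funext => x; rewrite mul0r add0r.
  - exact: smooth_cst.
  - exact: smooth_dseq.
exists 1, (`|w| + 1), (size s); split => //.
move=> phi sp M hM; rewrite mul1r normc_def /= expr0n addr0 sqrtr_sqr lecR.
by apply: hM => //; rewrite lerDl.
Qed.

Lemma distrib_density L : distrib L -> (forall p, rpoly p -> L p = 0) ->
  forall f, lsmooth f -> L f = 0.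
Proof.
move=> [lL [K [r [N [K0 r0 h]]]]] L0 f sf.
have close (eps : R) : 0 < eps -> `|L f| <= (K * eps)%:C%C.
  move=> e0; have [p pp hp] := smooth_approximable sf N r e0.
  have sp := rpoly_smooth pp.
  have -> : L f = L (fun x => f x - p x).
    rewrite (_ : f = fun x => 1 * (f x - p x) + p x); last by apply/funext => x; ring.
    rewrite lL//; last exact: smoothB.
    rewrite (L0 p pp) addr0 rmorph1 mul1r; congr L; apply/funext => x; ring.
  by apply: h => //; exact: smoothB.
apply/eqP; rewrite -normr_eq0 normc_def; apply/eqP; congr (_%:C)%C.
apply/eqP; rewrite eq_le sqrtr_ge0 andbT.
apply/ler_addgt0Pl => eps e0; rewrite addr0.
have K1 : 0 < K + 1 by rewrite ltr_wpDl.
have := close _ (divr_gt0 e0 K1); rewrite normc_def lecR => /le_trans; apply.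
by rewrite mulrCA ler_piMr ?ltW// ltr_pdivrMr// mul1r ltrDl.
Qed.

Section Pairing.
Variable L : (V -> R) -> C.
Hypothesis dL : distrib L.

Lemma distrib_at0 : L (fun=> 0) = 0.
Proof.
have [lL _] := dL; have s0 := @smooth_cst R d 0.
have : L (fun=> 0) = L (fun=> 0) + L (fun=> 0).
  rewrite -[X in _ = X + _]mul1r -(rmorph1 (real_complex R)) -lL//.
  by congr L; apply/funext => x; rewrite mulr0 addr0.
by move=> /eqP; rewrite -subr_eq subrr eq_sym => /eqP.
Qed.

Lemma distribL_add f g : lsmooth f -> lsmooth g -> L (fun x => f x + g x) = L f + L g.
Proof.
move=> sf sg; have [lL _] := dL; rewrite -[L f]mul1r -(rmorph1 (real_complex R)) -lL//.
by congr L; apply/funext => x; rewrite mul1r.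
Qed.

Lemma distribL_scale (a : R) f : lsmooth f -> L (fun x => a * f x) = a%:C%C * L f.
Proof.
move=> sf; have [lL _] := dL; have := lL a f (fun=> 0) sf (@smooth_cst R d 0).
rewrite distrib_at0 addr0 => <-; congr L; apply/funext => x; by rewrite addr0.
Qed.

Lemma pairing_add h k : csmooth h -> csmooth k ->
  pairing L (fun x => h x + k x) = pairing L h + pairing L k.
Proof.
move=> [h1 h2] [k1 k2]; rewrite /pairing.
rewrite (_ : (fun x => Re _) = fun x => Re (h x) + Re (k x)); last by apply/funext => y; rewrite ReD.
rewrite (_ : (fun x => Im _) = fun x => Im (h x) + Im (k x)); last by apply/funext => y; rewrite ImD.
by rewrite !distribL_add//; ring.
Qed.

Lemma pairing_scale (c : C) h : csmooth h -> pairing L (fun x => c * h x) = c * pairing L h.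
Proof.
move=> [h1 h2]; rewrite /pairing.
rewrite (_ : (fun x => Re _) = fun x => Re c * Re (h x) + - Im c * Im (h x)); last first.
  by apply/funext => y; rewrite ReM mulNr.
rewrite (_ : (fun x => Im _) = fun x => Re c * Im (h x) + Im c * Re (h x)); last first.
  by apply/funext => y; rewrite ImM.
have sM a f : lsmooth f -> lsmooth (fun x => a * f x).
  by move=> sf; apply: smoothM => //; exact: smooth_cst.
rewrite !distribL_add ?distribL_scale//; try exact: sM.
rewrite [in RHS](complexE c) rmorphN.
have i2 : Complex 0 1 * Complex 0 1 = -1 :> C by rewrite -expr2 sqr_i.
set a := (Re c)%:C%C; set b := (Im c)%:C%C; set A := L _; set B := L _.
transitivity (a * A + a * Complex 0 1 * B + b * Complex 0 1 * A + b * (-1) * B); first by ring.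
by rewrite -i2; ring.
Qed.

Lemma pairing0 : pairing L (fun=> 0) = 0.
Proof. by rewrite /pairing distrib_at0 mulr0 addr0. Qed.

Lemma pairing_sum (T : Type) (t : seq T) (P : pred T) (h : T -> V -> C) :
  (forall a, csmooth (h a)) ->
  pairing L (fun x => \sum_(a <- t | P a) h a x) = \sum_(a <- t | P a) pairing L (h a).
Proof.
move=> sh; elim: t => [|a t IH].
  by rewrite big_nil -[RHS]pairing0; congr pairing; apply/funext => x; rewrite big_nil.
rewrite big_cons (_ : (fun _ => _) = fun x => if P a then h a x + \sum_(a <- t | P a) h a x
    else \sum_(a <- t | P a) h a x); last by apply/funext => x; rewrite big_cons.
by case: (P a); rewrite ?pairing_add ?IH//; exact: csmooth_sum.
Qed.

Lemma pairing_real f : pairing L (fun x => (f x)%:C%C) = L f.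
Proof. by rewrite /pairing /= distrib_at0 mulr0 addr0. Qed.

Lemma pairing_bound : exists (K r : R) (N : nat), [/\ 0 <= K, 0 < r &
  forall h, csmooth h -> forall M : R,
    (forall s, (size s <= N)%N -> forall x, `|x| <= r -> `|cdseq s h x| <= M%:C%C) ->
    `|pairing L h| <= (K * M)%:C%C].
Proof.
have [_ [K [r [N [K0 r0 hK]]]]] := dL; exists (2 * K), r, N; split => //.
  exact: mulr_ge0.
move=> h [h1 h2] M hM; rewrite (le_trans (ler_normD _ _))//.
rewrite -mulrA mulr_natl mulr2n rmorphD lerD//.
  apply: hK => // s ss x xr; have [+ _] := norm_Re_Im_le (hM s ss x xr).
  by rewrite (congr1 (fun u => u x) (Re_cdseq s h)).
have n1 : `|Complex 0 1| = 1 :> C by rewrite normc_def /= expr0n add0r expr1n sqrtr1.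
rewrite normrM n1 mul1r.
apply: hK => // s ss x xr; have [_] := norm_Re_Im_le (hM s ss x xr).
by rewrite (congr1 (fun u => u x) (Im_cdseq s h)).
Qed.

End Pairing.

End Functionals.

(** * Moments of finite rank *)

Section Holomorphic.
Variables (R : realType) (d n : nat) (pi : 'I_n * bool -> 'I_d).
Hypothesis pi_bij : bijective pi.
Local Notation V := 'rV[R]_d.
Local Notation C := R[i].
Local Notation Re := complex.Re.
Local Notation Im := complex.Im.
Implicit Types (f g u : V -> R) (h k : V -> C) (i : 'I_d) (j : 'I_n) (s : seq 'I_d) (x y : V).
Implicit Types (L : (V -> R) -> C).

Definition zcoord j x : C := Complex (x 0 (pi (j, false))) (x 0 (pi (j, true))).

Local Notation z := zcoord.

Definition dz i j : C := Complex (pi (j, false) == i)%:R (pi (j, true) == i)%:R.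

Lemma csmooth_z j : csmooth (z j).
Proof. by split; exact: smooth_coord. Qed.

Lemma cpartial_z i j : cpartial i (z j) = fun=> dz i j.
Proof. by apply/funext => x; rewrite /cpartial /= !partial_coord. Qed.

Lemma dz_le1 i j : `|dz i j| <= 1.
Proof.
rewrite normc_def /= -(rmorph1 (real_complex R)) lecR.
have : ~~ ((pi (j, false) == i) && (pi (j, true) == i)).
  by apply/negP => /andP[/eqP <- /eqP /(bij_inj pi_bij)].
by case: (_ == i); case: (_ == i) => // _; rewrite ?expr0n ?expr1n ?addr0 ?add0r ?sqrtr1 ?sqrtr0.
Qed.

Lemma norm_z_le j x (r : R) : `|x| <= r -> `|z j x| <= (2 * r)%:C%C.
Proof.
move=> xr; rewrite (le_trans (norm_complex_le _))// lecR mulr_natl mulr2n /=.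
by rewrite lerD// (le_trans (coord_le_norm _ _)).
Qed.

Lemma cpartial_horner i (P : {poly C}) h : csmooth h ->
  cpartial i (fun x => P.[h x]) = fun x => P^`().[h x] * cpartial i h x.
Proof.
move=> sh; elim/poly_ind: P => [|P c IH].
  rewrite (_ : (fun _ => _) = fun=> 0); last by apply/funext => x; rewrite horner0.
  by rewrite cpartial_cst deriv0; apply/funext => x; rewrite horner0 mul0r.
rewrite (_ : (fun _ => _) = fun x => P.[h x] * h x + c); last first.
  by apply/funext => x; rewrite !hornerE.
have sP := csmooth_horner P sh.
rewrite cpartialD; [|exact: csmoothM|exact: csmooth_cst].
rewrite cpartialM// IH cpartial_cst; apply/funext => x.
by rewrite derivD derivM derivX derivC !hornerE /=; ring.
Qed.

Lemma conjcM (a b : C) : conjc (a * b) = conjc a * conjc b. Proof. exact: rmorphM. Qed.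
Lemma conjcX (a : C) m : conjc (a ^+ m) = conjc a ^+ m. Proof. exact: rmorphXn. Qed.
Lemma conjcN (a : C) : conjc (- a) = - conjc a. Proof. exact: rmorphN. Qed.

Section Growth.
Variables (j : 'I_n) (t : C).

Definition twisted_exp (a b : nat) x : C :=
  (trunc_exp C a).[t * z j x] * ((trunc_exp C b).[- (t * z j x)])^*%C.

Lemma csmooth_tz : csmooth (fun x => t * z j x).
Proof. by apply: csmoothM; [exact: csmooth_cst|exact: csmooth_z]. Qed.

Lemma csmooth_Ntz : csmooth (fun x => - (t * z j x)).
Proof.
rewrite (_ : (fun _ => _) = fun x => (- t) * z j x); last by apply/funext => x; rewrite mulNr.
by apply: csmoothM; [exact: csmooth_cst|exact: csmooth_z].
Qed.

Lemma csmooth_twisted_exp a b : csmooth (twisted_exp a b).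
Proof.
apply: csmoothM; first exact/csmooth_horner/csmooth_tz.
exact/csmooth_conj/csmooth_horner/csmooth_Ntz.
Qed.

Lemma cpartial_twisted_exp i a b : cpartial i (twisted_exp a b) = fun x =>
  (t * dz i j) * twisted_exp a.-1 b x + - ((t * dz i j)^*%C) * twisted_exp a b.-1 x.
Proof.
have s1 := csmooth_tz; have s2 := csmooth_Ntz.
have p1 : cpartial i (fun x => t * z j x) = fun=> t * dz i j.
  rewrite cpartialM; [|exact: csmooth_cst|exact: csmooth_z].
  by rewrite cpartial_cst cpartial_z; apply/funext => x; rewrite mul0r add0r.
have p2 : cpartial i (fun x => - (t * z j x)) = fun=> - (t * dz i j).
  rewrite (_ : (fun x => - (t * z j x)) = fun x => (- 1) * (t * z j x)); last by apply/funext => x; rewrite mulN1r.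
  rewrite cpartialM; [|exact: csmooth_cst|exact: csmooth_tz].
  by rewrite cpartial_cst p1; apply/funext => x; rewrite mul0r add0r mulN1r.
rewrite cpartialM; [|exact: csmooth_horner|exact/csmooth_conj/csmooth_horner].
rewrite cpartial_conj; last exact: csmooth_horner.
rewrite !cpartial_horner// p1 p2; apply/funext => x.
rewrite !deriv_trunc_exp /twisted_exp rmorphM rmorphN /=.
by move: (_.[_]) (_.[_]^*)%C => A B; ring.
Qed.

(** A derivative yields two terms with coefficients at most [rho], each with one truncation order
    lowered. Starting from [n0 + size s] keeps both orders at least [n0]. *)
Lemma cdseq_twisted_exp_bound n0 (rho : C) x s : 0 <= rho -> `|t| <= rho ->
  (forall a b, (n0 <= a)%N -> (n0 <= b)%N -> `|twisted_exp a b x| <= 2) ->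
  forall a b, (n0 + size s <= a)%N -> (n0 + size s <= b)%N ->
  `|cdseq s (twisted_exp a b) x| <= (2 * (1 + rho)) ^+ size s * 2.
Proof.
move=> rho0 trho h; elim/last_ind: s => [|s i IH] a b ha hb.
  by rewrite expr0 mul1r /= h//; rewrite addn0 in ha hb.
rewrite size_rcons addnS in ha hb *.
have td : `|t * dz i j| <= rho.
  by rewrite normrM -[rho]mulr1 ler_pM// dz_le1.
have ctd : `|- (t * dz i j)^*%C| <= rho.
  by rewrite normrN (_ : `|_^*%C| = `|t * dz i j|)// !normc_def Re_conj Im_conj sqrrN.
have sE a' b' := csmooth_twisted_exp a' b'.
have sZ (c : C) a' b' : csmooth (fun x => c * twisted_exp a' b' x).
  by apply: csmoothM => //; exact: csmooth_cst.
rewrite cdseq_rcons cpartial_twisted_exp cdseqD// !cdseqZ//.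
have ha' : (n0 + size s <= a.-1)%N by case: a ha {IH}.
have hb' : (n0 + size s <= b.-1)%N by case: b hb {IH}.
have I1 := IH a.-1 b ha' (ltnW hb); have I2 := IH a b.-1 (ltnW ha) hb'.
have r1 : rho <= 1 + rho by rewrite lerDr.
rewrite (le_trans (ler_normD _ _))//.
have -> : (2 * (1 + rho)) ^+ (size s).+1 * 2 =
    (1 + rho) * ((2 * (1 + rho)) ^+ size s * 2) + (1 + rho) * ((2 * (1 + rho)) ^+ size s * 2).
  by rewrite exprS; ring.
apply: lerD; rewrite normrM ler_pM//; first exact: le_trans td r1.
exact: le_trans ctd r1.
Qed.

End Growth.

Lemma twisted_sumE j t m x (G : V -> C) :
  \sum_(a < m) \sum_(b < m) t ^+ a * (- t^*%C) ^+ b / (a`! * b`!)%:R *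
      (z j x ^+ a * (z j x ^+ b)^*%C * G x) = twisted_exp j t m m x * G x.
Proof.
rewrite /twisted_exp /trunc_exp !horner_poly rmorph_sum /= mulr_suml mulr_suml.
apply: eq_bigr => a _; rewrite mulr_sumr mulr_suml; apply: eq_bigr => b _.
have -> : (b`!%:R^-1 * (- (t * z j x)) ^+ b)^*%C = b`!%:R^-1 * (- (t^*%C * (z j x)^*%C)) ^+ b.
  have e1 : (b`!%:R^-1 : C)^*%C = b`!%:R^-1 by rewrite conjc_inv conjc_nat.
  by rewrite -[in RHS]e1 -conjcM -conjcN -conjcX -conjcM.
rewrite conjcX -mulNr !exprMn natrM invfM.
by move: (_^-1) (_^-1) => u1 u2; ring.
Qed.

(** The exponent is the order [N] of the distribution, each derivative contributing at most one
    factor 1 + rho. It is chosen before [j] and [G], so one exponent serves every application of the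
    shift lemma. *)
Lemma growth L : distrib L -> exists M : nat, forall j (G : V -> C), csmooth G ->
  exists2 K : C, 0 <= K & forall rho : C, 0 <= rho -> exists n0, forall m, (n0 <= m)%N ->
    forall t : C, `|t| <= rho ->
    `|\sum_(a < m) \sum_(b < m) t ^+ a * (- t^*%C) ^+ b / (a`! * b`!)%:R *
        pairing L (fun x => z j x ^+ a * (z j x ^+ b)^*%C * G x)| <= K * (1 + rho) ^+ M.
Proof.
move=> dL; have [K [r [N [K0 r0 hK]]]] := pairing_bound dL.
exists N => j G sG; have [A A0 hA] := csmooth_bound N r sG.
exists (K * (2 ^+ N * (2 ^+ N * 2 * A)))%:C%C.
  by rewrite -(rmorph0 (real_complex R)) lecR !mulr_ge0 ?exprn_ge0.
move=> rho rho0.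
have rhoR : rho = (Re rho)%:C%C by rewrite RRe_real// ger0_real.
have r'0 : 0 <= Re rho by rewrite -lecR -rhoR.
have [n0 hn0] := @trunc_exp_mul_bound R (Re rho * (2 * r)) (mulr_ge0 r'0 (mulr_ge0 (ler0n _ 2) (ltW r0))).
exists (n0 + N)%N => m hm t ht.
have szab a b : csmooth (fun x => z j x ^+ a * (z j x ^+ b)^*%C * G x).
  apply: csmoothM => //; apply: csmoothM; first exact/csmoothX/csmooth_z.
  exact/csmooth_conj/csmoothX/csmooth_z.
have -> : \sum_(a < m) \sum_(b < m) t ^+ a * (- t^*%C) ^+ b / (a`! * b`!)%:R *
        pairing L (fun x => z j x ^+ a * (z j x ^+ b)^*%C * G x) =
     pairing L (fun x => twisted_exp j t m m x * G x).
  rewrite (_ : (fun x => twisted_exp j t m m x * G x) = fun x => \sum_(a < m) \sum_(b < m)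
      t ^+ a * (- t^*%C) ^+ b / (a`! * b`!)%:R * (z j x ^+ a * (z j x ^+ b)^*%C * G x)); last first.
    by apply/funext => x; rewrite twisted_sumE.
  rewrite pairing_sum//; last first.
    move=> a; apply: csmooth_sum => b; apply: csmoothM => //; exact: csmooth_cst.
  apply: eq_bigr => a _; rewrite pairing_sum//; last first.
    move=> b; apply: csmoothM => //; exact: csmooth_cst.
  by apply: eq_bigr => b _; rewrite pairing_scale.
have E2 x : `|x| <= r -> forall a b, (n0 <= a)%N -> (n0 <= b)%N -> `|twisted_exp j t a b x| <= 2.
  move=> xr a b ha hb; rewrite /twisted_exp normrM.
  rewrite (_ : `|_^*%C| = `|(trunc_exp C b).[- (t * z j x)]|); last first.
    by rewrite !normc_def Re_conj Im_conj sqrrN.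
  rewrite -normrM; apply: hn0 => //.
  rewrite (_ : (Re rho * (2 * r))%:C%C = rho * (2 * r)%:C%C); last by rewrite [in RHS]rhoR -rmorphM.
  by rewrite normrM ler_pM//; exact: norm_z_le.
have -> : (K * (2 ^+ N * (2 ^+ N * 2 * A)))%:C%C * (1 + rho) ^+ N =
   (K * (2 ^+ N * ((2 * (1 + Re rho)) ^+ N * 2 * A)))%:C%C.
  rewrite exprMn {1}rhoR -(rmorph1 (real_complex R)) -rmorphD -rmorphXn -rmorphM.
  by congr (_%:C)%C; ring.
apply: hK; first by apply: csmoothM => //; exact: csmooth_twisted_exp.
have one_le : 1 <= 1 + rho by rewrite lerDl.
move=> s ss x xr; apply: (@le_trans _ _ (2 ^+ size s * (((2 * (1 + rho)) ^+ N * 2) * A%:C%C))).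
  apply: cdseq_mul_bound => //; first exact: csmooth_twisted_exp.
    move=> s' hs'; have s'N := leq_trans hs' ss.
    apply: (le_trans (@cdseq_twisted_exp_bound j t n0 rho x s' rho0 ht (E2 x xr) m m _ _)).
    - by rewrite (leq_trans _ hm)// leq_add2l.
    - by rewrite (leq_trans _ hm)// leq_add2l.
    rewrite ler_wpM2r// ler_weXn2l//.
    by rewrite (le_trans one_le)// ler_peMl ?ler1n// (le_trans ler01).
  by move=> s' hs'; apply: hA => //; exact: leq_trans hs' ss.
have -> : (2 ^+ N * ((2 * (1 + Re rho)) ^+ N * 2 * A))%:C%C =
    2 ^+ N * ((2 * (1 + rho)) ^+ N * 2 * A%:C%C).
  have e2 : (2%:R : R)%:C%C = 2 :> C by rewrite rmorph_nat.
  have e1 : (1 + Re rho)%:C%C = 1 + rho by rewrite [in RHS]rhoR rmorphD rmorph1.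
  by rewrite -e2 -e1 -!(rmorphM (real_complex R)) -!(rmorphXn (real_complex R)) -!(rmorphM (real_complex R)).
rewrite ler_wpM2r ?ler_weXn2l ?ler1n//.
rewrite !mulr_ge0 ?exprn_ge0 ?mulr_ge0 ?(le_trans ler01 one_le)//.
by rewrite -(rmorph0 (real_complex R)) lecR.
Qed.

End Holomorphic.

(** * Moments in the complex coordinates and their conjugates *)

Section FiniteRankMoments.
Variables (R : realType) (d n : nat) (pi : 'I_n * bool -> 'I_d).
Hypothesis pi_bij : bijective pi.
Local Notation V := 'rV[R]_d.
Local Notation C := R[i].
Local Notation Re := complex.Re.
Local Notation Im := complex.Im.
Local Notation z := (@zcoord R d n pi).
Local Notation A := {ffun 'I_n -> nat}.
Implicit Types (f g u : V -> R) (h k : V -> C) (i : 'I_d) (j : 'I_n) (s : seq 'I_d) (x y : V).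
Implicit Types (L : (V -> R) -> C) (a b c : A).

Definition zmon a x : C := \prod_j z j x ^+ a j.

Definition madd a b : A := [ffun j => (a j + b j)%N].
Definition mincr j a : A := [ffun l => (a l + (l == j))%N].

Lemma zmonD a b x : zmon (madd a b) x = zmon a x * zmon b x.
Proof. by rewrite /zmon -big_split; apply: eq_bigr => j _; rewrite ffunE exprD. Qed.

Lemma zmon_incr j a x : zmon (mincr j a) x = z j x * zmon a x.
Proof.
rewrite /zmon [LHS](bigD1 j)//= [in RHS](bigD1 j)//= ffunE eqxx addn1 exprS -mulrA.
congr (_ * (_ * _)); apply: eq_bigr => l lj.
by rewrite ffunE (negbTE lj) addn0.
Qed.

Lemma zmon_iter_incr m j a x : zmon (iter m (mincr j) a) x = z j x ^+ m * zmon a x.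
Proof. by elim: m => [|m IH]; rewrite ?expr0 ?mul1r// iterS zmon_incr IH exprS mulrA. Qed.

Lemma csmooth_zmon a : csmooth (zmon a).
Proof. by apply: csmooth_prod => j; exact/csmoothX/csmooth_z. Qed.

Definition zzmon a b x : C := zmon a x * (zmon b x)^*%C.

Lemma csmooth_zzmon a b : csmooth (zzmon a b).
Proof. by apply: csmoothM; [|apply: csmooth_conj]; exact: csmooth_zmon. Qed.

Definition moment L a b : C := pairing L (zzmon a b).

Lemma NumconjE (t : C) : Num.conj t = t^*%C. Proof. by []. Qed.

Lemma rank_le_comp (K : fieldType) (I J I' J' : Type) (B : I -> J -> K) (phi : I' -> I) (psi : J' -> J)
  (B' : I' -> J' -> K) m : rank_le B m -> (forall p q, B' p q = B (phi p) (psi q)) -> rank_le B' m.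
Proof.
move=> hB hBB' k l i j; rewrite (_ : \matrix_(_, _) _ = \matrix_(a, b) B (phi (i a)) (psi (j b))).
  exact: (hB k l (phi \o i) (psi \o j)).
by apply/matrixP => p q; rewrite !mxE hBB'.
Qed.

(** Only the first [m] coordinates carry a free exponent; raising [m] by one costs one application
    of the shift lemma. *)
Definition cutoff (m : nat) (c : A) : A := [ffun l : 'I_n => if (l < m)%N then c l else 0%N].

Lemma moments_shift L m : distrib L -> rank_le (moment L) m ->
  exists m', rank_le (fun a (bc : A * A) => moment L (madd a bc.2) bc.1) m'.
Proof.
move=> dL hm; have [M hM] := growth pi_bij dL.
have step (k : nat) : (k <= n)%N -> exists m', rank_le (fun a (bc : A * A) =>
     moment L (madd a (cutoff k bc.2)) bc.1) m'.
  elim: k => [_|k IH kn].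
    exists m; apply: (@rank_le_comp _ _ _ _ _ _ id (fun bc : A * A => bc.1) _ _ hm) => a [b c] /=.
    by congr moment; apply/ffunP => j; rewrite !ffunE addn0.
  have [m1 h1] := IH (ltnW kn); pose j := Ordinal kn.
  (* The right shift raises the antiholomorphic exponent [b] only and carries [c] along as a
     parameter. *)
  have [|m2 h2] := @shift_finite_rank _ _ _ _ (mincr j) (fun bc : A * A => (mincr j bc.1, bc.2)) m1 M h1.
    move=> a [b c]; have sG := csmooth_zzmon (madd a (cutoff k c)) b.
    have [K K0 hK] := hM j _ sG; exists K => // rho rho0.
    have [n0 hn0] := hK rho rho0; exists n0 => q hq t ht.
    rewrite (le_trans _ (hn0 q hq t ht))// le_eqVlt; apply/orP; left; apply/eqP; congr `|_|.
    apply: eq_bigr => p _; apply: eq_bigr => r _; rewrite NumconjE; congr (_ * _).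
    have -> : iter r (fun bc : A * A => (mincr j bc.1, bc.2)) (b, c) = (iter r (mincr j) b, c).
      by elim: (nat_of_ord r) => //= r' ->.
    rewrite /moment /=; congr pairing; apply/funext => x.
    rewrite /zzmon zmonD !zmon_iter_incr zmonD conjcM conjcX.
    by move: (_^*%C) (_^*%C) => u v; ring.
  exists m2.
  apply: (@rank_le_comp _ _ _ _ _ _ id (fun bc : A * A => (bc, bc.2 j)) _ _ h2) => a [b c] /=.
  congr moment; apply/ffunP => l; rewrite !ffunE.
  have -> : iter (c j) (mincr j) a l = (a l + (if l == j then c j else 0))%N.
    elim: (c j) => [|q IHq] /=; first by rewrite if_same addn0.
    by rewrite ffunE IHq; case: eqP; rewrite ?addn0// addn1 addnS.
  rewrite -addnA; congr (_ + _)%N; rewrite ltnS leq_eqVlt -(inj_eq val_inj) /=.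
  by case: (eqVneq (val l) k) => [e|] //=; rewrite ?add0n// ltnNge -e leqnn addn0; congr (c _); exact: val_inj.
have [m' h] := step n (leqnn n); exists m'.
apply: (@rank_le_comp _ _ _ _ _ _ id id _ _ h) => a [b c] /=.
by congr moment; apply/ffunP => l; rewrite !ffunE ltn_ord.
Qed.

Lemma pairing_conj L h : distrib L -> csmooth h ->
  pairing (fun f => (L f)^*%C) h = (pairing L (fun x => (h x)^*%C))^*%C.
Proof.
move=> dL [h1 h2]; rewrite /pairing.
rewrite (_ : (fun x => Re (h x)^*%C) = fun x => Re (h x)); last by apply/funext => y; rewrite Re_conj.
rewrite (_ : (fun x => Im (h x)^*%C) = fun x => (-1) * Im (h x)); last first.
  by apply/funext => y; rewrite Im_conj mulN1r.
rewrite (distribL_scale dL)//.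
move: (L _) (L _) => [a b] [a' b']; apply: complex_eqP => /=;
  rewrite ?(ReD, ImD, ReM, ImM, Re_conj, Im_conj) /=; ring.
Qed.

(** Conjugating the functional exchanges z and its conjugate; in this way the shift lemma, which
    acts on the holomorphic exponent, also reaches the antiholomorphic one. *)
Lemma moment_conj L a b : distrib L -> moment (fun f => (L f)^*%C) a b = (moment L b a)^*%C.
Proof.
move=> dL; rewrite /moment pairing_conj//; last exact: csmooth_zzmon.
congr (conjc (pairing L _)); apply/funext => x.
by rewrite /zzmon conjcM conjcK mulrC.
Qed.

(* The functionals [zzmon c e * L] span a finite-dimensional space. *)
Lemma moments_finite L m m1 : distrib L -> rank_le (moment L) m ->
  rank_le (moment (fun f => (L f)^*%C)) m1 ->
  exists (T : finType) (mu : T -> A * A -> C) (lam : A -> A -> T -> C),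
  forall a b c e, moment L (madd a c) (madd b e) = \sum_(t : T) lam a b t * mu t (c, e).
Proof.
move=> dL h h'; have dL' := distrib_conj dL.
have [m2 h2] := moments_shift dL h; have [m3 h3] := moments_shift dL' h'.
have [r [i0 [_ [lam [_ _ _ hlam]]]]] := rank_factor h2.
have [r' [i0' [_ [lam' [_ _ _ hlam']]]]] := rank_factor h3.
exists ('I_r * 'I_r')%type, (fun t ce => moment L (madd (i0 t.1) ce.1) (madd (i0' t.2) ce.2)),
  (fun a b t => lam a t.1 * (lam' b t.2)^*%C) => a b c e.
(* First [a] is replaced by reference rows [i0]; then the conjugate functional replaces [b] by
   reference rows [i0']. *)
rewrite (hlam a (madd b e, c)) /=.
under eq_bigr => p _.
  have := hlam' b (madd (i0 p) c, e); rewrite /= moment_conj// => /(congr1 conjc).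
  rewrite conjcK => ->; rewrite rmorph_sum mulr_sumr /=.
  under eq_bigr do rewrite conjcM moment_conj// conjcK mulrA.
  over.
by rewrite pair_big.
Qed.

Lemma zzmon_incrl j a b x : z j x * zzmon a b x = zzmon (mincr j a) b x.
Proof. by rewrite /zzmon zmon_incr mulrA. Qed.

Lemma zzmon_incrr j a b x : (z j x)^*%C * zzmon a b x = zzmon a (mincr j b) x.
Proof. by rewrite /zzmon zmon_incr conjcM mulrCA. Qed.

Lemma zzmon0 x : zzmon [ffun=> 0%N] [ffun=> 0%N] x = 1.
Proof.
rewrite /zzmon /zmon big1 => [|j _]; last by rewrite ffunE.
by rewrite mul1r conjc1.
Qed.

Lemma coord_z i : exists j (c1 c2 : C), forall x, (x 0 i)%:C%C = c1 * z j x + c2 * (z j x)^*%C.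
Proof.
have [pinv piK invK] := pi_bij; rewrite -(invK i); case: (pinv i) => j bb; exists j.
case: bb.
  exists (Complex 0 (- 2^-1)), (Complex 0 2^-1) => x; apply: complex_eqP;
  rewrite ?(ReD, ImD, ReM, ImM, Re_conj, Im_conj) /z /=; lra.
exists (Complex 2^-1 0), (Complex 2^-1 0) => x; apply: complex_eqP;
  rewrite ?(ReD, ImD, ReM, ImM, Re_conj, Im_conj) /z /=; lra.
Qed.

(* Real polynomials are polynomials in the [z_j] and their conjugates. *)
Lemma rpoly_zzmon_vanish L : distrib L -> (forall a b, moment L a b = 0) ->
  forall p, rpoly p -> L p = 0.
Proof.
move=> dL h p pp.
(* The free factor [g] carries the induction through products: [q1] is absorbed into [g] before [q2]
   is treated. *)
suff H : forall q, rpoly q -> forall g : V -> C, csmooth g ->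
    (forall a b, pairing L (fun x => g x * zzmon a b x) = 0) ->
    forall a b, pairing L (fun x => (g x * (q x)%:C%C) * zzmon a b x) = 0.
  have := H p pp (fun=> 1) (@csmooth_cst R d 1) _ [ffun=> 0%N] [ffun=> 0%N].
  rewrite -(pairing_real dL) => H'.
  transitivity (pairing L (fun x => 1 * (p x)%:C%C * zzmon [ffun=> 0%N] [ffun=> 0%N] x)).
    congr pairing; apply/funext => x; by rewrite mul1r zzmon0 mulr1.
  apply: H' => a b; rewrite -[RHS](h a b); congr pairing.
  by apply/funext => x; rewrite mul1r.
move=> q; elim=> [c|i|q1 q2 p1 I1 p2 I2|q1 q2 p1 I1 p2 I2] g sg hg a b.
- rewrite (_ : (fun x => _) = fun x => c%:C%C * (g x * zzmon a b x)); last first.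
    by apply/funext => x; ring.
  rewrite pairing_scale ?hg ?mulr0//; apply: csmoothM => //; exact: csmooth_zzmon.
- have [j [c1 [c2 hc]]] := coord_z i.
  have sz : forall a b, csmooth (fun x => g x * zzmon a b x).
    by move=> a' b'; apply: csmoothM => //; exact: csmooth_zzmon.
  rewrite (_ : (fun x => _) = fun x => c1 * (g x * zzmon (mincr j a) b x) + c2 * (g x * zzmon a (mincr j b) x)).
    rewrite (pairing_add dL) ?(pairing_scale dL)//; try by apply: csmoothM => //; exact: csmooth_cst.
    by rewrite !hg !mulr0 addr0.
  by apply/funext => x; rewrite hc -zzmon_incrl -zzmon_incrr; ring.
- have s1 := csmooth_real (rpoly_smooth p1); have s2 := csmooth_real (rpoly_smooth p2).
  rewrite (_ : (fun x => _) = fun x => g x * (q1 x)%:C%C * zzmon a b x + g x * (q2 x)%:C%C * zzmon a b x).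
    rewrite (pairing_add dL) ?I1 ?I2 ?addr0//; apply: csmoothM; try exact: csmooth_zzmon; exact: csmoothM.
  by apply/funext => x; rewrite rmorphD /=; ring.
have s1 := csmooth_real (rpoly_smooth p1).
rewrite (_ : (fun x => _) = fun x => (g x * (q1 x)%:C%C) * (q2 x)%:C%C * zzmon a b x).
  by apply: I2; [exact: csmoothM|exact: I1].
by apply/funext => x; rewrite rmorphM /=; ring.
Qed.

End FiniteRankMoments.

(** * Polynomials annihilating the distribution *)

Section Annihilator.
Variables (R : realType) (d n : nat) (pi : 'I_n * bool -> 'I_d).
Hypothesis pi_bij : bijective pi.
Local Notation V := 'rV[R]_d.
Local Notation C := R[i].
Local Notation Re := complex.Re.
Local Notation Im := complex.Im.
Local Notation z := (@zcoord R d n pi).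
Local Notation zzmon := (@zzmon R d n pi).
Local Notation moment := (@moment R d n pi).
Implicit Types (f g : V -> R) (h : V -> C) (i : 'I_d) (x y : V) (L : (V -> R) -> C).

(** The product of [L] with a complex function; as [L] acts on real test functions only, it is
    written through [pairing]. *)
Lemma distrib_cmul L h : distrib L -> csmooth h ->
  distrib (fun f => pairing L (fun x => h x * (f x)%:C%C)).
Proof.
move=> dL [h1 h2].
rewrite (_ : (fun _ => _) = fun f => L (fun x => Re (h x) * f x) + Complex 0 1 * L (fun x => Im (h x) * f x)).
  by apply: distribD; [|apply: distribZ]; exact: distrib_mul.
apply/funext => f; rewrite /pairing; congr (L _ + _ * L _); apply/funext => x.
  by rewrite ReM /= mulr0 subr0.
by rewrite ImM /= mulr0 add0r.
Qed.

Lemma pairing_cmul L h k : distrib L -> csmooth h -> csmooth k ->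
  pairing (fun f => pairing L (fun x => h x * (f x)%:C%C)) k = pairing L (fun x => h x * k x).
Proof.
move=> dL sh [k1 k2]; have r1 := csmooth_real k1; have r2 := csmooth_real k2.
rewrite {1}/pairing -(pairing_scale dL); last exact: csmoothM.
rewrite -(pairing_add dL); [|exact: csmoothM|by apply: csmoothM; [exact: csmooth_cst|exact: csmoothM]].
congr pairing; apply/funext => x; rewrite [in RHS](complexE (k x)); ring.
Qed.

(** On the [zzmon], multiplying [L] by a power of x_i gives a combination of [#|T|] fixed
    functionals, so [#|T|.+1] powers admit a nontrivial linear relation. The resulting functional
    vanishes on polynomials, hence by density on all smooth functions. *)
Lemma coord_annihilator L m m1 i : distrib L -> rank_le (moment L) m ->
  rank_le (moment (fun f => (L f)^*%C)) m1 ->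
  exists2 q : {poly C}, q != 0 & forall h, csmooth h ->
    pairing L (fun x => q.[(x 0 i)%:C%C] * h x) = 0.
Proof.
move=> dL h h'; have [T [mu [lam hlam]]] := moments_finite pi_bij dL h h'.
have sx : csmooth (fun x => (x 0 i)%:C%C) by apply: csmooth_real; exact: smooth_coord.
have szz a b : csmooth (zzmon a b) by exact: csmooth_zzmon.
pose W (u : V -> C) := exists cf : T -> C, forall c e,
  pairing L (fun x => u x * zzmon c e x) = \sum_t cf t * mu t (c, e).
have Wpow k a b : W (fun x => (x 0 i)%:C%C ^+ k * zzmon a b x).
  elim: k a b => [|k IH] a b.
    exists (lam a b) => c e; rewrite -hlam; congr pairing; apply/funext => x.
    rewrite expr0 mul1r /zzmon !zmonD conjcM.
    by move: (_^*%C) (_^*%C) => u v; ring.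
  have [j [c1 [c2 hx]]] : exists j (c1 c2 : C), forall x, (x 0 i)%:C%C = c1 * z j x + c2 * (z j x)^*%C.
    exact: coord_z.
  have [cf1 e1] := IH (mincr j a) b; have [cf2 e2] := IH a (mincr j b).
  exists (fun t => c1 * cf1 t + c2 * cf2 t) => c e.
  have sk u v : csmooth (fun x => (x 0 i)%:C%C ^+ k * zzmon u v x * zzmon c e x).
    by apply: csmoothM => //; apply: csmoothM => //; exact: csmoothX.
  rewrite (_ : (fun x => _) = fun x =>
      c1 * ((x 0 i)%:C%C ^+ k * zzmon (mincr j a) b x * zzmon c e x) +
      c2 * ((x 0 i)%:C%C ^+ k * zzmon a (mincr j b) x * zzmon c e x)); last first.
    apply/funext => x; rewrite exprS [X in X * _ ^+ _]hx -zzmon_incrl -zzmon_incrr; ring.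
  rewrite (pairing_add dL) ?(pairing_scale dL)//; try by apply: csmoothM => //; exact: csmooth_cst.
  rewrite e1 e2 !mulr_sumr -big_split; apply: eq_bigr => t _ /=; ring.
have Wk k : W (fun x => (x 0 i)%:C%C ^+ k).
  have [cf hcf] := Wpow k [ffun=> 0%N] [ffun=> 0%N]; exists cf => c e.
  by rewrite -hcf; congr pairing; apply/funext => x; rewrite zzmon0 mulr1.
have /choice[cf hcf] := Wk.
pose N := #|T|; pose M := \matrix_(k < N.+1, t < N) cf k (enum_val t).
have /rowV0Pn[u uker u0] : kermx M != 0.
  by rewrite kermx_eq0 /row_free neq_ltn ltnS rank_leq_col.
have {}uker : u *m M = 0 by apply/sub_kermxP.
pose q := \poly_(k < N.+1) u 0 (inord k).
exists q.
  apply: contraNneq u0 => q0; apply/eqP/rowP => k.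
  have := congr1 (fun p : {poly C} => p`_k) q0.
  by rewrite /= coef_poly ltn_ord inord_val coef0 mxE.
have sq : csmooth (fun x => q.[(x 0 i)%:C%C]) by exact: csmooth_horner.
have dq := distrib_cmul dL sq.
have q0 a b : moment (fun f => pairing L (fun x => q.[(x 0 i)%:C%C] * (f x)%:C%C)) a b = 0.
  rewrite /moment pairing_cmul//.
  rewrite (_ : (fun x => _) = fun x => \sum_(k < N.+1) u 0 k * ((x 0 i)%:C%C ^+ k * zzmon a b x)); last first.
    apply/funext => x; rewrite horner_poly mulr_suml; apply: eq_bigr => k _.
    by rewrite inord_val -mulrA.
  have sk k : csmooth (fun x => (x 0 i)%:C%C ^+ k * zzmon a b x).
    by apply: csmoothM => //; exact: csmoothX.
  rewrite (pairing_sum dL); last by move=> k; apply: csmoothM; [exact: csmooth_cst|exact: sk].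
  under eq_bigr do rewrite (pairing_scale dL _ (sk _)) hcf mulr_sumr.
  rewrite exchange_big /= big1// => t _.
  have ut : \sum_(k < N.+1) u 0 k * cf k t = 0.
    have := congr1 (fun w : 'rV_N => w 0 (enum_rank t)) uker; rewrite /= !mxE => h0; rewrite -[RHS]h0.
    by apply: eq_bigr => k _; rewrite mxE enum_rankK.
  under eq_bigr do rewrite mulrA.
  by rewrite -mulr_suml ut mul0r.
move=> k [k1 k2].
have z0 := distrib_density dq (rpoly_zzmon_vanish pi_bij dq q0).
rewrite -(pairing_cmul dL sq)//.
apply: etrans (_ : 0 + Complex 0 1 * 0 = 0); last by rewrite mulr0 addr0.
by congr (_ + _ * _); exact: z0.
Qed.

Lemma root_free_factor (Q : {poly R}) : Q != 0 -> exists (ws : seq R) (S : {poly R}),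
  Q = \prod_(w <- ws) ('X - w%:P) * S /\ forall t : R, S.[t] != 0.
Proof.
have [m] := ubnP (size Q); elim: m Q => // m IH Q sQ Q0.
have [[w /eqP rw]|nr] := pselect (exists w, Q.[w] == 0); last first.
  exists [::], Q; rewrite big_nil mul1r; split => // x.
  by apply/negP => hx; apply: nr; exists x.
have /factor_theorem[S eS] : root Q w by apply/eqP.
have S0 : S != 0 by apply: contraNneq Q0 => S0; rewrite eS S0 mul0r.
have [|ws [S' [e h]]] := IH S _ S0.
  by move: sQ; rewrite eS size_Mmonic ?monicXsubC// size_XsubC addn2.
by exists (w :: ws), S'; split => //; rewrite big_cons eS e; ring.
Qed.

Lemma real_annihilator L m m1 i : distrib L -> rank_le (moment L) m ->
  rank_le (moment (fun f => (L f)^*%C)) m1 ->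
  exists ws : seq R, forall f, lsmooth f ->
    L (fun x => (\prod_(w <- ws) ('X - w%:P)).[x 0 i] * f x) = 0.
Proof.
move=> dL h h'; have [q q0 hq] := coord_annihilator i dL h h'.
pose P1 : {poly R} := \poly_(k < size q) Re q`_k.
pose P2 : {poly R} := \poly_(k < size q) Im q`_k.
pose c1 := map_poly (real_complex R) P1; pose c2 := map_poly (real_complex R) P2.
have qE : q = c1 + (Complex 0 1)%:P * c2.
  by apply/polyP => k; rewrite coefD coefCM !coef_map /=; exact: complexE.
have ii : (Complex 0 1 : C) * Complex 0 1 = -1 by rewrite -expr2 sqr_i.
(* The product of [q] with its coefficientwise conjugate: a real polynomial, equal to |q|^2 on the
   real line, and still annihilating as a multiple of [q]. *)
pose Q := P1 ^+ 2 + P2 ^+ 2.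
have QE : map_poly (real_complex R) Q = q * (c1 - (Complex 0 1)%:P * c2).
  rewrite rmorphD !rmorphXn /= -/c1 -/c2 qE.
  have {}ii : (Complex 0 1 : C)%:P * (Complex 0 1)%:P = -1 by rewrite -polyCM ii polyCN.
  move: (_%:P) ii => I ii; transitivity (c1 ^+ 2 - (I * I) * c2 ^+ 2); last by ring.
  by rewrite ii; ring.
have Q0 : Q != 0.
  apply: contraNneq q0 => Q0.
  move/eqP: QE; rewrite Q0 rmorph0 eq_sym mulf_eq0 => /orP[//|/eqP e0].
  apply/eqP/polyP => k; have := congr1 (fun p : {poly C} => p`_k) e0.
  rewrite coefB coefCM !coef_map !coef0 /=; case: (q`_k) => a b /= /eqP.
  rewrite eq_complex /= => /andP[/eqP e1 /eqP e2].
  by apply: complex_eqP => /=; lra.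
have [ws [S [eQ S0]]] := root_free_factor Q0.
exists ws => f sf.
have sS : lsmooth (fun x => S.[x 0 i]) by exact: smooth_horner_coord.
(* This quotient is smooth but in general not a polynomial: here it matters that [q] annihilates on
   all smooth functions. *)
have sg : lsmooth (fun x => f x / S.[x 0 i]).
  by apply: smoothM => //; apply: smoothV => // x; exact: S0.
pose qb := c1 - (Complex 0 1)%:P * c2.
have sx : csmooth (fun x => (x 0 i)%:C%C) by apply: csmooth_real; exact: smooth_coord.
have sk : csmooth (fun x => qb.[(x 0 i)%:C%C] * (f x / S.[x 0 i])%:C%C).
  by apply: csmoothM; [exact: csmooth_horner|exact: csmooth_real].
rewrite -[RHS](hq _ sk) -(pairing_real dL); congr pairing; apply/funext => x.
rewrite mulrA -hornerM -QE horner_map /= -rmorphM; congr (_%:C)%C.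
by rewrite eQ hornerM; field.
Qed.

Lemma common_annihilator L m m1 : distrib L -> rank_le (moment L) m ->
  rank_le (moment (fun f => (L f)^*%C)) m1 ->
  exists (W : seq R) (K : nat), uniq W /\ forall i f, lsmooth f ->
    L (fun x => (\prod_(w <- W) ('X - w%:P) ^+ K).[x 0 i] * f x) = 0.
Proof.
move=> dL h h'.
have /choice[ws hws] := fun i => real_annihilator i dL h h'.
pose U := flatten [seq ws i | i <- enum 'I_d].
(* A common multiple for all coordinates: every root that occurs, each with the crude multiplicity
   [size U]. *)
exists (undup U), (size U); split; first exact: undup_uniq.
move=> i f sf.
have : \prod_(w <- ws i) ('X - w%:P) %| \prod_(w <- undup U) ('X - w%:P) ^+ size U.
  apply: (@dvdp_trans _ (\prod_(w <- U) ('X - w%:P))).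
    have : i \in enum 'I_d by rewrite mem_enum.
    rewrite /U big_flatten big_map /=; elim: (enum 'I_d) => // i' s IH.
    rewrite inE big_cons => /orP[/eqP <-|/IH]; first exact: dvdp_mulr.
    exact: dvdp_mull.
  rewrite -prodr_undup_exp_count.
  elim: (undup U) => [|w s IH]; first by rewrite !big_nil.
  by rewrite !big_cons dvdp_mul// dvdp_exp2l// count_size.
move=> /dvdpP[S ->].
rewrite -[RHS](hws i (fun x => S.[x 0 i] * f x)).
  by congr L; apply/funext => x; rewrite hornerM; ring.
by apply: smoothM => //; exact: smooth_horner_coord.
Qed.

End Annihilator.

(** * Support in finitely many points *)

Section Hermite.
Variable R : realType.
Implicit Types (P Q : {poly R}).

Lemma taylor_dvdp P (w : R) (K : nat) :
  ('X - w%:P) ^+ K %| P - \sum_(l < K) (P^`(l).[w] / l`!%:R) *: ('X - w%:P) ^+ l.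
Proof.
(* The expansion is padded to [K + size P] terms so that it can be cut at [K] whatever the degree of
   [P]. *)
have T : P = \sum_(l < K + size P) P^`N(l).[w] *: ('X - w%:P) ^+ l.
  have c : GRing.comm w%:P ('X - w%:P : {poly R}) by exact: mulrC.
  have sP : (size (map_poly (@polyC R) P) <= K + size P)%N.
    by rewrite size_map_polyC leq_addl.
  have := nderiv_taylor_wide c sP; rewrite addrC subrK => e.
  rewrite -[LHS]comp_polyXr /comp_poly e; apply: eq_bigr => l _.
  by rewrite nderivn_map horner_map /= mul_polyC.
have e l : P^`(l).[w] / l`!%:R = P^`N(l).[w].
  by rewrite nderivn_def hornerMn -[_ *+ _]mulr_natr mulfK// pnatr_eq0 -lt0n fact_gt0.
under eq_bigr do rewrite e.
rewrite {1}T -(big_mkord xpredT (fun l => P^`N(l).[w] *: ('X - w%:P) ^+ l)).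
rewrite -(big_mkord xpredT (fun l => P^`N(l).[w] *: ('X - w%:P) ^+ l)).
rewrite (big_cat_nat (leq0n K) (leq_addr _ _)) /= addrAC subrr add0r.
rewrite big_nat; apply: (big_ind (fun r => ('X - w%:P) ^+ K %| r)) => [|p q hp hq|l /andP[Kl _]]; first exact: dvdp0.
  exact: dvdp_add.
by rewrite -mul_polyC dvdp_mull// dvdp_exp2l.
Qed.

Variables (k K : nat) (w : 'I_k -> R).
Hypothesis w_inj : injective w.

Lemma coprime_pow (a b : 'I_k) : a != b -> coprimep (('X - (w a)%:P) ^+ K) (('X - (w b)%:P) ^+ K).
Proof.
move=> ab; rewrite coprimep_expl// coprimep_expr// coprimep_XsubC root_XsubC.
by rewrite (inj_eq w_inj) eq_sym.
Qed.

Lemma prod_pow_dvdp (s : seq 'I_k) P : uniq s ->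
  (forall a, a \in s -> ('X - (w a)%:P) ^+ K %| P) -> \prod_(a <- s) ('X - (w a)%:P) ^+ K %| P.
Proof.
elim: s => [|a s IH] /=; first by rewrite big_nil dvd1p.
move=> /andP[ans us] h; rewrite big_cons Gauss_dvdp.
  by rewrite h ?inE ?eqxx//= IH// => b bs; rewrite h// inE bs orbT.
rewrite big_seq; apply: (big_ind (fun r => coprimep (('X - (w a)%:P) ^+ K) r)) => [|p q hp hq|b bs].
- exact: coprimep1.
- by rewrite coprimepMr hp.
- by apply: coprime_pow; apply: contraNneq ans => ->.
Qed.

(** Chinese remainders: Bezout gives [E a] congruent to 1 modulo the power at [w a] and to 0 modulo
    the powers at the other nodes, and these glue the Taylor polynomials of [P]. The [H a l] are
    chosen before [P], so the interpolant is linear in the derivatives of [P] at the nodes. *)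
Lemma hermite : exists H : 'I_k -> 'I_K -> {poly R}, forall P,
  \prod_(a < k) ('X - (w a)%:P) ^+ K %|
    P - \sum_(a < k) \sum_(l < K) P^`(l).[w a] *: H a l.
Proof.
have /choice[E hE] : forall a : 'I_k, exists E : {poly R},
    ('X - (w a)%:P) ^+ K %| 1 - E /\ forall b, b != a -> ('X - (w b)%:P) ^+ K %| E.
  move=> a.
  have : coprimep (\prod_(b < k | b != a) ('X - (w b)%:P) ^+ K) (('X - (w a)%:P) ^+ K).
    apply: (big_ind (fun r => coprimep r (('X - (w a)%:P) ^+ K))) => [|p q hp hq|b ba].
    - exact: coprime1p.
    - by rewrite coprimepMl hp.
    - exact: coprime_pow.
  move=> /Bezout_eq1_coprimepP[[u v] /= uv].
  exists (u * \prod_(b < k | b != a) ('X - (w b)%:P) ^+ K); split.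
    by move: uv; set g := u * _ => uv; rewrite -uv addrAC subrr add0r dvdp_mull.
  by move=> b ba; rewrite dvdp_mull// (bigD1 b)//= dvdp_mulr.
exists (fun a l => (l`!%:R)^-1 *: (E a * ('X - (w a)%:P) ^+ l)) => P.
apply: prod_pow_dvdp; first exact: index_enum_uniq.
move=> b _.
pose T a := \sum_(l < K) (P^`(l).[w a] / l`!%:R) *: ('X - (w a)%:P) ^+ l.
rewrite (_ : \sum_(a < k) _ = \sum_(a < k) E a * T a); last first.
  apply: eq_bigr => a _; rewrite mulr_sumr; apply: eq_bigr => l _.
  by rewrite scalerA -scalerAr.
rewrite (bigD1 b)//= opprD addrA; apply: dvdp_sub; last first.
  apply: (big_ind (fun r => ('X - (w b)%:P) ^+ K %| r)) => [|p q hp hq|a ab]; first exact: dvdp0.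
    exact: dvdp_add.
  by rewrite dvdp_mulr// (hE a).2// eq_sym.
have -> : P - E b * T b = (P - T b) + (1 - E b) * T b by ring.
apply: dvdp_add; first exact: taylor_dvdp.
by rewrite dvdp_mulr// (hE b).1.
Qed.

End Hermite.

(** * Reduction to point masses *)

Section PointSupport.
Variables (R : realType) (d : nat).
Local Notation V := 'rV[R]_d.
Local Notation C := R[i].
Implicit Types (f g : V -> R) (i : 'I_d) (x y : V) (L : (V -> R) -> C) (P : 'I_d -> {poly R}).

Definition tensor P x : R := \prod_i (P i).[x 0 i].

Lemma smooth_tensor P : lsmooth (tensor P).
Proof. by apply: smooth_prod => i _; exact: smooth_horner_coord. Qed.

Lemma partial_tensor j P :
  partial j (tensor P) = tensor (fun i => if i == j then (P i)^`() else P i).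
Proof.
pose q x := \prod_(i | i != j) (P i).[x 0 i].
have sq : lsmooth q by apply: smooth_prod => i _; exact: smooth_horner_coord.
have iq : indep j q.
  by move=> x t; apply: eq_bigr => i ij; rewrite updE (negbTE ij).
rewrite (_ : tensor P = fun x => (P j).[x 0 j] * q x); last first.
  by apply/funext => x; rewrite /tensor (bigD1 j).
rewrite partialM//; last exact: smooth_horner_coord.
rewrite partial_horner_coord eqxx (indep_partial0 sq iq).
apply/funext => x; rewrite mulr0 addr0 /tensor (bigD1 j)//= eqxx; congr (_ * _).
by apply: eq_bigr => i /negbTE ->.
Qed.

Lemma dseq_tensor s P : dseq s (tensor P) = tensor (fun i => (P i)^`(count_mem i s)).
Proof.
elim: s => [|j s IH] //=; rewrite IH partial_tensor; congr tensor; apply/funext => i.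
by rewrite eq_sym; case: eqP => _; rewrite ?add1n ?add0n// derivnS.
Qed.

Lemma dmulti_tensor (a : 'I_d -> nat) P : dmulti a (tensor P) = tensor (fun i => (P i)^`(a i)).
Proof.
rewrite /dmulti dseq_tensor; congr tensor; apply/funext => i; congr (_^`(_)).
rewrite count_flatten -map_comp sumnE big_map big_enum /= (bigD1 i)//= big1 ?addn0.
  by rewrite count_nseq /= eqxx mul1n.
by move=> j ji; rewrite count_nseq /= (negbTE ji).
Qed.

Lemma tensor_vanish L : distrib L -> (forall P, L (tensor P) = 0) ->
  forall p, rpoly p -> L p = 0.
Proof.
move=> dL h p pp.
have t1 x : tensor (fun=> 1) x = 1 by rewrite /tensor big1// => i _; rewrite hornerC.
suff H : forall q, rpoly q -> forall g, lsmooth g -> (forall P, L (fun x => g x * tensor P x) = 0) ->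
    forall P, L (fun x => g x * q x * tensor P x) = 0.
  rewrite -(H p pp (fun=> 1) (@smooth_cst R d 1) _ (fun=> 1)).
    by congr L; apply/funext => x; rewrite t1 mul1r mulr1.
  by move=> P; rewrite -[RHS](h P); congr L; apply/funext => x; rewrite mul1r.
move=> q; elim=> [c|i|q1 q2 p1 I1 p2 I2|q1 q2 p1 I1 p2 I2] g sg hg P.
- rewrite -[RHS](mulr0 c%:C%C) -(hg P) -(distribL_scale dL).
    by congr L; apply/funext => x; ring.
  by apply: smoothM => //; exact: smooth_tensor.
- rewrite -[RHS](hg (fun l => if l == i then 'X * P l else P l)); congr L; apply/funext => x.
  rewrite -mulrA; congr (_ * _); rewrite /tensor (bigD1 i)//= [in RHS](bigD1 i)//= eqxx.
  rewrite hornerM hornerX mulrA; congr (_ * _).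
  by apply: eq_bigr => l /negbTE ->.
- rewrite -[RHS]addr0 -{1}(I1 g sg hg P) -{1}(I2 g sg hg P) -(distribL_add dL).
  + by congr L; apply/funext => x; ring.
  + by apply: smoothM; [apply: smoothM => //; exact: rpoly_smooth|exact: smooth_tensor].
  + by apply: smoothM; [apply: smoothM => //; exact: rpoly_smooth|exact: smooth_tensor].
rewrite -[RHS](I2 _ _ (I1 g sg hg) P).
  by congr L; apply/funext => x; ring.
by apply: smoothM => //; exact: rpoly_smooth.
Qed.

Lemma distrib_Ldelta N (c : {ffun 'I_d -> 'I_N} -> C) x0 : distrib (Ldelta c x0).
Proof.
rewrite /Ldelta; apply: distrib_sum => a.
rewrite (_ : (fun _ => _) = fun f => (c a * ((-1) ^+ (\sum_(i < d) (a i : nat)))%:C%C) *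
    (dmulti (fun i => a i : nat) f x0)%:C%C).
  by apply: distribZ; exact: distrib_eval.
by apply/funext => f; rewrite rmorphM mulrA.
Qed.

Lemma distrib_tensor_congr L (Q : {poly R}) P P' : distrib L ->
  (forall i f, lsmooth f -> L (fun x => Q.[x 0 i] * f x) = 0) ->
  (forall i, Q %| P i - P' i) -> L (tensor P) = L (tensor P').
Proof.
move=> dL hQ PP'.
(* Arbitrary multipliers [u] are included so that the relation survives one more tensor factor. *)
pose Z f g := [/\ lsmooth f, lsmooth g & forall u, lsmooth u -> L (fun x => u x * (f x - g x)) = 0].
suff [sf sg h] : Z (tensor P) (tensor P').
  have := h _ (@smooth_cst R d 1).
  have -> : (fun x => 1 * (tensor P x - tensor P' x)) = fun x => tensor P x + (-1) * tensor P' x.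
    by apply/funext => x; ring.
  rewrite (distribL_add dL)// ?(distribL_scale dL)//.
    by rewrite rmorphN rmorph1 mulN1r => /eqP; rewrite subr_eq0 => /eqP.
  by apply: smoothM => //; exact: smooth_cst.
rewrite /tensor; elim: (index_enum _) => [|i s [sf sg IH]].
  rewrite (_ : (fun _ => _) = fun=> 1); last by apply/funext => x; rewrite big_nil.
  rewrite (_ : (fun _ => _) = fun=> 1); last by apply/funext => x; rewrite big_nil.
  split; try exact: smooth_cst.
  move=> u su; rewrite -(distrib_at0 dL); congr L; apply/funext => x; ring.
pose a x := \prod_(i <- s) (P i).[x 0 i]; pose b x := \prod_(i <- s) (P' i).[x 0 i].
rewrite (_ : (fun _ => _) = fun x => (P i).[x 0 i] * a x); last by apply/funext => x; rewrite big_cons.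
rewrite (_ : (fun x => \prod_(_ <- _ :: _) _) = fun x => (P' i).[x 0 i] * b x); last first.
  by apply/funext => x; rewrite big_cons.
have sP := smooth_horner_coord (P i) i; have sP' := smooth_horner_coord (P' i) i.
split; try exact: smoothM.
move=> u su; have /dvdpP[S eS] := PP' i.
rewrite (_ : (fun x => _) = fun x => Q.[x 0 i] * (u x * S.[x 0 i] * a x) + (u x * (P' i).[x 0 i]) * (a x - b x)).
  rewrite (distribL_add dL).
  - rewrite hQ ?IH ?addr0//; first exact: smoothM.
    by apply: smoothM => //; apply: smoothM => //; exact: smooth_horner_coord.
  - apply: smoothM; first exact: smooth_horner_coord.
    by apply: smoothM => //; apply: smoothM => //; exact: smooth_horner_coord.
  - by apply: smoothM; [exact: smoothM|exact: smoothB].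
apply/funext => x; have : (P i).[x 0 i] = (P' i).[x 0 i] + S.[x 0 i] * Q.[x 0 i].
  by rewrite -hornerM -eS hornerD hornerN addrC subrK.
by move=> ->; ring.
Qed.

(** The candidate points fill a grid, since the coordinates are annihilated separately. By density
    both sides need only be compared on tensor products, where [L] sees each factor modulo the
    annihilator, that is, through its Hermite interpolant. *)
Lemma point_support L (W : seq R) (K : nat) : distrib L -> uniq W ->
  (forall i f, lsmooth f -> L (fun x => (\prod_(w <- W) ('X - w%:P) ^+ K).[x 0 i] * f x) = 0) ->
  exists (k : nat) (w : 'I_k -> R) (c : {ffun 'I_d -> 'I_k} -> {ffun 'I_d -> 'I_K} -> C),
    injective w /\ forall f, lsmooth f ->
      L f = \sum_(G : {ffun 'I_d -> 'I_k}) Ldelta (c G) (\row_i w (G i)) f.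
Proof.
move=> dL uW hL; pose k := size W; pose w (a : 'I_k) := nth 0 W a.
have wi : injective w.
  by move=> a b /eqP; rewrite /w nth_uniq// => /eqP/val_inj.
have [H hH] := hermite K wi.
have {}hL i f : lsmooth f -> L (fun x => (\prod_(a < k) ('X - (w a)%:P) ^+ K).[x 0 i] * f x) = 0.
  by move=> sf; rewrite -[RHS](hL i f sf) (big_nth 0) big_mkord.
(* Cancels the sign that [Ldelta] attaches to a derivative of order |a|. *)
pose sgn (a : {ffun 'I_d -> 'I_K}) : R := (-1) ^+ (\sum_(i < d) (a i : nat)).
pose c (G : {ffun 'I_d -> 'I_k}) (a : {ffun 'I_d -> 'I_K}) :=
  (sgn a)%:C%C * L (tensor (fun i => H (G i) (a i))).
exists k, w, c; split => // f sf.
pose D f := L f + (-1) * \sum_(G : {ffun 'I_d -> 'I_k}) Ldelta (c G) (\row_i w (G i)) f.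
have dD : distrib D.
  apply: distribD => //; apply: distribZ; apply: distrib_sum => G; exact: distrib_Ldelta.
suff : D f = 0 by rewrite /D mulN1r => /eqP; rewrite subr_eq0 => /eqP.
apply: (distrib_density dD) sf; apply: (tensor_vanish dD) => P.
apply/eqP; rewrite /D mulN1r subr_eq0; apply/eqP.
rewrite (distrib_tensor_congr dL hL (fun i => hH (P i))).
have sT (G : {ffun 'I_d -> 'I_k}) (a : {ffun 'I_d -> 'I_K}) (r : R) :
    lsmooth (fun x => r * tensor (fun i => H (G i) (a i)) x).
  by apply: smoothM; [exact: smooth_cst|exact: smooth_tensor].
transitivity (L (fun x => \sum_(G : {ffun 'I_d -> 'I_k}) \sum_(a : {ffun 'I_d -> 'I_K})
   (\prod_i ((P i)^`(a i)).[w (G i)]) * tensor (fun i => H (G i) (a i)) x)).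
  congr L; apply/funext => x; rewrite /tensor.
  under eq_bigr => i _.
    rewrite horner_sum; under eq_bigr => a _.
      rewrite horner_sum; under eq_bigr do rewrite hornerZ.
      over.
    over.
  rewrite bigA_distr_bigA /=; apply: eq_bigr => G _.
  by rewrite bigA_distr_bigA /=; apply: eq_bigr => a _; rewrite big_split.
rewrite -(pairing_real dL).
transitivity (pairing L (fun x => \sum_(G : {ffun 'I_d -> 'I_k}) \sum_(a : {ffun 'I_d -> 'I_K})
   ((\prod_i ((P i)^`(a i)).[w (G i)]) * tensor (fun i => H (G i) (a i)) x)%:C%C)).
  congr pairing; apply/funext => x; rewrite rmorph_sum; apply: eq_bigr => G _.
  by rewrite rmorph_sum.
have sC (G : {ffun 'I_d -> 'I_k}) (a : {ffun 'I_d -> 'I_K}) := csmooth_real (sT G a (\prod_i ((P i)^`(a i)).[w (G i)])).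
rewrite (pairing_sum dL); last by move=> G; exact: csmooth_sum.
apply: eq_bigr => G _; rewrite (pairing_sum dL)//; apply: eq_bigr => a _.
rewrite (pairing_real dL) (distribL_scale dL); last exact: smooth_tensor.
rewrite dmulti_tensor /c mulrAC -rmorphM /sgn mulrA -exprMn mulrNN mulr1 expr1n mul1r.
by congr (_%:C%C * _); apply: eq_bigr => i _; rewrite mxE.
Qed.

End PointSupport.

(** * Counting the points *)

Section HolomorphicPolynomials.
Variables (R : realType) (d n : nat) (pi : 'I_n * bool -> 'I_d).
Hypothesis pi_bij : bijective pi.
Local Notation V := 'rV[R]_d.
Local Notation C := R[i].
Local Notation Re := complex.Re.
Local Notation Im := complex.Im.
Local Notation z := (@zcoord R d n pi).
Local Notation zmon := (@zmon R d n pi).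
Implicit Types (h k g : V -> C) (i : 'I_d) (j : 'I_n) (x y : V).

Inductive hol : (V -> C) -> Prop :=
| hol_cst (c : C) : hol (fun=> c)
| hol_z j : hol (z j)
| holD h k : hol h -> hol k -> hol (fun x => h x + k x)
| holM h k : hol h -> hol k -> hol (fun x => h x * k x).

Lemma hol_csmooth h : hol h -> csmooth h.
Proof.
elim=> [c|j|{}h k _ sh _ sk|{}h k _ sh _ sk].
- exact: csmooth_cst.
- exact: csmooth_z.
- exact: csmoothD.
- exact: csmoothM.
Qed.

Lemma holX h m : hol h -> hol (fun x => h x ^+ m).
Proof.
move=> hh; elim: m => [|m IH]; first exact: (hol_cst 1).
rewrite (_ : (fun _ => _) = fun x => h x * h x ^+ m); first exact: holM.
by apply/funext => x; rewrite exprS.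
Qed.

Lemma hol_zmon a : hol (zmon a).
Proof.
rewrite /zmon; elim: (index_enum _) => [|j s IH].
  by rewrite (_ : (fun _ => _) = fun=> 1); [exact: hol_cst|apply/funext => x; rewrite big_nil].
rewrite (_ : (fun _ => _) = fun x => z j x ^+ a j * \prod_(l <- s) z l x ^+ a l).
  by apply: holM => //; apply: holX; exact: hol_z.
by apply/funext => x; rewrite big_cons.
Qed.

(** The second part is the Cauchy-Riemann equation in the variable z_j; the first part allows it to
    be used twice, which gives harmonicity. *)
Lemma hol_cauchy_riemann h j : hol h -> hol (cpartial (pi (j, false)) h) /\
  cpartial (pi (j, true)) h = fun x => Complex 0 1 * cpartial (pi (j, false)) h x.
Proof.
elim=> [c|l|{}h k hh [h1 h2] hk [k1 k2]|{}h k hh [h1 h2] hk [k1 k2]].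
- by rewrite !cpartial_cst; split; [exact: hol_cst|apply/funext => x; rewrite mulr0].
- rewrite !cpartial_z; split; first exact: hol_cst.
  apply/funext => x; rewrite /dz !(inj_eq (bij_inj pi_bij)) !xpair_eqE /= ?andbT ?andbF.
  by case: eqP => _; apply: complex_eqP; rewrite ?(ReM, ImM) /=; ring.
- have sh := hol_csmooth hh; have sk := hol_csmooth hk.
  rewrite !cpartialD// h2 k2; split; first exact: holD.
  by apply/funext => x; rewrite mulrDr.
have sh := hol_csmooth hh; have sk := hol_csmooth hk.
rewrite !cpartialM// h2 k2; split; first by apply: holD; exact: holM.
by apply/funext => x; ring.
Qed.

Lemma hol_laplacian h x : hol h -> \sum_(i < d) cpartial i (cpartial i h) x = 0.
Proof.
move=> hh; rewrite (reindex pi) /=; last exact: onW_bij.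
transitivity (\sum_(j < n) \sum_(b : bool) cpartial (pi (j, b)) (cpartial (pi (j, b)) h) x).
  by rewrite pair_big /=; apply: eq_bigr => -[].
rewrite big1// => j _; rewrite big_bool /=.
have [h1 h2] := hol_cauchy_riemann j hh; have [_ h3] := hol_cauchy_riemann j h1.
have s1 := hol_csmooth h1.
rewrite h2 cpartialM//; last exact: csmooth_cst.
rewrite cpartial_cst h3 mul0r add0r mulrA -expr2 sqr_i mulN1r addNr//.
Qed.

Definition mono_list (s : seq (C * {ffun 'I_d -> nat})) x : C :=
  \sum_(ca <- s) ca.1 * \prod_(i < d) (x 0 i)%:C%C ^+ ca.2 i.

Lemma mono_list_coord s i : exists s', forall x, mono_list s x * (x 0 i)%:C%C = mono_list s' x.
Proof.
exists [seq (ca.1, [ffun l => (ca.2 l + (l == i))%N]) | ca : C * {ffun 'I_d -> nat} <- s] => x.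
rewrite /mono_list big_map mulr_suml; apply: eq_bigr => ca _ /=.
rewrite -mulrA; congr (_ * _); rewrite (bigD1 i)//= [in RHS](bigD1 i)//= ffunE eqxx.
rewrite addn1 exprSr mulrAC; congr (_ * _); apply: eq_bigr => l li.
by rewrite ffunE (negbTE li) addn0.
Qed.

Lemma mono_list_scale s (c : C) : exists s', forall x, mono_list s x * c = mono_list s' x.
Proof.
exists [seq (c * ca.1, ca.2) | ca : C * {ffun 'I_d -> nat} <- s] => x.
rewrite /mono_list big_map mulr_suml; apply: eq_bigr => ca _ /=.
by rewrite mulrC mulrA.
Qed.

Lemma mono_listD s s' x : mono_list s x + mono_list s' x = mono_list (s ++ s') x.
Proof. by rewrite /mono_list big_cat. Qed.

(** With an arbitrary left factor [s], the product case just chains the two induction hypotheses,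
    and two sparse polynomials never have to be multiplied. *)
Lemma hol_mono_list h : hol h -> forall s, exists s', forall x, mono_list s x * h x = mono_list s' x.
Proof.
elim=> [c|j|{}h k _ hh _ hk|{}h k _ hh _ hk] s.
- exact: mono_list_scale.
- have [s1 e1] := mono_list_coord s (pi (j, false)).
  have [s2 e2] := mono_list_coord s (pi (j, true)).
  have [s3 e3] := mono_list_scale s2 (Complex 0 1).
  exists (s1 ++ s3) => x; rewrite -mono_listD -e1 -e3 -e2.
  by rewrite [z j x]complexE /z /=; ring.
- have [s1 e1] := hh s; have [s2 e2] := hk s; exists (s1 ++ s2) => x.
  by rewrite -mono_listD -e1 -e2 mulrDr.
have [s1 e1] := hh s; have [s2 e2] := hk s1; exists s2 => x.
by rewrite -e2 -e1 mulrA.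
Qed.

Lemma mono_list_cpoly s : cpoly (mono_list s).
Proof.
pose N := (\max_(ca <- s) \max_(i < d) ca.2 i).+1.
have hN ca i : ca \in s -> (ca.2 i < N)%N.
  move=> cs; rewrite ltnS; apply: leq_trans (leq_bigmax_seq _ cs isT).
  exact: (leq_bigmax (F := fun i => ca.2 i)).
(* The coefficient is a sum because the list may repeat an exponent. *)
exists N, (fun a : {ffun 'I_d -> 'I_N} => \sum_(ca <- s) if [forall i, ca.2 i == a i :> nat] then ca.1 else 0) => x.
under [RHS]eq_bigr do rewrite mulr_suml.
rewrite exchange_big /= /mono_list big_seq [RHS]big_seq; apply: eq_bigr => ca cs.
rewrite (bigD1 [ffun i => Ordinal (hN ca i cs)]) //= ifT; last first.
  by apply/forallP => i; rewrite ffunE.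
rewrite [X in _ + X]big1 ?addr0 => [|a ane]; last first.
  case: ifP => [/forallP ha|_]; last by rewrite mul0r.
  case/negP: ane; apply/eqP/ffunP => i; by apply: val_inj; rewrite ffunE /= (eqP (ha i)).
by congr (_ * _); apply: eq_bigr => i _; rewrite ffunE.
Qed.

Lemma hol_harmonic h : hol h -> harmonic_poly h.
Proof.
move=> hh; split.
  have [s e] := hol_mono_list hh [:: (1, [ffun=> 0%N])].
  rewrite (_ : h = mono_list s); first exact: mono_list_cpoly.
  apply/funext => x; rewrite -e /mono_list big_seq1 big1 ?mul1r// => i _.
  by rewrite ffunE.
move=> x; have := hol_laplacian x hh => e.
have ReS (F : 'I_d -> C) : Re (\sum_(i < d) F i) = \sum_(i < d) Re (F i).
  by elim/big_ind2 : _ => // a b c' d' <- <-; rewrite ReD.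
have ImS (F : 'I_d -> C) : Im (\sum_(i < d) F i) = \sum_(i < d) Im (F i).
  by elim/big_ind2 : _ => // a b c' d' <- <-; rewrite ImD.
by split; [have := congr1 (@complex.Re R) e; rewrite ReS|have := congr1 (@complex.Im R) e; rewrite ImS].
Qed.

End HolomorphicPolynomials.

(** * Vanishing to high order at a point *)

Section Flat.
Variables (R : realType) (d : nat).
Local Notation V := 'rV[R]_d.
Local Notation C := R[i].
Local Notation Re := complex.Re.
Local Notation Im := complex.Im.
Implicit Types (h k : V -> C) (i : 'I_d) (x y : V).

Definition flat y N h := forall s : seq 'I_d, (size s < N)%N -> cdseq s h y = 0.

Lemma flatM y M N h k : csmooth h -> csmooth k -> flat y M h -> flat y N k ->
  flat y (M + N) (fun x => h x * k x).
Proof.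
move=> sh sk fh fk s; elim/last_ind: s M N h k sh sk fh fk => [|s i IH] M N h k sh sk fh fk.
  case: M fh => [|M] fh hs; first by have /= k0 := fk [::] hs; rewrite k0 mulr0.
  by have /= h0 := fh [::] isT; rewrite h0 mul0r.
have si := csmooth_cpartial i.
have fl N' u : flat y N' u -> flat y N'.-1 (cpartial i u).
  move=> fu s' hs'; rewrite -cdseq_rcons; apply: fu; rewrite size_rcons.
  by case: N' hs'.
rewrite size_rcons => hs.
rewrite cdseq_rcons cpartialM// cdseqD; try by apply: csmoothM => //; exact: si.
rewrite (IH M.-1 N)//; [|exact: si|exact: fl|by move: hs; clear; lia].
rewrite (IH M N.-1) ?addr0//; [exact: si|exact: fl|by move: hs; clear; lia].
Qed.

Lemma flatMl y N h k : csmooth h -> csmooth k -> flat y N h -> flat y N (fun x => h x * k x).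
Proof. by move=> sh sk fh; rewrite -[N]addn0; exact: flatM. Qed.

Lemma flat_conj y N h : csmooth h -> flat y N h -> flat y N (fun x => (h x)^*%C).
Proof.
move=> sh fh s hs.
have -> : cdseq s (fun x => (h x)^*%C) = fun x => (cdseq s h x)^*%C.
  elim: s {hs} => //= i s ->; rewrite cpartial_conj//; exact: csmooth_cdseq.
by rewrite fh// conjc0.
Qed.

Lemma flatX y N h : csmooth h -> h y = 0 -> flat y N (fun x => h x ^+ N).
Proof.
move=> sh hy; elim: N => [//|N IH].
rewrite (_ : (fun _ => _) = fun x => h x * h x ^+ N); last by apply/funext => x; rewrite exprS.
rewrite -add1n; apply: flatM => //; first exact: csmoothX.
by move=> s; rewrite ltnS leqn0 size_eq0 => /eqP ->.
Qed.

Lemma size_dmulti_word (a : 'I_d -> nat) K : (forall i, a i < K)%N ->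
  (size (flatten [seq nseq (a i) i | i <- enum 'I_d]) < (d * K).+1)%N.
Proof.
move=> aK; rewrite ltnS size_flatten /shape -map_comp sumnE big_map big_enum /=.
rewrite -[d in (d * K)%N]card_ord -sum_nat_const leq_sum// => i _.
by rewrite size_nseq ltnW.
Qed.

(** A multi-index with [d] entries below [K] has order at most [d * K], which flatness of order
    [(d * K).+1] covers. *)
Lemma pairing_Ldelta_flat K (c : {ffun 'I_d -> 'I_K} -> C) y h :
  flat y (d * K).+1 h -> pairing (Ldelta c y) h = 0.
Proof.
move=> fh.
have hs (a : {ffun 'I_d -> 'I_K}) := size_dmulti_word (fun i => ltn_ord (a i)).
rewrite /pairing /Ldelta !big1 ?mulr0 ?addr0// => a _.
  have := congr1 (@complex.Im R) (fh _ (hs a)).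
  rewrite (congr1 (fun u => u y) (Im_cdseq _ _)) /= /dmulti => ->.
  by rewrite mulr0 rmorph0 mulr0.
have := congr1 (@complex.Re R) (fh _ (hs a)).
rewrite (congr1 (fun u => u y) (Re_cdseq _ _)) /= /dmulti => ->.
by rewrite mulr0 rmorph0 mulr0.
Qed.

End Flat.

(** * Localization at a single point *)

Section RankLowerBound.
Variables (R : realType) (d n : nat) (pi : 'I_n * bool -> 'I_d).
Hypothesis pi_bij : bijective pi.
Local Notation V := 'rV[R]_d.
Local Notation C := R[i].
Local Notation Re := complex.Re.
Local Notation Im := complex.Im.
Local Notation z := (@zcoord R d n pi).
Local Notation zmon := (@zmon R d n pi).
Local Notation hol := (@hol R d n pi).
Implicit Types (h k : V -> C) (i : 'I_d) (j : 'I_n) (x y : V) (L : (V -> R) -> C).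

(** A product of factors (z_j - z_j(x))^N, one for each point x to be killed, with [j] a complex
    coordinate in which x differs from [y]. *)
Lemma killer N y (s : seq V) : y \notin s -> exists2 kap : V -> C, hol kap &
  kap y != 0 /\ forall x, x \in s -> flat x N kap.
Proof.
elim: s => [_|x s IH].
  by exists (fun=> 1); [exact: hol_cst|split => //; exact: oner_neq0].
rewrite inE negb_or => /andP[yx /IH[kap hk [ky kf]]].
have [i yi] : exists i, y 0 i != x 0 i.
  apply/existsP; apply: contraNT yx; rewrite negb_exists => /forallP h.
  by apply/eqP/rowP => i; apply/eqP; move: (h i); rewrite negbK.
have [pinv piK invK] := pi_bij; case e : (pinv i) => [j b].
have ei : i = pi (j, b) by rewrite -e invK.
have zyx : z j y - z j x != 0.
  rewrite subr_eq0; apply: contraNN yi => /eqP; rewrite ei /z => -[e1 e2].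
  by case: b {e ei} => /=; rewrite ?e1 ?e2.
have hl : hol (fun x' => z j x' + - z j x) by apply: holD; [exact: hol_z|exact: hol_cst].
have sk := hol_csmooth hk; have sl := hol_csmooth hl; have slN := csmoothX N sl.
exists (fun x' => (z j x' + - z j x) ^+ N * kap x').
  by apply: holM => //; exact: holX hl.
split; first by rewrite mulf_neq0// expf_neq0.
move=> x'; rewrite inE => /orP[/eqP ->|/kf fl].
  by apply: flatMl => //; apply: flatX => //; rewrite subrr.
rewrite (_ : (fun _ => _) = fun x' => kap x' * (z j x' + - z j x) ^+ N); first exact: flatMl.
by apply/funext => u; rewrite mulrC.
Qed.

(** If all these pairings vanished, |kap|^2 times the point functional would vanish on every
    [zzmon], hence on every smooth function. As |kap|^2 is nonzero at [y], it is invertible modulo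
    functions flat at [y], so the point functional itself would be zero. *)
Lemma local_pairing_neq0 K (c : {ffun 'I_d -> 'I_K} -> C) y kap p :
  hol kap -> kap y != 0 -> rpoly p -> Ldelta c y p != 0 ->
  exists f g, [/\ hol f, hol g &
    pairing (Ldelta c y) (fun x => (kap x * f x) * (kap x * g x)^*%C) != 0].
Proof.
move=> hk ky pp; apply: contra_neqP => hno.
have dL := distrib_Ldelta c y; have sk := hol_csmooth hk.
pose u x := Re (kap x) ^+ 2 + Im (kap x) ^+ 2.
have uE x : (u x)%:C%C = kap x * (kap x)^*%C by rewrite -sqr_normc add_Re2_Im2.
have su : lsmooth u by case: sk => s1 s2; apply: smoothD; exact: smoothX.
have u0 : u y != 0.
  apply: contraNneq ky => u0; have := uE y; rewrite u0 => /esym/eqP.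
  by rewrite rmorph0 mulf_eq0 conjc_eq0 orbb.
pose D f := Ldelta c y (fun x => u x * f x).
have dD : distrib D by exact: distrib_mul.
have D0 : forall f, rpoly f -> D f = 0.
  apply: (rpoly_zzmon_vanish pi_bij dD) => a b; apply/eqP; apply: contraT => nz.
  case: hno; exists (zmon a), (zmon b); split; [exact: hol_zmon|exact: hol_zmon|].
  apply: contraNN nz => /eqP e; apply/eqP; rewrite -{}e /moment.
  rewrite {1}/pairing /D /pairing; congr (Ldelta c y _ + _ * Ldelta c y _); apply/funext => x.
    have -> : kap x * zmon a x * (kap x * zmon b x)^*%C = (u x)%:C%C * zzmon pi a b x.
      by rewrite uE /zzmon conjcM; move: (_^*%C) (_^*%C) => w1 w2; ring.
    by rewrite [RHS]ReM /= mul0r subr0.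
  have -> : kap x * zmon a x * (kap x * zmon b x)^*%C = (u x)%:C%C * zzmon pi a b x.
    by rewrite uE /zzmon conjcM; move: (_^*%C) (_^*%C) => w1 w2; ring.
  by rewrite [RHS]ImM /= mul0r addr0.
have sp := rpoly_smooth pp.
pose N := (d * K).+1; pose v x := 1 - u x / u y.
have sv : lsmooth v.
  by apply: smoothB; [exact: smooth_cst|apply: smoothM => //; exact: smooth_cst].
pose psi x := (u y)^-1 * \sum_(l < N) v x ^+ l.
have spsi : lsmooth psi.
  by apply: smoothM; [exact: smooth_cst|apply: smooth_sum => l _; exact: smoothX].
have pE : p = fun x => u x * (psi x * p x) + v x ^+ N * p x.
  apply/funext => x.
  have : u x * psi x = 1 - v x ^+ N.
    have := subrX1 (v x) N; rewrite /psi mulrA => e.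
    have -> : u x / u y = - (v x - 1) by rewrite /v; ring.
    by rewrite mulNr -e; ring.
  by move=> e; rewrite [u x * (_ * p x)]mulrA e; ring.
have svN : lsmooth (fun x => v x ^+ N) by exact: smoothX.
rewrite pE (distribL_add dL); try exact: smoothM; last by apply: smoothM => //; exact: smoothM.
rewrite -[X in X + _]/(D (fun x => psi x * p x)) (distrib_density dD D0); last exact: smoothM.
rewrite add0r -(pairing_real dL); apply: pairing_Ldelta_flat.
rewrite (_ : (fun _ => _) = fun x => ((v x)%:C%C) ^+ N * (p x)%:C%C); last first.
  by apply/funext => x; rewrite rmorphM rmorphXn.
apply: flatMl; [exact/csmoothX/csmooth_real|exact: csmooth_real|].
apply: flatX; first exact: csmooth_real.
by rewrite /v divff// subrr.
Qed.

End RankLowerBound.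

Section PointCount.
Variables (R : realType) (d n : nat) (pi : 'I_n * bool -> 'I_d).
Hypothesis pi_bij : bijective pi.
Local Notation V := 'rV[R]_d.
Local Notation C := R[i].
Local Notation hol := (@hol R d n pi).

Lemma point_count (L : (V -> R) -> C) m (I : finType) K
    (c : I -> {ffun 'I_d -> 'I_K} -> C) (X : I -> V) :
  injective X ->
  (forall f, lsmooth f -> L f = \sum_(a : I) Ldelta (c a) (X a) f) ->
  (forall a, exists2 p, rpoly p & Ldelta (c a) (X a) p != 0) ->
  (forall (k l : nat) (f : 'I_k -> V -> C) (g : 'I_l -> V -> C),
     (forall a, harmonic_poly (f a)) -> (forall b, harmonic_poly (g b)) ->
     (\rank (Hsub L f g) <= m)%N) -> (#|I| <= m)%N.
Proof.
move=> Xi hL hc hrk; pose N := (d * K).+1.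
have /choice[fg hfg] : forall a : I, exists fg : (V -> C) * (V -> C),
    [/\ hol fg.1, hol fg.2, forall b, b != a -> flat (X b) N fg.1,
        forall b, b != a -> flat (X b) N fg.2 &
        pairing (Ldelta (c a) (X a)) (fun x => fg.1 x * (fg.2 x)^*%C) != 0].
  move=> a; have ya : X a \notin [seq X b | b <- enum I & b != a].
    apply/mapP => -[b]; rewrite mem_filter => /andP[ba _] /Xi ab.
    by rewrite ab eqxx in ba.
  have [kap hk [ky kf]] := killer pi_bij N ya.
  have [p pp pn] := hc a.
  have [f [g [hf hg hfg]]] := local_pairing_neq0 pi_bij hk ky pp pn.
  have sk := hol_csmooth hk.
  have kfl b : b != a -> flat (X b) N kap.
    by move=> ba; apply: kf; apply: map_f; rewrite mem_filter ba mem_enum.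
  exists (fun x => kap x * f x, fun x => kap x * g x); split => //=.
  - exact: holM.
  - exact: holM.
  - by move=> b /kfl fl; apply: flatMl fl => //; exact: hol_csmooth hf.
  - by move=> b /kfl fl; apply: flatMl fl => //; exact: hol_csmooth hg.
have dL a : distrib (Ldelta (c a) (X a)) by exact: distrib_Ldelta.
have pL h : csmooth h -> pairing L h = \sum_a pairing (Ldelta (c a) (X a)) h.
  by move=> [h1 h2]; rewrite /pairing !hL// big_split /= mulr_sumr.
pose f (q : 'I_#|I|) := (fg (enum_val q)).1; pose g (q : 'I_#|I|) := (fg (enum_val q)).2.
have := hrk _ _ f g.
(* Off the diagonal, one of the two factors is flat at every point: [f q] at all points other than
   that of q, and [g r] at the point of q. *)
have -> : Hsub L f g = diag_mx (\row_q pairing (Ldelta (c (enum_val q)) (X (enum_val q)))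
    (fun x => f q x * (g q x)^*%C)).
  apply/matrixP => q r; rewrite !mxE.
  have [f1 _ ff _ _] := hfg (enum_val q); have [_ g1 _ gg _] := hfg (enum_val r).
  have sf := hol_csmooth f1; have sg := csmooth_conj (hol_csmooth g1).
  rewrite pL; last exact: csmoothM.
  rewrite (bigD1 (enum_val q))//= big1 ?addr0 => [|b bq]; last first.
    by apply: pairing_Ldelta_flat; apply: flatMl => //; exact: ff.
  case: eqP => [<-|/eqP qr]; first by rewrite mulr1n.
  rewrite mulr0n; apply: pairing_Ldelta_flat.
  rewrite (_ : (fun _ => _) = fun x => (g r x)^*%C * f q x); last first.
    by apply/funext => x; rewrite mulrC.
  apply: flatMl => //; apply: flat_conj; first exact: hol_csmooth g1.
  by apply: gg; rewrite (inj_eq enum_val_inj).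
rewrite mxrank_unit; last first.
  rewrite unitmxE det_diag unitfE prodf_seq_neq0; apply/allP => q _ /=.
  by rewrite mxE; have [] := hfg (enum_val q).
by apply=> q; apply: (hol_harmonic pi_bij); have [] := hfg (enum_val q).
Qed.

End PointCount.

(** The moment matrix of the conjugate functional is the conjugate transpose of a matrix of the same
    kind for [L], so the same bound holds for both. *)
Lemma HF_rank_moment (R : realType) (d n : nat) (pi : 'I_n * bool -> 'I_d)
  (L : ('rV[R]_d -> R) -> R[i]) m : bijective pi -> distrib L ->
  (forall (k l : nat) (f : 'I_k -> 'rV[R]_d -> R[i]) (g : 'I_l -> 'rV[R]_d -> R[i]),
     (forall a, harmonic_poly (f a)) -> (forall b, harmonic_poly (g b)) ->
     (\rank (Hsub L f g) <= m)%N) ->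
  rank_le (moment pi L) m /\ rank_le (moment pi (fun f => (L f)^*%C)) m.
Proof.
move=> pb dL h; have hz a : harmonic_poly (@zmon R d n pi a).
  by apply: (hol_harmonic pb); exact: hol_zmon.
split=> k l i j.
  exact: (h k l (fun a => zmon pi (i a)) (fun b => zmon pi (j b))).
rewrite (_ : \matrix_(_, _) _ =
    map_mx (@conjc R) (Hsub L (fun b => zmon pi (j b)) (fun a => zmon pi (i a)))^T).
  by rewrite mxrank_map mxrank_tr; exact: h.
by apply/matrixP => a b; rewrite !mxE moment_conj.
Qed.

Unset Implicit Arguments.

Theorem theorem5p1 (R : realType) (n : nat) (hn : (0 < n)%N)
  (F : ('rV[R]_(2 * n) -> R) -> R[i]) (m : nat) :
  compact_distribution F ->
  HF_rank F m ->
  exists (m0 : nat), (m0 <= m)%N /\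
    exists (xs : 'I_m0 -> 'rV[R]_(2 * n)) (N : nat)
           (L : 'I_m0 -> {ffun 'I_(2 * n) -> 'I_N} -> R[i]),
      forall phi : 'rV[R]_(2 * n) -> R, smooth phi ->
        F phi = \sum_(q < m0) Ldelta (L q) (xs q) phi.
Proof.
move=> /compact_distribution_distrib dF [hrk _].
have [pi pb] : exists pi : 'I_n * bool -> 'I_(2 * n), bijective pi.
  have e : #|{: 'I_n * bool}| = (2 * n)%N by rewrite card_prod card_ord card_bool mulnC.
  exists (cast_ord e \o enum_rank); apply: bij_comp; last exact: enum_rank_bij.
  by exists (cast_ord (esym e)); [exact: cast_ordK|exact: cast_ordKV].
have [r1 r2] := HF_rank_moment pb dF hrk.
have [W [K [uW hW]]] := common_annihilator pb dF r1 r2.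
have [k [w [c [wi hc]]]] := point_support dF uW hW.
pose X (G : {ffun 'I_(2 * n) -> 'I_k}) : 'rV[R]_(2 * n) := \row_i w (G i).
have Xi : injective X.
  move=> G G' /rowP e; apply/ffunP => i; have := e i; rewrite !mxE; exact: wi.
(* A grid point whose functional vanishes on polynomials contributes nothing, by density. Only the
   others are kept, because the count against the rank needs a nonzero functional at each point. *)
pose sel := [pred G | `[< exists2 p, rpoly p & Ldelta (c G) (X G) p != 0 >]].
pose I := {G | G \in sel}.
have hI f : lsmooth f -> F f = \sum_(a : I) Ldelta (c (val a)) (X (val a)) f.
  move=> sf; rewrite hc// (bigID sel) /= [X in _ + X]big1 ?addr0.
    exact: (big_sub sel (fun G => Ldelta (c G) (X G) f)).
  move=> G /asboolPn nG; apply: (distrib_density (distrib_Ldelta (c G) (X G))) sf => p pp.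
  by apply/eqP; apply: contraT => np; case: nG; exists p.
exists #|{: I}|; split.
  apply: (point_count pb (c := fun a : I => c (val a)) (X := fun a => X (val a)) _ hI _ hrk).
    by move=> a b /Xi/val_inj.
  by move=> a; apply/asboolP; exact: (valP a).
exists (fun q => X (val (enum_val q : I))), K, (fun q => c (val (enum_val q : I))) => phi.
rewrite -lsmoothE => sphi; rewrite hI// (reindex (enum_val (A := {: I})))//.
by apply: onW_bij; exact: enum_val_bij.
Qed.
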